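(* Let $\Delta$ be a simple root system. (a) The period of the Kostant partition function of $\Delta$ divides the least common multiple of all possible orders of elements of the groups $\Lambda_{\mathbb{Z}}(\Delta)/\Lambda_{\mathbb{Z}}(\Delta_1)$, where $\Delta_1$ runs over all root subsystems of $\Delta$ that have the same rank as $\Delta$. (b) The set of all possible orders of elements of $\Lambda_{\mathbb{Z}}(\Delta)/\Lambda_{\mathbb{Z}}(\Delta_1)$ (over all $\Delta_1$ as in (a)), and a number of which the period of the Kostant partition function of $\Delta$ is a divisor, are as follows: - type $A_n$: orders $\{1\}$; period divides $1$; - types $B_n$, $C_n$, $D_n$: orders $\{1,2\}$; period divides $2$; - type $E_6$: orders $\{1,2,3\}$; period divides $6$; - type $E_7$: orders $\{1,2,3,4\}$; period divides $12$; - type $E_8$: orders $\{1,2,3,4,5,6\}$; period divides $60$; - type $F_4$: orders $\{1,2,3,4\}$; period divides $12$; - type $G_2$: orders $\{1,2,3\}$; period divides $6$.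
   Context: $\Delta$ is an irreducible reduced finite root system of type $A_n$ ($n\ge2$), $B_n$ ($n\ge2$), $C_n$ ($n\ge2$), $D_n$ ($n\ge4$), $E_6,E_7,E_8,F_4$ or $G_2$; $n$ is its rank and $\Delta^+$ a set of positive roots. Coordinates are taken with respect to the corresponding basis of simple roots, so that $\Lambda_{\mathbb{Z}}(\Delta)=\mathbb{Z}^n$ and positive roots have nonnegative integer coordinates. $\Lambda_{\mathbb{Z}}(S)$ denotes the lattice of integral linear combinations of $S$. The Kostant partition function $P(\gamma)$ is the number of ways to write $\gamma$ as a linear combination of the elements of $\Delta^+$ with nonnegative integer coefficients. Let the boundaries of the cones spanned by $(n-1)$-element linearly independent subsets of $\Delta^+$ split the cone $\{\sum_{\alpha\in\Delta^+}a_\alpha\alpha\mid a_\alpha\in\mathbb{Q}_{\ge0}\}$ into closed full-dimensional polyhedral cones (chambers); on each chamber $P$ agrees with a unique quasipolynomial in the sense below. The statement that the period of the Kostant partition function divides a number $D$ means that for every chamber the period of the corresponding quasipolynomial divides $D$. Quasipolynomials and periods: for positive integers $m,d$, an $m\times n$ integer matrix $M$ and an $m\times1$ integer column $c$, the basic quasinumber $\tau_{M,c,d}$ is the function on $\mathbb{C}^n$ with $\tau_{M,c,d}(\gamma)=1$ if $\gamma\in\mathbb{Z}^n$ and $M\gamma\equiv c\pmod d$, and $0$ otherwise. Quasipolynomials are the elements of the ring of functions on $\mathbb{C}^n$ generated over $\mathbb{Q}$ by the basic quasinumbers and the coordinate functions $\gamma\mapsto\gamma^i$. If a quasipolynomial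 $q$ can be written as a polynomial expression with rational coefficients in the coordinate functions and in the elements of a finite set $\{\tau_{M_i,c_i,d_i}\}$, then the least common multiple of the $d_i$ is called a possible common period of $q$. The period of $q$ is the minimum of all possible common periods of $q$. *)

(* Defs.v *)
From HB Require Import structures.
From Stdlib Require Import Relation_Operators.
From mathcomp Require Import all_boot all_order all_algebra perm finmap.
From mathcomp Require Import boolp classical_sets cardinality reals.
From mathcomp Require Import complex.

Set Implicit Arguments.
Unset Strict Implicit.
Unset Printing Implicit Defensive.

Import Order.TTheory GRing.Theory Num.Theory.

Local Open Scope classical_set_scope.
Local Open Scope ring_scope.
Local Open Scope complex_scope.

(** * Root systems *)

(* Finite root systems spanning V = Q^n, following Bourbaki, Lie VI.1.1.  The
   coroot of [a] is a linear form on V, i.e. a row vector; on roots it is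
   uniquely determined by the axioms, and its values off the roots are
   irrelevant. *)
Record root_system (n : nat) := RootSystem {
  roots : {fset 'cV[rat]_n};
  coroot : 'cV[rat]_n -> 'rV[rat]_n;
  roots_neq0 : 0 \notin roots;
  roots_span : (<<roots>> = fullv)%VS;
  coroot_self : forall a, a \in roots -> (coroot a *m a) 0 0 = 2;
  roots_refl : forall a b, a \in roots -> b \in roots ->
    b - (coroot a *m b) 0 0 *: a \in roots;
  coroot_int : forall a b, a \in roots -> b \in roots ->
    (coroot a *m b) 0 0 \is a Num.int }.

Section RootSystem.

Variables (n : nat) (Phi : root_system n).
Implicit Types (a b v : 'cV[rat]_n) (S : {fset 'cV[rat]_n}).

(* <v, a^vee> *)
Definition pairing v a : rat := (coroot Phi a *m v) 0 0.

Definition reflection a v := v - pairing v a *: a.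

Definition reduced :=
  forall a (c : rat), a \in roots Phi -> c *: a \in roots Phi ->
    c = 1 \/ c = -1.

Definition irreducible :=
  roots Phi != fset0 /\
  forall S1 S2, roots Phi = (S1 `|` S2)%fset ->
    (forall a b, a \in S1 -> b \in S2 -> pairing a b = 0) ->
    S1 = fset0 \/ S2 = fset0.

Definition simple_root (i : 'I_n) : 'cV[rat]_n := delta_mx i 0.

(* The standard basis of Q^n is a basis of simple roots, i.e. coordinates are
   taken with respect to simple roots. *)
Definition standard_base :=
  (forall i, simple_root i \in roots Phi) /\
  (forall a, a \in roots Phi ->
     (forall i, a i 0 \is a Num.nat) \/ (forall i, - a i 0 \is a Num.nat)).

Definition positive_roots : {fset 'cV[rat]_n} :=
  [fset a in roots Phi | [forall i, 0 <= a i 0]]%fset.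

Definition root_subsystem S :=
  (S `<=` roots Phi)%fset /\
  forall a b, a \in S -> b \in S -> reflection a b \in S.

Definition full_rank_subsystem S :=
  root_subsystem S /\ (\dim <<S>> = \dim <<roots Phi>>)%VS.

Definition lattice S : set 'cV[rat]_n :=
  [set v | exists c : 'cV[rat]_n -> int, v = \sum_(a <- S) a *~ c a].

(* [k] is the order of the class of [v] in the quotient of an additive group
   containing [v] by its subgroup [L]. *)
Definition coset_order (L : set 'cV[rat]_n) v (k : nat) :=
  [/\ (0 < k)%N, L (v *+ k)
    & forall j : nat, (0 < j)%N -> L (v *+ j) -> (k <= j)%N].

Definition quotient_orders : set nat :=
  [set k | exists S v, [/\ full_rank_subsystem S, lattice (roots Phi) v
                         & coset_order (lattice S) v k]].

(** * Kostant partition function and chambers *)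

(* [fset_set] is the finite set underlying a classical set; the set below is
   finite because positive roots have nonnegative coordinates and are not
   zero. *)
Definition kostant v : nat :=
  #|` fset_set [set c : {ffun positive_roots -> nat} |
                  \sum_a val a *+ c a = v] |.

Definition cone S : set 'cV[rat]_n :=
  [set v | exists c : 'cV[rat]_n -> rat,
     (forall a, 0 <= c a) /\ v = \sum_(a <- S) c a *: a].

(* A cone spanned by n-1 linearly independent vectors has empty interior in
   Q^n, hence is its own boundary. *)
Definition wall S :=
  [/\ (S `<=` positive_roots)%fset, #|` S| = n.-1 & free S].

Definition regular : set 'cV[rat]_n :=
  [set v | cone positive_roots v /\ forall S, wall S -> ~ cone S v].

Definition segment u v : set 'cV[rat]_n :=
  [set (1 - t) *: u + t *: v | t in [set t : rat | 0 <= t <= 1]].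

(* The connected component of [u] in the set of regular points: over Q,
   connectedness means connectedness by polygonal paths. *)
Definition regular_component u : set 'cV[rat]_n :=
  [set v | clos_refl_trans _ (fun x y => segment x y `<=` regular) u v].

Definition closed_hull (U : set 'cV[rat]_n) : set 'cV[rat]_n :=
  [set v | forall e : rat, 0 < e ->
     exists2 u, U u & forall i, `|v i 0 - u i 0| < e].

Definition chamber (K : set 'cV[rat]_n) :=
  exists2 u, regular u & K = closed_hull (regular_component u).

End RootSystem.

(** * Quasipolynomials *)

(* Smallest set of functions containing the rational constants and [G], and
   closed under pointwise sums and products, i.e. the functions that are
   polynomial expressions with rational coefficients in elements of [G]. *)
Inductive rat_algebra (T : Type) (F : numFieldType) (G : set (T -> F)) :
    (T -> F) -> Prop :=
| RatAlgConst (r : rat) : rat_algebra G (fun=> ratr r)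
| RatAlgGen f : G f -> rat_algebra G f
| RatAlgAdd f g : rat_algebra G f -> rat_algebra G g ->
    rat_algebra G (fun x => f x + g x)
| RatAlgMul f g : rat_algebra G f -> rat_algebra G g ->
    rat_algebra G (fun x => f x * g x).

(* Number of rows [bq_rows.+1], so that it is positive. *)
Record basic_data (n : nat) := BasicData {
  bq_rows : nat;
  bq_mx : 'M[int]_(bq_rows.+1, n);
  bq_col : 'cV[int]_(bq_rows.+1);
  bq_mod : nat;
  bq_mod_gt0 : (0 < bq_mod)%N }.

Section Quasipolynomials.

Variables (R : realType) (n : nat).
Local Notation fn := ('cV[R[i]]_n -> R[i]).

Definition basic_quasinumber (t : basic_data n) : fn := fun g =>
  (`[< exists2 z : 'cV[int]_n, g = map_mx intr z &
         forall i, ((bq_mx t *m z) i ord0 = bq_col t i ord0 %[mod bq_mod t])%Z >])%:R.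

Definition coordinate (i : 'I_n) : fn := fun g => g i 0.

Definition quasipolynomial (q : fn) :=
  rat_algebra (range coordinate `|` range basic_quasinumber) q.

Definition possible_common_period (q : fn) (D : nat) :=
  exists (k : nat) (t : 'I_k -> basic_data n),
    rat_algebra
      (range coordinate `|` range (fun i => basic_quasinumber (t i))) q /\
    D = (\big[lcmn/1]_(i < k) bq_mod (t i))%N.

Definition is_period (q : fn) (d : nat) :=
  possible_common_period q d /\
  forall d', possible_common_period q d' -> (d <= d')%N.

Definition kostant_agrees (Phi : root_system n) (K : set 'cV[rat]_n) (q : fn) :=
  forall v, K v -> (kostant Phi v)%:R = q (map_mx ratr v).

Definition kostant_period_divides (Phi : root_system n) (D : nat) :=
  forall K, chamber Phi K ->
    exists q, unique (fun f => quasipolynomial f /\ kostant_agrees Phi K f) q /\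
      exists2 d, is_period q d & (d %| D)%N.

End Quasipolynomials.

Arguments kostant_period_divides R {n} Phi D.

(** * Types of simple root systems *)

Inductive dynkin_type :=
| TypeA of nat | TypeB of nat | TypeC of nat | TypeD of nat
| TypeE6 | TypeE7 | TypeE8 | TypeF4 | TypeG2.

Definition dynkin_rank (X : dynkin_type) : nat :=
  match X with
  | TypeA n | TypeB n | TypeC n | TypeD n => n
  | TypeE6 => 6 | TypeE7 => 7 | TypeE8 => 8 | TypeF4 => 4 | TypeG2 => 2
  end.

Definition dynkin_valid (X : dynkin_type) : bool :=
  match X with
  | TypeA n | TypeB n | TypeC n => (2 <= n)%N
  | TypeD n => (4 <= n)%N
  | _ => true
  end.

(* Edges i - j with i < j of the Dynkin diagram; nodes are numbered as in
   Bourbaki, shifted to start from 0. *)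
Definition dynkin_edge (X : dynkin_type) (i j : nat) : bool :=
  match X with
  | TypeA _ | TypeB _ | TypeC _ | TypeF4 | TypeG2 => j == i.+1
  | TypeD n => (j == i.+1) && (j < n.-1)%N || (i == n - 3)%N && (j == n.-1)
  | TypeE6 | TypeE7 | TypeE8 =>
      (i, j) \in [:: (0, 2); (1, 3); (2, 3); (3, 4); (4, 5); (5, 6); (6, 7)]%N
  end.

(* Absolute value of the (i, j) Cartan integer for adjacent nodes. *)
Definition dynkin_weight (X : dynkin_type) (i j : nat) : nat :=
  match X with
  | TypeB n => if (i == n - 2) && (j == n.-1) then 2 else 1
  | TypeC n => if (i == n.-1) && (j == n - 2) then 2 else 1
  | TypeF4 => if (i == 1) && (j == 2) then 2 else 1
  | TypeG2 => if (i == 1) && (j == 0) then 3 else 1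
  | _ => 1
  end%N.

(* The (i, j) entry is <alpha_i, alpha_j^vee>. *)
Definition cartan_entry (X : dynkin_type) (i j : nat) : int :=
  if i == j then 2
  else if dynkin_edge X i j || dynkin_edge X j i then
    - (dynkin_weight X i j)%:Z
  else 0.

(* The enumeration of the simple roots given by the coordinates is arbitrary,
   whence the permutation. *)
Definition has_type (X : dynkin_type) (Phi : root_system (dynkin_rank X)) :=
  exists s : {perm 'I_(dynkin_rank X)}, forall i j,
    pairing Phi (simple_root (s i)) (simple_root (s j))
      = (cartan_entry X i j)%:~R.

Definition dynkin_orders (X : dynkin_type) : seq nat :=
  match X with
  | TypeA _ => [:: 1]
  | TypeB _ | TypeC _ | TypeD _ => [:: 1; 2]
  | TypeE6 => [:: 1; 2; 3]
  | TypeE7 => [:: 1; 2; 3; 4]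
  | TypeE8 => [:: 1; 2; 3; 4; 5; 6]
  | TypeF4 => [:: 1; 2; 3; 4]
  | TypeG2 => [:: 1; 2; 3]
  end%N.

Definition dynkin_period_bound (X : dynkin_type) : nat :=
  match X with
  | TypeA _ => 1
  | TypeB _ | TypeC _ | TypeD _ => 2
  | TypeE6 => 6 | TypeE7 => 12 | TypeE8 => 60 | TypeF4 => 12 | TypeG2 => 6
  end.

(* Main.v *)
From Stdlib Require Import Relation_Operators.
From mathcomp Require Import all_boot all_order all_algebra finmap.
From mathcomp Require Import boolp classical_sets functions cardinality reals.
From mathcomp Require Import perm complex ring lra zify.
Require Import Defs.

(** The theorem combines a description of the orders with a description of the
    Kostant partition function.

    Orders.  Let S be a subsystem of full rank.  By the Smith normal form, the
    exponent d of the quotient of the root lattice by the lattice of S is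
    detected by a single functional y: it is integral on S, and j y is integral
    on the root lattice only if d divides j ([exponent_functional]).  The roots
    on which y is integral span the space, and this property is preserved by
    the affine Weyl group, so y may be moved into the fundamental alcove
    ([reach_alcove]), where it forces y to be a vertex ([alcove_vertex]): y is
    zero, or it is zero on all simple roots but the i-th, where it is 1 / c with
    c the i-th coefficient of the highest root.  Hence every order divides 1 or
    a coefficient of the highest root ([quotient_order_dvd]).  Conversely, every
    positive coefficient k of a root is an order ([coefficient_order]).  The
    coefficients are at most 1 in type A and 2 in types B, C, D, because in the
    usual realizations the reflections permute the coordinates up to sign, so
    that the l1 norm of a root is at most 2 ([family_bound]); for the
    exceptional types all roots are enumerated ([exceptional_rows]).

    Period.  For a basis M of positive roots, consider the functions q on which
    the difference operators along the columns of M are nilpotent.  Up to a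
    generic shift s, the partition function is a sum over M of such functions
    q_M cut off at the cones of the bases,
      P(gamma) = sum over M with gamma + s in the open cone of M of q_M(gamma)
    ([decomposed]).  This is proved by adding the positive roots alpha one at a
    time to the simple ones, each of which amounts to summing along the rays
    gamma - k alpha.  Such a ray meets a simplicial cone in an interval, and if
    Q is an antiderivative of q in the direction alpha, the sum telescopes to
    the values of Q at the two ends.  The end on the i-th facet is a function of
    the same kind for the basis in which alpha replaces the i-th column, and the
    end inside the cone gives Q itself ([ray_sum_term]).  On a chamber the
    cut-offs are constant, so P is there a plain sum f of functions q_M
    ([kostant_chamber]).

    If D times the root lattice is contained in the lattice of each basis M,
    the difference operators along D times the simple roots are nilpotent on f,
    and Newton's formula shows that f is polynomial on each residue class modulo
    D, i.e. a quasipolynomial with possible common period D.  A function that is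
    polynomial on the classes modulo d and on those modulo D is so on the
    classes modulo gcd(d, D) ([cellwise_gcd]), so the minimal period divides D.
    Finally, the lattice of a basis M is the lattice of the full rank subsystem
    of the roots that it contains, so the least common multiple of the orders is
    a possible choice of D ([orders_basis_lattice]). *)

Set Implicit Arguments.
Unset Strict Implicit.
Unset Printing Implicit Defensive.

Import Order.TTheory GRing.Theory Num.Theory.

Local Open Scope classical_set_scope.
Local Open Scope ring_scope.

(** * Difference calculus *)

Section Differences.

Variable V : zmodType.
Implicit Types (a b c x : V) (f g q : V -> rat).

Definition shift c f : V -> rat := fun x => f (x - c).
Definition dif b f : V -> rat := f - shift b f.

Definition scl (k : rat) f : V -> rat := fun x => k * f x.

Definition killed m b f := iter m (dif b) f = 0.
(** A function is [unip] along b when translation by b acts unipotently on the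
    span of its translates: it is then a polynomial on each coset of the
    multiples of b. *)
Definition unip b f := exists m, killed m b f.

Lemma shiftD c f g : shift c (f + g) = shift c f + shift c g. Proof. by []. Qed.
Lemma shiftN c f : shift c (- f) = - shift c f. Proof. by []. Qed.
Lemma shiftZ c (k : rat) f : shift c (scl k f) = scl k (shift c f). Proof. by []. Qed.
Lemma shift0 c : shift c 0 = 0. Proof. by []. Qed.
Lemma shift_shift c b f : shift c (shift b f) = shift (b + c) f.
Proof. by apply/funext => x; rewrite /shift opprD addrA addrAC. Qed.
Lemma shift_id f : shift 0 f = f.
Proof. by apply/funext => x; rewrite /shift subr0. Qed.

Lemma difD b f g : dif b (f + g) = dif b f + dif b g.
Proof. by rewrite /dif shiftD opprD addrACA. Qed.
Lemma difN b f : dif b (- f) = - dif b f.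
Proof. by rewrite /dif shiftN opprD. Qed.
Lemma sclD k f g : scl k (f + g) = scl k f + scl k g.
Proof. by apply/funext => x; exact: mulrDr. Qed.
Lemma sclN k f : scl k (- f) = - scl k f.
Proof. by apply/funext => x; exact: mulrN. Qed.
Lemma scl0 k : scl k 0 = 0. Proof. by apply/funext => x; exact: mulr0. Qed.
Lemma scl_sum k (I : Type) (r : seq I) (F : I -> V -> rat) :
  \sum_(i <- r) scl k (F i) = scl k (\sum_(i <- r) F i).
Proof. by elim: r => [|i r IH]; rewrite ?big_nil ?scl0 // !big_cons sclD IH. Qed.
Lemma difZ b (k : rat) f : dif b (scl k f) = scl k (dif b f).
Proof. by rewrite /dif shiftZ sclD sclN. Qed.
Lemma dif0 b : dif b 0 = 0. Proof. by rewrite /dif shift0 subr0. Qed.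
Lemma dif_shift b c f : dif b (shift c f) = shift c (dif b f).
Proof. by rewrite /dif shiftD shiftN !shift_shift [b + c]addrC. Qed.
Lemma dif_comm b c f : dif b (dif c f) = dif c (dif b f).
Proof. by rewrite {2}/dif difD difN dif_shift. Qed.
Lemma dif_sum b (I : Type) (r : seq I) (F : I -> V -> rat) :
  dif b (\sum_(i <- r) F i) = \sum_(i <- r) dif b (F i).
Proof. by elim: r => [|i r IH]; rewrite ?big_nil ?dif0 ?big_cons ?difD ?IH. Qed.

Lemma difDl b c f : dif (b + c) f = dif b f + shift b (dif c f).
Proof. by rewrite /dif shiftD shiftN shift_shift [c + b]addrC addrA subrK. Qed.

Lemma dif_opp b f : dif (- b) f = - shift (- b) (dif b f).
Proof. by rewrite /dif shiftD shiftN shift_shift subrr shift_id opprB. Qed.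

Lemma dif_mulrn b k f : dif (b *+ k) f = dif b (\sum_(i < k) shift (b *+ i) f).
Proof.
elim: k => [|k IH]; first by rewrite big_ord0 dif0 /dif shift_id subrr.
by rewrite mulrSr difDl IH big_ord_recr /= difD dif_shift.
Qed.

Lemma iter_difD m b f g :
  iter m (dif b) (f + g) = iter m (dif b) f + iter m (dif b) g.
Proof. by elim: m => //= m ->; rewrite difD. Qed.
Lemma iter_difN m b f : iter m (dif b) (- f) = - iter m (dif b) f.
Proof. by elim: m => //= m ->; rewrite difN. Qed.
Lemma iter_difZ m b k f : iter m (dif b) (scl k f) = scl k (iter m (dif b) f).
Proof. by elim: m => //= m ->; rewrite difZ. Qed.
Lemma iter_dif0 m b : iter m (dif b) 0 = 0.
Proof. by elim: m => //= m ->; rewrite dif0. Qed.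
Lemma iter_dif_shift m b c f :
  iter m (dif b) (shift c f) = shift c (iter m (dif b) f).
Proof. by elim: m => //= m ->; rewrite dif_shift. Qed.
Lemma iter_dif_dif m b c f :
  iter m (dif b) (dif c f) = dif c (iter m (dif b) f).
Proof. by elim: m => //= m ->; rewrite dif_comm. Qed.

Lemma killed_le m p b f : (m <= p)%N -> killed m b f -> killed p b f.
Proof. by move=> /subnK <-; rewrite /killed iterD => ->; rewrite iter_dif0. Qed.
Lemma killedD m b f g : killed m b f -> killed m b g -> killed m b (f + g).
Proof. by rewrite /killed iter_difD => -> ->; rewrite addr0. Qed.
Lemma killedN m b f : killed m b f -> killed m b (- f).
Proof. by rewrite /killed iter_difN => ->; rewrite oppr0. Qed.
Lemma killedZ m b k f : killed m b f -> killed m b (scl k f).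
Proof. by rewrite /killed iter_difZ => ->; rewrite scl0. Qed.
Lemma killed0 m b : killed m b 0. Proof. exact: iter_dif0. Qed.
Lemma killed_shift m b c f : killed m b f -> killed m b (shift c f).
Proof. by rewrite /killed iter_dif_shift => ->; rewrite shift0. Qed.
Lemma killed_dif m b c f : killed m b f -> killed m b (dif c f).
Proof. by rewrite /killed iter_dif_dif => ->; rewrite dif0. Qed.
Lemma killed_sum m b (I : Type) (r : seq I) (F : I -> V -> rat) :
  (forall i, killed m b (F i)) -> killed m b (\sum_(i <- r) F i).
Proof.
by move=> H; elim: r => [|i r IH]; rewrite ?big_nil ?big_cons; [exact: killed0|exact: killedD].
Qed.

(** The operators 1 - T_b and 1 - T_c commute and are nilpotent on f, and
    1 - T_(b + c) = (1 - T_b) + T_b (1 - T_c) is a combination of them. *)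
Lemma killed_add m p b c f : killed m b f -> killed p c f -> killed (m + p) (b + c) f.
Proof.
have [k lek] := ubnP (m + p); elim: k m p f lek => // k IH [|m] [|p] f lek.
- by rewrite /killed /= => -> _.
- by rewrite {1}/killed /= => -> _; exact: killed0.
- by move=> _; rewrite {1}/killed /= => ->; exact: killed0.
move=> hb hc; rewrite /killed addSn iterSr difDl.
have hb' : killed m b (dif b f) by move: hb; rewrite /killed iterSr.
have hc' : killed p c (dif c f) by move: hc; rewrite /killed iterSr.
apply: killedD.
- by apply: IH => //; exact: killed_dif.
- rewrite addnS -addSn; apply: IH; first by rewrite addSnnS.
    by apply/killed_shift/killed_dif.
  exact: killed_shift.
Qed.

Lemma unipD b f g : unip b f -> unip b g -> unip b (f + g).
Proof.
move=> [m hm] [p hp]; exists (maxn m p); apply: killedD.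
- exact: killed_le (leq_maxl _ _) hm.
- exact: killed_le (leq_maxr _ _) hp.
Qed.
Lemma unipN b f : unip b f -> unip b (- f).
Proof. by move=> [m hm]; exists m; exact: killedN. Qed.
Lemma unip0 b : unip b 0. Proof. by exists 0%N. Qed.
Lemma unip_shift b c f : unip b f -> unip b (shift c f).
Proof. by move=> [m hm]; exists m; exact: killed_shift. Qed.
Lemma unip_dif b c f : unip b f -> unip b (dif c f).
Proof. by move=> [m hm]; exists m; exact: killed_dif. Qed.
Lemma unip_sum b (I : Type) (r : seq I) (F : I -> V -> rat) :
  (forall i, unip b (F i)) -> unip b (\sum_(i <- r) F i).
Proof.
by move=> H; elim: r => [|i r IH]; rewrite ?big_nil ?big_cons; [exact: unip0|exact: unipD].
Qed.
Lemma unip_add b c f : unip b f -> unip c f -> unip (b + c) f.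
Proof. by move=> [m hm] [p hp]; exists (m + p)%N; exact: killed_add. Qed.
Lemma unip_opp b f : unip b f -> unip (- b) f.
Proof.
move=> [m hm]; exists m; elim: m f hm => [|m IH] f //.
rewrite /killed !iterSr dif_opp => hm; apply: IH.
by apply: killedN; apply: killed_shift.
Qed.
Lemma unip_0 f : unip 0 f.
Proof. by exists 1%N; rewrite /killed /= /dif shift_id subrr. Qed.
Lemma unip_mulrz b (k : int) f : unip b f -> unip (b *~ k) f.
Proof.
move=> hb; have hn (j : nat) : unip (b *+ j) f.
  by elim: j => [|j IH]; [rewrite mulr0n; exact: unip_0|rewrite mulrS; exact: unip_add].
by case: k => j; [exact: hn|rewrite NegzE mulrNz; exact/unip_opp/hn].
Qed.
Lemma unip_bsum (I : Type) (r : seq I) (P : pred I) (b : I -> V) f :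
  (forall i, unip (b i) f) -> unip (\sum_(i <- r | P i) b i) f.
Proof.
by move=> H; elim/big_ind: _ => [|*|*]; [exact: unip_0|exact: unip_add|exact: H].
Qed.

(** The operator 1 + T_b + ... + T_b^(k-1) equals k plus a nilpotent operator on
    the functions killed by a power of 1 - T_b, so it is invertible there; the
    inverse is a polynomial in T_b and hence preserves all other nilpotency
    conditions. *)
Lemma geometric_inverse b k e f : (0 < k)%N -> killed e b f ->
  exists Q, \sum_(i < k) shift (b *+ i) Q = f /\
    forall c p, killed p c f -> killed p c Q.
Proof.
move=> k0; elim: e f => [|e IH] f hf.
  by move: hf; rewrite /killed /= => ->; exists 0; split=> // ; rewrite big1.
(* (1 - T_b) G = f - (1 + ... + T_b^(k-1)) f / k is killed by a lower power. *)
pose G := scl k%:R^-1 (\sum_(i < k) \sum_(j < i) shift (b *+ j) f).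
have hG p c : killed p c f -> killed p c G.
  by move=> h; apply: killedZ; apply: killed_sum => i; apply: killed_sum => j; exact: killed_shift.
have hr : killed e b (dif b G).
  by move: (hG _ _ hf); rewrite /killed iterSr.
have [Q [EQ kQ]] := IH _ hr.
exists (scl k%:R^-1 f + Q); split; last first.
  by move=> c p h; apply: killedD; [exact: killedZ|exact/kQ/killed_dif/hG].
under eq_bigr do rewrite shiftD shiftZ.
rewrite big_split /= EQ scl_sum /G difZ -sclD dif_sum -big_split /=.
have -> : \sum_(i < k) (shift (b *+ i) f + dif b (\sum_(j < i) shift (b *+ j) f))
        = \sum_(i < k) f.
  by apply: eq_bigr => i _; rewrite -dif_mulrn /dif addrC subrK.
apply/funext => x; rewrite /scl sumr_const card_ord.
have -> j : (f *+ j) x = f x *+ j by elim: j => // j IHj; rewrite !mulrS -IHj.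
by rewrite -[f x *+ k]mulr_natl mulKf // pnatr_eq0 -lt0n.
Qed.

(** The sum of g over the half-open integer interval from 0 (excluded) to r
    (included), with the usual sign when r is negative. *)
Definition isum (g : int -> rat) (r : int) : rat :=
  match r with
  | Posz k => \sum_(i < k) g i.+1
  | Negz k => - \sum_(i < k.+1) g (- i%:Z)
  end.

Lemma isum_step (g : int -> rat) (r : int) : isum g r - isum g (r - 1) = g r.
Proof.
case: r => [[|k]|k].
- by rewrite (_ : 0%:Z - 1 = Negz 0) //= big_ord0 big_ord_recr big_ord0 /= oppr0 !add0r opprK.
- rewrite (_ : k.+1%:Z - 1 = k%:Z); last by lia.
  by rewrite /= big_ord_recr /= addrAC subrr add0r.
- rewrite (_ : Negz k - 1 = Negz k.+1); last by lia.
  rewrite [isum _ (Negz k.+1)]/= big_ord_recr /= opprK addrA addNr add0r.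
  by congr (g _); lia.
Qed.

Lemma additiveN (t : V -> rat) : (forall x y, t (x + y) = t x + t y) ->
  forall x, t (- x) = - t x.
Proof.
move=> tD x; have t0 : t 0 = 0 by apply: (addIr (t 0)); rewrite -tD addr0 add0r.
by apply/eqP; rewrite -addr_eq0 -tD addNr t0.
Qed.

(** A function with period b is determined by its values on the slab
    0 <= t < 1, which meets every coset of the multiples of b. *)
Lemma dif_eq0 b R (t : V -> rat) :
    (forall x y, t (x + y) = t x + t y) -> t b = 1 ->
  dif b R = 0 -> (forall x, 0 <= t x < 1 -> R x = 0) -> R = 0.
Proof.
move=> tD tb hR h0.
have inv x : R (x - b) = R x.
  by have := congr1 (fun f => f x) hR; rewrite /dif /shift /=; move=> /eqP; rewrite subr_eq0 => /eqP.
have invn x k : R (x - b *+ k) = R x.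
  by elim: k x => [|k IH] x; rewrite ?mulr0n ?subr0 // mulrS opprD addrA IH inv.
have tN := additiveN tD.
have tn k : t (b *+ k) = k%:R.
  elim: k => [|k IH]; last by rewrite mulrS tD IH tb -natr1 addrC.
  by apply: (addIr (t 0)); rewrite -tD mulr0n addr0 add0r.
apply/funext => x; have /andP[h1 h2] := floor_itv (t x).
case E: (Num.floor (t x)) h1 h2 => [k|k] h1 h2.
- rewrite -(invn x k) h0 // tD tN tn.
  by move: h1 h2; rewrite -pmulrn intrD -pmulrn => *; lra.
- have := invn (x + b *+ k.+1) k.+1; rewrite addrK => ->; rewrite h0 // tD tn.
  by move: h1 h2; rewrite NegzE intrD intrN -pmulrn => *; lra.
Qed.

(** The equation Q(x) - Q(x - b) = q(x) is solved by summing q from the slab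
    0 <= t < 1, on which Q is set to zero.  A translation c along the slab
    preserves this normalization, so Q inherits from q the equations in the
    direction c. *)
Lemma section_antiderivative b (t : V -> rat) q :
    (forall x y, t (x + y) = t x + t y) -> t b = 1 ->
  exists Q, dif b Q = q /\
    forall c p, t c = 0 -> killed p c q -> killed p c Q.
Proof.
move=> tD tb.
pose Q x := let r := Num.floor (t x) in isum (fun j => q (x + b *~ (j - r))) r.
have tN := additiveN tD.
have dQ : dif b Q = q.
  apply/funext => x; rewrite /dif /shift; change (Q x - Q (x - b) = q x).
  rewrite /Q tD tN tb; set r := Num.floor (t x).
  have -> : Num.floor (t x - 1) = r - 1.
    by rewrite (_ : -1 = (-1)%:~R) // floorDrz ?intr_int // intrKfloor.
  have -> : (fun j => q (x - b + b *~ (j - (r - 1)))) = (fun j => q (x + b *~ (j - r))).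
    by apply/funext => j; rewrite opprB [1 - r]addrC addrA mulrzDr mulr1z addrA addrAC subrK.
  by rewrite isum_step subrr mulr0z addr0.
exists Q; split=> // c p tc hq.
apply: (dif_eq0 tD tb); first by rewrite -iter_dif_dif dQ.
have Q0 x : 0 <= t x < 1 -> Q x = 0.
  move=> /andP[x0 x1]; rewrite /Q.
  have -> : Num.floor (t x) = 0 by apply: floor_def; rewrite x0.
  by rewrite /= big_ord0.
move: p {hq} => k; elim: k => [|k IH] x hx; first exact: Q0.
rewrite iterS /dif /shift; change (iter k (dif c) Q x - iter k (dif c) Q (x - c) = 0).
by rewrite !IH ?subrr // tD tN tc subr0.
Qed.

End Differences.

Section Antiderivative.

Variables (n : nat) (M : 'M[rat]_n).
Hypothesis uM : M \in unitmx.
Local Notation V := 'cV[rat]_n.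
Implicit Types (x : V) (f q : V -> rat).

Definition crd x i : rat := (invmx M *m x) i 0.
Definition unips f := forall j, unip (col j M) f.

Lemma crdD x y i : crd (x + y) i = crd x i + crd y i.
Proof. by rewrite /crd mulmxDr mxE. Qed.
Lemma crdN x i : crd (- x) i = - crd x i.
Proof. by rewrite /crd mulmxN mxE. Qed.
Lemma crdZ k x i : crd (k *: x) i = k * crd x i.
Proof. by rewrite /crd -scalemxAr mxE. Qed.
Lemma crdMn k x i : crd (x *+ k) i = crd x i *+ k.
Proof. by rewrite -scaler_nat crdZ mulr_natl. Qed.

Lemma crd_col i j : crd (col j M) i = (i == j)%:R.
Proof. by rewrite /crd colE mulmxA mulVmx // mul1mx mxE eqxx andbT. Qed.

Lemma crd_sum x : x = \sum_j crd x j *: col j M.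
Proof.
rewrite -[LHS](mulKVmx uM); apply/matrixP => i k; rewrite ord1 summxE mxE.
by apply: eq_bigr => j _; rewrite !mxE mulrC /crd mxE.
Qed.

Lemma unips_sum (I : Type) (r : seq I) (F : I -> V -> rat) :
  (forall i, unips (F i)) -> unips (\sum_(i <- r) F i).
Proof. by move=> H j; apply: unip_sum => i; exact: H. Qed.

Lemma common_denominator (a : 'I_n -> rat) :
  exists2 m : nat, (0 < m)%N & forall j, a j *+ m \is a Num.int.
Proof.
exists (\prod_j `|denq (a j)|)%N.
  by rewrite prodn_gt0 // => j; rewrite absz_gt0 denq_neq0.
move=> j; rewrite (bigD1 j) //= mulrnA; apply: rpredMn.
rewrite -mulr_natr natr_absz gtr0_norm ?denq_gt0 //.
by rewrite -[a j in X in X * _]divq_num_den mulfVK ?intr_eq0 ?denq_neq0 // intr_int.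
Qed.

(** A multiple m alpha of alpha is n0 b + c, where b is the column i0 and c is an
    integral combination of the other columns.  Antiderivatives in the direction
    b exist by summation, those in the direction n0 b by inverting the geometric
    sum, and those in the direction n0 b + c follow by induction on the
    nilpotency of 1 - T_c; summing over the translates by i alpha, i < m, turns
    an antiderivative for m alpha into one for alpha. *)
Lemma antiderivative alpha i0 q : 0 < crd alpha i0 -> unips q ->
  exists2 Q, dif alpha Q = q & unips Q.
Proof.
move=> a0 hq.
have [m m0 hm] := common_denominator (crd alpha).
have /fin_all_exists[N hN] j : exists z : int, crd alpha j *+ m = z%:~R.
  by have /intrP[z ->] := hm j; exists z.
have [n0 hn0] : exists k : nat, N i0 = k.
  have : (0 < (N i0)%:~R :> rat) by rewrite -hN pmulrn_rgt0.
  by rewrite ltr0z; case: (N i0) => // k _; exists k.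
have n0_gt0 : (0 < n0)%N.
  have : (0 < (N i0)%:~R :> rat) by rewrite -hN pmulrn_rgt0.
  by rewrite ltr0z hn0.
pose b := col i0 M; pose c := \sum_(j | j != i0) col j M *~ N j.
have Ea : alpha *+ m = b *+ n0 + c.
  rewrite [alpha *+ m]crd_sum (bigD1 i0) //=; congr (_ + _).
    by rewrite crdMn hN hn0 -pmulrn scaler_nat.
  by apply: eq_bigr => j _; rewrite crdMn hN scaler_int.
have cj j : j != i0 -> crd (col j M) i0 = 0 by move=> jn; rewrite crd_col eq_sym (negPf jn).
have c0 : crd c i0 = 0.
  have : crd (alpha *+ m) i0 = crd (b *+ n0 + c) i0 by rewrite Ea.
  rewrite crdD !crdMn hN hn0 crd_col eqxx -pmulrn => /eqP.
  by rewrite eq_sym -subr_eq0 addrAC subrr add0r => /eqP.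
have uc f : unips f -> unip c f.
  by move=> hf; apply: unip_bsum => j; exact: unip_mulrz.
(* 1 - T_(n0 b + c) = (1 - T_(n0 b)) + T_(n0 b) (1 - T_c), where the second
   term lowers p. *)
have main p f : unips f -> killed p c f ->
    exists2 Q, dif (b *+ n0 + c) Q = f & unips Q.
  elim: p f => [|p IH] f hf hc.
    by move: hc; rewrite /killed /= => ->; exists 0; [exact: dif0|move=> j; exact: unip0].
  have b1 : crd b i0 = 1 by rewrite crd_col eqxx.
  have [Q1 [dQ1 kQ1]] := section_antiderivative f (fun x y => crdD x y i0) b1.
  have uQ1 : unips Q1.
    move=> j; have [e he] := hf j; have [ji|ji] := eqVneq j i0.
      by exists e.+1; rewrite ji /killed iterSr dQ1 -ji.
    by exists e; apply: kQ1 => //; exact: cj.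
  have [e he] := uQ1 i0.
  have [Q0 [EQ0 kQ0]] := geometric_inverse n0_gt0 he.
  have uQ0 : unips Q0 by move=> j; have [e' he'] := uQ1 j; exists e'; exact: kQ0.
  have dQ0 : dif (b *+ n0) Q0 = f by rewrite dif_mulrn EQ0.
  have cQ0 : killed p.+1 c Q0 by apply: kQ0; apply: kQ1.
  have [|| Q2 dQ2 uQ2] := IH (shift (b *+ n0) (dif c Q0)).
  - by move=> j; apply: unip_shift; apply: unip_dif.
  - by apply: killed_shift; move: cQ0; rewrite /killed iterSr.
  exists (Q0 - Q2); first by rewrite difD difN dQ2 difDl dQ0 addrK.
  by move=> j; apply: unipD => //; exact: unipN.
have [p hp] := uc q hq.
have [Q dQ uQ] := main p q hq hp.
exists (\sum_(i < m) shift (alpha *+ i) Q); first by rewrite -dif_mulrn Ea.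
by apply: unips_sum => i j; exact: unip_shift.
Qed.

End Antiderivative.

(** * Sums over the integers of an interval *)

Section EndPoints.

Variables (I : finType) (x a : I -> rat).

(** The parameter at which the line [k |-> x - k a] meets the i-th coordinate
    hyperplane. *)
Definition crossing i : rat := x i / a i.

Definition crossing_inside i :=
  [forall j, (j != i) ==> (0 < x j - crossing i * a j)].

(** The positivity conditions cut out an interval of values of k: the coordinates
    with a i > 0 bound k from above and those with a i < 0 from below.  The sum
    telescopes to the two ends, which are the only crossings at which all the
    other conditions hold.  The non-degeneracy hypotheses exclude ties and
    integral crossings, so the ends may be written without knowing which
    coordinates are the binding ones. *)
Lemma sum_over_interval (y : int -> rat) (K : nat) ip im :
    0 < a ip -> a im < 0 ->
    (forall i (k : int), a i != 0 -> x i - k%:~R * a i != 0) ->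
    (forall i j, a i != 0 -> j != i -> x j - crossing i * a j != 0) ->
    (forall k : int, (forall i, 0 < x i - k%:~R * a i) -> 0 <= k < K) ->
  \sum_(k < K) [forall i, 0 < x i - k%:R * a i]%:R * (y k - y k.+1) =
  \sum_(i | a i != 0) (- Num.sg (a i)) *
     ((crossing_inside i)%:R * y (Num.floor (crossing i) + 1)).
Proof.
move=> aip0 aim0 hint htie hK.
(* A nonpositive coordinate with zero slope makes both sides vanish. *)
have [j /andP[/eqP aj xj]|nz] := pickP (fun j => (a j == 0) && (x j <= 0)).
  rewrite !big1 // => [i ai|k _].
    have -> : crossing_inside i = false.
      apply/negP => /forallP/(_ j); rewrite aj mulr0 subr0 ltNge xj implybF negbK => /eqP ji.
      by rewrite -ji aj eqxx in ai.
    by rewrite mul0r mulr0.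
  have -> : [forall i, 0 < x i - k%:R * a i] = false.
    by apply/negP => /forallP/(_ j); rewrite aj mulr0 subr0 ltNge xj.
  by rewrite mul0r.
have xpos j : a j = 0 -> 0 < x j.
  by move=> aj; have := nz j; rewrite aj eqxx /= ltNge => ->.
pose t i := crossing i.
have posP j r : 0 < a j -> (0 < x j - r * a j) = (r < t j).
  by move=> aj; rewrite subr_gt0 /t /crossing ltr_pdivlMr.
have posN j r : a j < 0 -> (0 < x j - r * a j) = (t j < r).
  by move=> aj; rewrite subr_gt0 /t /crossing ltr_ndivrMr.
have {ip aip0} [p p0 pmin] : exists2 p, 0 < a p & forall j, 0 < a j -> t p <= t j.
  by case: (arg_minP (P := fun i => 0 < a i) t aip0) => p p0 hp; exists p.
have {im aim0} [m m0 mmax] : exists2 m, a m < 0 & forall j, a j < 0 -> t j <= t m.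
  by case: (arg_maxP (P := fun i => a i < 0) t aim0) => m m0 hm; exists m.
have tpm : t p != t m.
  have := htie p m (lt0r_neq0 p0); rewrite subr_eq0 => h.
  apply/eqP => tE; move: h; rewrite -/(t p) tE.
  have -> : m != p by apply/eqP => E; rewrite E in m0; have := lt_trans m0 p0; rewrite ltxx.
  by rewrite /t /crossing divfK ?eqxx ?ltr0_neq0 // => /(_ isT).
have mp : m != p by apply/eqP => E; rewrite E in m0; have := lt_trans m0 p0; rewrite ltxx.
have Cp : crossing_inside p = (t m < t p).
  apply/forallP/idP => [/(_ m)|h j].
    by rewrite mp /= posN.
  apply/implyP => jp; have [aj|aj|aj] := ltgtP (a j) 0.
  - by rewrite posN // (le_lt_trans (mmax _ aj)).
  - rewrite posP // lt_neqAle -/(t p) pmin // andbT; apply/eqP => tE.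
    have := htie p j (lt0r_neq0 p0) jp; rewrite -/(t p) tE /t /crossing divfK ?subrr ?eqxx //.
    exact: lt0r_neq0.
  - by rewrite aj mulr0 subr0 xpos.
have Cm : crossing_inside m = (t m < t p).
  apply/forallP/idP => [/(_ p)|h j].
    by rewrite eq_sym mp /= posP.
  apply/implyP => jp; have [aj|aj|aj] := ltgtP (a j) 0.
  - rewrite posN // lt_neqAle -/(t m) mmax // andbT; apply/eqP => tE.
    have := htie m j (ltr0_neq0 m0) jp; rewrite -/(t m) -tE /t /crossing divfK ?subrr ?eqxx //.
    exact: ltr0_neq0.
  - by rewrite posP // (lt_le_trans h) // pmin.
  - by rewrite aj mulr0 subr0 xpos.
have condE (k : int) : (forall i, 0 < x i - k%:~R * a i) <-> (t m < k%:~R < t p).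
  split=> [h|/andP[h1 h2] i]; first by rewrite -posN // h -posP // h.
  have [ai|ai|ai] := ltgtP (a i) 0.
  - by rewrite posN // (le_lt_trans (mmax _ ai)).
  - by rewrite posP // (lt_le_trans h2) // pmin.
  - by rewrite ai mulr0 subr0 xpos.
rewrite (bigD1 p) ?lt0r_neq0 //= (bigD1 m) ?ltr0_neq0 ?mp //= [X in _ + (_ + X)]big1 ?addr0; last first.
  move=> i; rewrite -?andbA => /and3P[ai ip im].
  have -> : crossing_inside i = false; last by rewrite mul0r mulr0.
  apply/negP => /forallP h; have [ai'|ai'|ai'] := ltgtP (a i) 0.
  - have := h m; rewrite eq_sym im /= posN // => h'.
    by have := lt_le_trans h' (mmax _ ai'); rewrite ltxx.
  - have := h p; rewrite eq_sym ip /= posP // => h'.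
    by have := le_lt_trans (pmin _ ai') h'; rewrite ltxx.
  - by rewrite ai' eqxx in ai.
rewrite Cp Cm (gtr0_sg p0) (ltr0_sg m0) opprK mul1r mulN1r -/(t p) -/(t m).
have [lt|ge] := ltP (t m) (t p); last first.
  rewrite !mul0r oppr0 add0r big1 // => k _.
  case: forallP; rewrite ?mul0r // => /(condE k) /andP[h1 h2].
  by have := lt_trans h1 h2; rewrite ltNge ge.
rewrite !mul1r; set P := Num.floor (t m) + 1; set Q := Num.floor (t p) + 1.
have kQ (k : int) : (k%:~R < t p) = (k < Q).
  rewrite /Q ltzD1 floor_ge_int lt_neqAle andb_idl // => _.
  have := hint p k (lt0r_neq0 p0); rewrite subr_eq0; apply: contraNneq => ->.
  by rewrite /t /crossing divfK ?lt0r_neq0.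
have kP (k : int) : (t m < k%:~R) = (P <= k).
  by rewrite /P lezD1 floor_lt_int.
have PQ : P <= Q by rewrite /P /Q lerD2r le_floor // ltW.
have condE' (k : int) : (forall i, 0 < x i - k%:~R * a i) <-> (P <= k < Q).
  by rewrite condE kQ kP.
have condB (k : nat) : [forall i, 0 < x i - k%:R * a i] = (P <= k%:Z < Q).
  by apply/forallP/idP => /(condE' k).
under eq_bigr do rewrite condB.
have [E|ne] := eqVneq P Q.
  rewrite -E addNr big1 // => k _.
  by rewrite (_ : (_ && _) = false) ?mul0r //; lia.
have ltPQ : P < Q by rewrite lt_neqAle ne.
have /andP[P0 PK] : 0 <= P < K by apply: hK; apply/condE'; rewrite lexx.
have /andP[Q0 QK] : 0 <= Q - 1 < K by apply: hK; apply/condE'; lia.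
have [p' EP] : exists k : nat, P = k by case: (P) P0 => // k _; exists k.
have [q' EQ] : exists k : nat, Q = k by exists `|Q|%N; lia.
rewrite EP EQ -(big_mkord xpredT (fun k => (p'%:Z <= k%:Z < q'%:Z)%R%:R * (y k - y k.+1))).
have pq : (p' <= q')%N by lia.
have qK : (q' <= K)%N by lia.
rewrite (big_cat_nat (n := p')) //=; last exact: leq_trans qK.
rewrite big_nat big1 ?add0r; last by move=> k hk; rewrite (_ : (_ && _) = false) ?mul0r //; lia.
rewrite (big_cat_nat (n := q')) //= [X in _ + X]big_nat [X in _ + X]big1 ?addr0; last first.
  by move=> k hk; rewrite (_ : (_ && _) = false) ?mul0r //; lia.
rewrite (eq_big_nat _ _ (F2 := fun k => - (y k.+1 - y k))); last first.
  by move=> k hk; rewrite (_ : (_ && _) = true) ?mul1r ?opprB //; lia.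
by rewrite sumrN telescope_sumr // opprB addrC.
Qed.

End EndPoints.

(** * Sums along rays *)

Lemma big_option (T : finType) (P : pred (option T)) (F : option T -> rat) :
  P None -> \sum_(o | P o) F o = F None + \sum_(i | P (Some i)) F (Some i).
Proof.
move=> P0; rewrite (bigD1 None) //=; congr (_ + _).
rewrite (reindex_omap Some id) /=; last by case=> //; rewrite andbF.
by apply: eq_bigl => i; rewrite eqxx !andbT.
Qed.

Section ConeDecomposition.

Variable n : nat.
Local Notation V := 'cV[rat]_n.
Implicit Types (M : 'M[rat]_n) (s x alpha gamma : V) (F q : V -> rat).

Definition integral x := forall i, x i 0 \is a Num.int.

Lemma integralD x y : integral x -> integral y -> integral (x + y).
Proof. by move=> hx hy i; rewrite mxE rpredD. Qed.
Lemma integralN x : integral x -> integral (- x).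
Proof. by move=> hx i; rewrite mxE rpredN. Qed.
Lemma integralMz x (k : int) : integral x -> integral (x *~ k).
Proof. by move=> hx i; rewrite -scaler_int mxE rpredM ?intr_int. Qed.

Lemma integral_int x : integral x -> exists z : 'cV[int]_n, x = map_mx intr z.
Proof.
move=> ix; have /fin_all_exists[k hk] : forall i, exists k : int, x i 0 = k%:~R.
  by move=> i; apply/intrP.
by exists (\col_i k i); apply/colP => i; rewrite !mxE.
Qed.

Lemma col_sum x : x = \sum_i x i 0 *: delta_mx i 0.
Proof.
apply/colP => i; rewrite summxE (bigD1 i) //= !mxE !eqxx mulr1 big1 ?addr0 // => j ji.
by rewrite !mxE eq_sym (negPf ji) mulr0.
Qed.

Definition in_cone M x := [forall j, 0 < crd M x j].

Definition replace_col M i alpha : 'M[rat]_n :=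
  \matrix_(r, c) if c == i then alpha r 0 else M r c.

Lemma col_replace M i alpha j :
  col j (replace_col M i alpha) = if j == i then alpha else col j M.
Proof. by apply/colP => r; rewrite !mxE; case: ifP; rewrite // mxE. Qed.

(** Cramer-type exchange: after replacing a column by alpha, the old coordinate i
    is divided by that of alpha, and the others are corrected accordingly. *)
Lemma replace_colP M i alpha : M \in unitmx -> crd M alpha i != 0 ->
  replace_col M i alpha \in unitmx /\
  forall x j, crd (replace_col M i alpha) x j =
    if j == i then crd M x i / crd M alpha i
    else crd M x j - crd M x i / crd M alpha i * crd M alpha j.
Proof.
move=> uM ai; set M' := replace_col _ _ _; set a := crd M alpha in ai *.
pose W : 'M[rat]_n := \matrix_(j, k)
  if j == i then invmx M i k / a i else invmx M j k - a j / a i * invmx M i k.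
have MW : M' *m W = 1%:M.
  apply/matrixP => r k; rewrite mxE (bigD1 i) //= !mxE eqxx.
  rewrite (eq_bigr (fun c => M r c * invmx M c k - M r c * a c * (invmx M i k / a i))); last first.
    by move=> c ci; rewrite !mxE (negPf ci); ring.
  rewrite big_split /= sumrN -mulr_suml.
  have := congr1 (fun A : 'M_n => A r k) (mulmxV uM); rewrite !mxE (bigD1 i) //= => h1.
  have h2 : alpha r 0 = M r i * a i + \sum_(c | c != i) M r c * a c.
    by rewrite -(bigD1 i (P := xpredT)) //= -[in LHS](mulKVmx uM alpha) mxE.
  by rewrite -h1 h2; field.
have [uM' _] := mulmx1_unit MW; split=> // x j.
have iW : invmx M' = W by rewrite -[W]mul1mx -(mulVmx uM') -mulmxA MW mulmx1.
have cE z l : crd M z l = \sum_k invmx M l k * z k 0 by rewrite /crd mxE.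
rewrite {1}/crd iW mxE; case: ifP => ji.
  by rewrite cE mulr_suml; apply: eq_bigr => k _; rewrite !mxE ji; ring.
rewrite !cE -/a !mulr_suml -sumrB.
by apply: eq_bigr => k _; rewrite !mxE ji; ring.
Qed.

Variable A : seq V.
Hypothesis A_int : forall a, a \in A -> integral a.
Hypothesis A_ge0 : forall a, a \in A -> forall i, 0 <= a i 0.
Hypothesis A_neq0 : forall a, a \in A -> a != 0.

Definition bases : seq 'M[rat]_n :=
  undup [seq M <- [seq \matrix_(i, j) (nth 0 A (f j)) i 0 | f : {ffun 'I_n -> 'I_(size A)}]
        | M \in unitmx].

Lemma basesP M : reflect (M \in unitmx /\ forall j, col j M \in A) (M \in bases).
Proof.
rewrite mem_undup mem_filter; apply: (iffP andP) => -[uM hM]; split=> //.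
  move/mapP: hM => [f _ ->] j.
  rewrite (_ : col j _ = nth 0 A (f j)) ?mem_nth //.
  by apply/colP => i; rewrite !mxE.
have lt j : (index (col j M) A < size A)%N by rewrite index_mem.
apply/mapP; exists [ffun j => Ordinal (lt j)]; first by rewrite mem_enum.
by apply/matrixP => i j; rewrite !mxE ffunE /= nth_index // mxE.
Qed.

(** The cone of M is shifted by [- s] and only its interior counts; for a
    generic s no integral point lies on a wall, so open and closed cones give
    the same formula. *)
Definition decomposed s F := exists2 q : 'M[rat]_n -> V -> rat,
  forall M, M \in bases -> unips M (q M) &
  forall gamma, integral gamma ->
    F gamma = \sum_(M <- bases) (in_cone M (gamma + s))%:R * q M gamma.

Definition generic s := forall M, M \in bases -> forall j gamma,
  integral gamma -> crd M (gamma + s) j != 0.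

Lemma unipsD M q q' : unips M q -> unips M q' -> unips M (q + q').
Proof. by move=> h h' j; exact: unipD. Qed.

Lemma decomposedD s F F' :
  decomposed s F -> decomposed s F' -> decomposed s (F + F').
Proof.
move=> [q uq hq] [q' uq' hq']; exists (fun M => q M + q' M).
  by move=> M hM; apply: unipsD; [exact: uq|exact: uq'].
move=> g ig; rewrite [LHS](_ : _ = F g + F' g) // hq // hq' // -big_split /=.
by apply: eq_bigr => M _; rewrite -mulrDr.
Qed.

Lemma decomposed0 s : decomposed s 0.
Proof.
exists (fun=> 0) => [M _ j|g _]; first exact: unip0.
by rewrite big1 // => M _; rewrite mulr0.
Qed.

Lemma decomposed_sum s (I : Type) (r : seq I) (P : pred I) (F : I -> V -> rat) :
  (forall i, P i -> decomposed s (F i)) -> decomposed s (\sum_(i <- r | P i) F i).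
Proof. by move=> H; elim/big_ind: _ => //; [exact: decomposed0|exact: decomposedD]. Qed.

Lemma decomposed_term s M q : M \in bases -> unips M q ->
  decomposed s (fun gamma => (in_cone M (gamma + s))%:R * q gamma).
Proof.
move=> hM uq; exists (fun M' => if M' == M then q else 0) => [M' _|g _].
  by case: eqP => [->//|_ j]; exact: unip0.
rewrite (bigD1_seq M) ?undup_uniq //= eqxx big1 ?addr0 // => M' /negPf ->.
by rewrite mulr0.
Qed.

(** The columns and alpha have nonnegative entries, so alpha cannot be a
    nonpositive combination of the columns unless it is zero. *)
Lemma positive_crd M alpha : M \in bases -> alpha \in A ->
  exists i, 0 < crd M alpha i.
Proof.
move=> /basesP[uM cM] aA; apply/existsP; rewrite -[X in is_true X]negbK negb_exists.
apply/forallP => h; have /negP := A_neq0 aA; apply; apply/eqP/colP => r.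
rewrite mxE; apply/eqP; rewrite eq_le A_ge0 // andbT.
rewrite (crd_sum uM alpha) summxE sumr_le0 // => j _.
rewrite mxE mulr_le0_ge0 //; first by rewrite leNgt.
by rewrite A_ge0 // -/(col j M).
Qed.

(** The function is Q evaluated at the first point of the ray gamma - k alpha
    past the i-th facet (shifted by r).  It is constant along alpha, since translating gamma
    by alpha moves along the ray, and a translation along another column of M
    does not change the crossing parameter. *)
Lemma unips_crossing M i alpha (r : rat) Q : M \in unitmx -> crd M alpha i != 0 ->
  unips M Q ->
  unips (replace_col M i alpha)
    (fun gamma => Q (gamma - alpha *~ (Num.floor (crd M gamma i / crd M alpha i + r) + 1))).
Proof.
move=> uM ai uQ j; rewrite col_replace; set H := (X in unip _ X).
case: eqP => [_|ji].
  (* The column alpha of the new basis: x and x - alpha lie on the same ray. *)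
  exists 1%N; apply/funext => x; rewrite /= /dif; change (H x - H (x - alpha) = 0).
  rewrite /H crdD crdN mulrDl mulNr divff //.
  set t := crd M x i / _; rewrite (_ : t - 1 + r = t + r + (-1)%:~R); last by rewrite addrAC.
  rewrite (floorDrz (t + r) (y := (-1)%:~R)) ?intr_int // intrKfloor; apply/eqP; rewrite subr_eq0; apply/eqP; congr (Q _).
  by rewrite -[x - alpha - _]addrA -opprD; congr (x - _); rewrite subrK addrC mulrzDr mulr1z.
have [p hp] := uQ j; exists p.
have key k x : iter k (dif (col j M)) H x =
    iter k (dif (col j M)) Q (x - alpha *~ (Num.floor (crd M x i / crd M alpha i + r) + 1)).
  elim: k x => // k IH x; rewrite !iterS.
  change (iter k (dif (col j M)) H x - iter k (dif (col j M)) H (x - col j M) =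
    iter k (dif (col j M)) Q (x - alpha *~ (Num.floor (crd M x i / crd M alpha i + r) + 1)) -
    iter k (dif (col j M)) Q (x - alpha *~ (Num.floor (crd M x i / crd M alpha i + r) + 1) - col j M)).
  rewrite !IH crdD crdN crd_col // (_ : i == j = false) ?subr0; last by apply/eqP => E; rewrite E in ji.
  by rewrite [in X in _ = _ - X]addrAC.
by apply/funext => x; rewrite key hp.
Qed.

(** The sum of a single cut-off term along the ray.  The interval of summation
    is bounded by the facets of the cone of M and by k >= 0.  The end k = 0
    contributes Q on the cone of M, and a crossing of the facet i contributes on
    the cone of the basis in which alpha replaces the column i.  Writing k >= 0
    as 0 < eps + k with 0 < eps < 1 treats it as one more coordinate, and the
    positivity conditions at the crossings become those of the cones shifted by
    s + eps alpha. *)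
Lemma ray_sum_term M q alpha s eps : M \in bases -> unips M q -> alpha \in A ->
    0 < eps < 1 -> generic s -> generic (s + eps *: alpha) ->
  exists2 F', decomposed (s + eps *: alpha) F' &
    forall gamma, integral gamma -> exists K0, forall K, (K0 <= K)%N ->
      \sum_(k < K) (in_cone M (gamma - alpha *+ k + s))%:R * q (gamma - alpha *+ k)
      = F' gamma.
Proof.
move=> hM uq aA /andP[e0 e1] gs gs'; set s' := s + _ in gs' *.
have [uM cM] := basesP _ hM.
have [ip aip] := positive_crd hM aA.
have [Q dQ uQ] := antiderivative uM aip uq.
pose a := crd M alpha; pose t gamma i := crd M (gamma + s) i / a i.
pose H i gamma := Q (gamma - alpha *~ (Num.floor (t gamma i) + 1)).
have hM' i : a i != 0 -> replace_col M i alpha \in bases.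
  move=> ai; apply/basesP; split; first by have [] := replace_colP uM ai.
  by move=> j; rewrite col_replace; case: ifP.
pose F' : V -> rat := (fun gamma => (in_cone M (gamma + s'))%:R * Q gamma) +
  \sum_(i | a i != 0) (fun gamma => (in_cone (replace_col M i alpha) (gamma + s'))%:R *
       scl (- Num.sg (a i)) (H i) gamma).
exists F'.
  apply: decomposedD; first exact: decomposed_term.
  apply: decomposed_sum => i ai; apply: decomposed_term; first exact: hM'.
  move=> j; have [p hp] := unips_crossing (crd M s i / a i) uM ai uQ j; exists p.
  apply: killedZ; rewrite /H /t.
  rewrite (_ : (fun gamma => _) = (fun gamma => Q (gamma - alpha *~ (Num.floor (crd M gamma i / crd M alpha i + crd M s i / a i) + 1)))) //.
  by apply/funext => g; rewrite crdD mulrDl.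
move=> gamma ig.
(* The coordinate None is the condition 0 < eps + k. *)
pose xx (o : option 'I_n) := if o is Some i then crd M (gamma + s) i else eps.
pose aa (o : option 'I_n) := if o is Some i then a i else -1.
pose y (k : int) := Q (gamma - alpha *~ k).
exists (absz (Num.floor (t gamma ip) + 1)) => K hK.
have ialpha : integral alpha by exact: A_int.
have crds k i : crd M (gamma - alpha *~ k + s) i = crd M (gamma + s) i - k%:~R * a i.
  by rewrite !crdD crdN -scaler_int crdZ addrAC.
have crdsn (k : nat) i : crd M (gamma - alpha *+ k + s) i = crd M (gamma + s) i - k%:R * a i.
  exact: (crds k i).
have crds' i : crd M (gamma + s') i = crd M (gamma + s) i + eps * a i.
  by rewrite /s' !crdD crdZ addrA.
have crdr i j : a i != 0 -> crd (replace_col M i alpha) (gamma + s') j =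
   if j == i then t gamma i + eps else crd M (gamma + s) j - t gamma i * a j.
  move=> ai; have [_ ->] := replace_colP uM ai; rewrite !crds' -/a.
  by case: ifP => _; rewrite /t; field.
have sumE := @sum_over_interval _ xx aa y K (Some ip) None aip (ltrN10 _).
transitivity (\sum_(k < K) [forall i, 0 < xx i - k%:R * aa i]%:R * (y k - y k.+1)).
  apply: eq_bigr => k _; congr ((nat_of_bool _)%:R * _).
    rewrite /in_cone; apply/forallP/forallP => h; first case=> [i|] /=.
    - by have := h i; rewrite crdsn.
    - by rewrite mulrN1 opprK ltr_pwDl // ler0n.
    - by move=> i; have := h (Some i); rewrite /= crdsn.
  rewrite -dQ /dif /shift; change (Q (gamma - alpha *+ k) - Q (gamma - alpha *+ k - alpha) = y k - y k.+1).
  by rewrite /y -!pmulrn mulrSr opprD addrA.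
rewrite sumE; first last.
- move=> k h; have h2 := h None; have h1 := h (Some ip); rewrite /= mulrN1 opprK in h2; rewrite /= in h1.
  have k0 : 0 <= k.
    rewrite -ltzD1 -(ltr_int rat) intrD /= (_ : 0%:~R = 0) // (_ : 1%:~R = 1) //; lra.
  rewrite k0 /=; have : k%:~R < t gamma ip by rewrite /t ltr_pdivlMr // -subr_gt0.
  move=> /ltW; rewrite -floor_ge_int; move: hK; rewrite -lez_nat.
  move: (Num.floor (t gamma ip)) => f; move: k0; clear; lia.
- move=> [i|] [j|] //= ai ji; rewrite /crossing /=.
  + have ji' : (j == i) = false by apply/eqP => E; rewrite E eqxx in ji.
    by have := gs' _ (hM' i ai) j gamma ig; rewrite crdr // ji'.
  + have := gs' _ (hM' i ai) i gamma ig; rewrite crdr // eqxx.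
    by rewrite mulrN1 opprK addrC.
  + have := gs' _ hM j gamma ig; rewrite crds'.
    by rewrite invrN1 mulrN1 mulNr opprK.
- move=> [i|] k /= ai.
    by rewrite -crds; apply: gs => //; apply/integralD/integralN/integralMz.
  apply/eqP => h; have : (-1)%:~R < k%:~R :> rat by move: h; rewrite mulrN1 opprK; lra.
  have : k%:~R < 0%:~R :> rat by move: h; rewrite mulrN1 opprK; lra.
  by rewrite !ltr_int; lia.
rewrite big_option ?oppr_eq0 ?oner_eq0 //=.
have E0 : crossing xx aa None = - eps by rewrite /crossing /= invrN1 mulrN1.
rewrite E0 sgrN sgr1 opprK mul1r.
have -> : Num.floor (- eps) = -1 by apply: floor_def; rewrite intrD /=; apply/andP; split; lra.
rewrite /y addNr mulr0z subr0.
rewrite /F' [RHS](_ : _ = (in_cone M (gamma + s'))%:R * Q gamma +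
  \sum_(i | a i != 0) (in_cone (replace_col M i alpha) (gamma + s'))%:R *
       scl (- Num.sg (a i)) (H i) gamma); last first.
  rewrite [LHS](_ : _ = (in_cone M (gamma + s'))%:R * Q gamma + (\sum_(i | a i != 0) (fun gamma => (in_cone (replace_col M i alpha) (gamma + s'))%:R *
       scl (- Num.sg (a i)) (H i) gamma)) gamma) //; congr (_ + _).
  by elim/big_rec2: _ => // i y1 y2 _ <-.
congr ((nat_of_bool _)%:R * _ + _).
  rewrite /in_cone; apply/forallP/forallP => h.
    by move=> j; have := h (Some j); rewrite E0 /= crds' mulNr opprK.
  by case=> [j|] //=; rewrite E0 -/a mulNr opprK -crds'.
apply: eq_bigr => i ai; rewrite /scl mulrCA; congr ((nat_of_bool _)%:R * _).
rewrite /in_cone; apply/forallP/forallP => h.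
  move=> j; rewrite crdr //; case: eqP => [_|/eqP ji].
    by have := h None; rewrite /= mulrN1 opprK addrC.
  by have := h (Some j); rewrite /= (_ : Some j != Some i).
case=> [j|]; apply/implyP => ji /=.
  have ji' : (j == i) = false by apply/negP => /eqP E; rewrite E eqxx in ji.
  by have := h j; rewrite crdr // ji'.
by have := h i; rewrite crdr // eqxx /= mulrN1 opprK addrC.
Qed.

(** The infinite sum over k is finite for each gamma, but the number of terms
    depends on gamma; K is any large enough cut-off. *)
Lemma ray_sum F alpha s eps : decomposed s F -> alpha \in A ->
    0 < eps < 1 -> generic s -> generic (s + eps *: alpha) ->
  exists2 F', decomposed (s + eps *: alpha) F' &
    forall gamma, integral gamma -> exists K0, forall K, (K0 <= K)%N ->
      \sum_(k < K) F (gamma - alpha *+ k) = F' gamma.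
Proof.
move=> [q uq hq] aA he gs gs'.
have : exists2 F', decomposed (s + eps *: alpha) F' &
    forall gamma, integral gamma -> exists K0, forall K, (K0 <= K)%N ->
      \sum_(k < K) \sum_(M <- bases) (in_cone M (gamma - alpha *+ k + s))%:R * q M (gamma - alpha *+ k) = F' gamma.
  have : {subset bases <= bases} by [].
  elim: {1 3}bases => [|M r IH] sub.
    exists 0; first exact: decomposed0.
    by move=> gamma _; exists 0%N => K _; rewrite big1 // => k _; rewrite big_nil.
  have [|F1 d1 h1] := IH; first by move=> M' hM'; apply: sub; rewrite inE hM' orbT.
  have MB : M \in bases by apply: sub; rewrite inE eqxx.
  have [F2 d2 h2] := ray_sum_term MB (uq _ MB) aA he gs gs'.
  exists (F2 + F1); first exact: decomposedD.
  move=> gamma ig; have [K1 hK1] := h1 gamma ig; have [K2 hK2] := h2 gamma ig.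
  exists (maxn K1 K2) => K; rewrite geq_max => /andP[k1 k2].
  under eq_bigr do rewrite big_cons.
  by rewrite big_split /= hK1 // hK2.
move=> [F' dF' hF']; exists F' => // gamma ig; have [K0 hK] := hF' gamma ig.
exists K0 => K leK; rewrite -(hK K) //; apply: eq_bigr => k _; apply: hq.
by apply/integralD/integralN; rewrite // pmulrn; apply/integralMz/A_int.
Qed.

End ConeDecomposition.

(** * Vector partition functions *)

Section Counting.

Variable n : nat.
Local Notation V := 'cV[rat]_n.

Definition height (v : V) : rat := \sum_i v i 0.
Definition natural (v : V) := [forall i, v i 0 \is a Num.nat].

Lemma heightD u v : height (u + v) = height u + height v.
Proof. by rewrite /height -big_split; apply: eq_bigr => i _; rewrite mxE. Qed.
Lemma heightN v : height (- v) = - height v.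
Proof. by rewrite /height -sumrN; apply: eq_bigr => i _; rewrite mxE. Qed.
Lemma heightMn v k : height (v *+ k) = height v *+ k.
Proof. by elim: k => [|k IH]; rewrite ?mulr0n ?mulrS ?heightD ?IH // /height big1 // => i _; rewrite mxE. Qed.

(** Vectors of height at least 1 can be subtracted from v less often than this
    before the height becomes negative. *)
Definition height_bound v : nat := (absz (Num.floor (height v))).+1.

Lemma height_boundP v (k : nat) : k%:R <= height v -> (k < height_bound v)%N.
Proof.
rewrite pmulrn => h; have : (k%:Z <= Num.floor (height v)) by rewrite floor_ge_int.
by rewrite /height_bound; lia.
Qed.

(** The number of ways to write v as a combination of l and of the simple
    roots: the latter form the standard basis, so their coefficients are the
    coordinates of the remainder, and only its integrality and positivity have
    to be tested. *)
Fixpoint pcount (l : seq V) (v : V) : nat :=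
  if l is a :: l' then (\sum_(k < height_bound v) pcount l' (v - a *+ k))%N
  else natural v.

Lemma pcount_height l v : (forall a, a \in l -> 0 <= height a) ->
  height v < 0 -> pcount l v = 0%N.
Proof.
elim: l v => [|a l IH] v hl hv /=.
  case: (boolP (natural v)) => // /forallP h; move: hv; rewrite ltNge sumr_ge0 // => i _.
  by have /natrP[k ->] := h i.
apply: big1 => k _; apply: IH => [b bl|]; first by apply: hl; rewrite inE bl orbT.
rewrite heightD heightN heightMn (le_lt_trans _ hv) // gerDl oppr_le0 mulrn_wge0 //.
by apply: hl; rewrite inE eqxx.
Qed.

Lemma pcount_cons a l v K : (forall b, b \in a :: l -> 1 <= height b) ->
  (height_bound v <= K)%N ->
  (\sum_(k < K) pcount l (v - a *+ k))%N = pcount (a :: l) v.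
Proof.
move=> hl hK; rewrite /= -(big_mkord xpredT (fun k => pcount l (v - a *+ k))).
rewrite (big_cat_nat (n := height_bound v)) //= big_mkord [X in (_ + X)%N]big_nat.
rewrite [X in (_ + X)%N]big1 ?addn0 // => k /andP[hk _].
apply: pcount_height => [b bl|].
  by rewrite (le_trans ler01) // hl // inE bl orbT.
rewrite ltNge; apply/negP => h0; move: hk; rewrite leqNgt => /negP; apply.
apply: height_boundP; move: h0; rewrite heightD heightN heightMn subr_ge0.
apply: le_trans; rewrite -[height a *+ k]mulr_natr ler_peMl ?ler0n // hl // inE eqxx //.
Qed.

Variables (I : finType) (vec : I -> V) (sidx : 'I_n -> I).
Hypothesis vec_nat : forall a i, vec a i 0 \is a Num.nat.
Hypothesis vec_height : forall a, 1 <= height (vec a).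
Hypothesis vec_sidx : forall i, vec (sidx i) = delta_mx i 0.

Definition upd (c : {ffun I -> nat}) a k : {ffun I -> nat} :=
  [ffun b => if b == a then k else c b].

(** The recursion of [pcount], with the solutions themselves instead of their
    number; the vectors [vec (sidx i)] form the standard basis. *)
Fixpoint solutions (r : seq I) (v : V) : seq {ffun I -> nat} :=
  if r is a :: r' then
    [seq upd c a k | k <- iota 0 (height_bound v), c <- solutions r' (v - vec a *+ k)]
  else if natural v then
    [:: [ffun a => (\sum_i (a == sidx i) * Num.truncn (v i 0)%R)%N]] else [::].

Lemma solutions_cons a r v : solutions (a :: r) v =
  [seq upd c a k | k <- iota 0 (height_bound v), c <- solutions r (v - vec a *+ k)].
Proof. by []. Qed.

Lemma sidx_inj : injective sidx.
Proof.
move=> i j e; have := vec_sidx i; rewrite e vec_sidx => /colP/(_ j).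
by rewrite !mxE eqxx andbT; case: eqP => // _ /eqP; rewrite oner_eq0.
Qed.

Lemma size_solutions r v : size (solutions r v) = pcount [seq vec a | a <- r] v.
Proof.
elim: r v => [|a r IH] v; first by rewrite /=; case: ifP.
rewrite solutions_cons size_allpairs_dep map_cons [RHS]/= sumnE big_map -[in RHS](big_mkord xpredT (fun k => pcount _ (v - vec a *+ k))).
by rewrite /index_iota subn0; apply: eq_bigr => k _; rewrite IH.
Qed.

Lemma sum_upd (c : {ffun I -> nat}) a k : c a = 0%N ->
  \sum_b vec b *+ upd c a k b = \sum_b vec b *+ c b + vec a *+ k.
Proof.
move=> ca; rewrite [in RHS](bigD1 a) // [in LHS](bigD1 a) //= ffunE eqxx ca mulr0n add0r addrC.
by congr (_ + _); apply: eq_bigr => b /negPf ba; rewrite ffunE ba.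
Qed.

Lemma mem_solutions r v c : uniq r -> (forall i, sidx i \notin r) ->
  (c \in solutions r v) <->
  (forall b, b \notin r -> (forall i, b != sidx i) -> c b = 0%N) /\
  \sum_b vec b *+ c b = v.
Proof.
elim: r v c => [|a r IH] v c.
  move=> _ _ /=; split=> [|[h1 h2]].
    case: ifP => // /forallP hv; rewrite inE => /eqP ->; split.
      by move=> b _ hb; rewrite ffunE big1 // => i _; rewrite (negPf (hb i)).
    apply/colP => j; rewrite summxE.
    under eq_bigr => b _ do rewrite -scaler_nat mxE ffunE.
    rewrite (bigD1 (sidx j)) //= [X in _ + X]big1 ?addr0 => [|b bj].
      rewrite vec_sidx mxE !eqxx mulr1 (bigD1 j) //= eqxx mul1n big1 ?addn0.
        exact/truncnK/hv.
      by move=> i ij; rewrite (inj_eq sidx_inj) eq_sym (negPf ij).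
    have [/existsP[i /eqP bi]|nb] := boolP [exists i, b == sidx i].
      rewrite bi vec_sidx mxE (_ : j == i = false) ?mulr0 //.
      by apply/negP => /eqP E; rewrite bi E eqxx in bj.
    rewrite big1 ?mul0r // => i _; case: eqP => // bi.
    by move: nb; rewrite negb_exists => /forallP/(_ i); rewrite bi eqxx.
  have vE j : v j 0 = (c (sidx j))%:R.
    rewrite -h2 summxE (bigD1 (sidx j)) //= -scaler_nat mxE vec_sidx mxE !eqxx mulr1.
    rewrite big1 ?addr0 // => b bj; have [/existsP[i /eqP bi]|nb] := boolP [exists i, b == sidx i].
      rewrite -scaler_nat mxE bi vec_sidx mxE (_ : j == i = false) ?mulr0 //.
      by apply/negP => /eqP E; rewrite bi E eqxx in bj.
    rewrite h1 ?mulr0n ?mxE // => i; apply/eqP => bi.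
    by move: nb; rewrite negb_exists => /forallP/(_ i); rewrite bi eqxx.
  have -> : natural v by apply/forallP => j; rewrite vE natr_nat.
  rewrite inE; apply/eqP/ffunP => b; rewrite ffunE.
  have [/existsP[i /eqP bi]|nb] := boolP [exists i, b == sidx i].
    rewrite bi (bigD1 i) //= eqxx mul1n big1 ?addn0 ?vE ?natrK //.
    by move=> j ji; rewrite (inj_eq sidx_inj) eq_sym (negPf ji).
  have nb' i : b != sidx i by apply: contraNN nb => h; apply/existsP; exists i.
  by rewrite h1 // big1 // => i _; rewrite (negPf (nb' i)).
rewrite solutions_cons => /andP[ar ur] hs.
have hs' i : sidx i \notin r by have := hs i; rewrite inE negb_or => /andP[].
have na i : a != sidx i by have := hs i; rewrite inE negb_or eq_sym => /andP[].
split=> [/allpairsPdep[k [c' [kh hc' ->]]]|[h1 h2]].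
  have [h1 h2] := (IH _ _ ur hs').1 hc'.
  split; last by rewrite sum_upd ?h2 ?subrK // h1.
  move=> b; rewrite inE negb_or => /andP[/negPf ba br] hb; rewrite ffunE ba.
  exact: h1.
apply/allpairsPdep; exists (c a), (upd c a 0); split.
- rewrite mem_iota /= add0n; apply: height_boundP; rewrite -h2 (bigD1 a) //= heightD heightMn.
  rewrite -[X in X <= _]addr0 lerD //.
    by rewrite -[height (vec a) *+ _]mulr_natr ler_peMl ?ler0n.
  rewrite /height sumr_ge0 // => i _; rewrite summxE sumr_ge0 // => b _.
  by rewrite -scaler_nat mxE mulr_ge0 ?ler0n //; have /natrP[k ->] := vec_nat b i; rewrite ler0n.
- apply/(IH _ _ ur hs'); split.
    move=> b br hb; rewrite ffunE; case: eqP => // /eqP ba.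
    by apply: h1 => //; rewrite inE negb_or ba.
  apply/eqP; rewrite eq_sym subr_eq -sum_upd ?ffunE ?eqxx //; apply/eqP.
  by rewrite -h2; apply: eq_bigr => b _; rewrite !ffunE; case: eqP => // ->.
- by apply/ffunP => b; rewrite !ffunE; case: eqP => // ->.
Qed.

Lemma uniq_solutions r v : uniq r -> (forall i, sidx i \notin r) ->
  uniq (solutions r v).
Proof.
elim: r v => [|a r IH] v; first by rewrite /=; case: ifP.
rewrite solutions_cons => /andP[ar ur] hs.
have hs' i : sidx i \notin r by have := hs i; rewrite inE negb_or => /andP[].
have na i : a != sidx i by have := hs i; rewrite inE negb_or eq_sym => /andP[].
apply: allpairs_uniq_dep; first exact: iota_uniq.
  by move=> k _; exact: IH.
move=> [k c] [k' c'] /allpairsPdep[k1 [c1 [_ h1 [-> ->]]]].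
move=> /allpairsPdep[k2 [c2 [_ h2 [-> ->]]]] /= E.
have ck : k1 = k2 by have := congr1 (fun f : {ffun _ -> _} => f a) E; rewrite !ffunE eqxx.
rewrite -ck in h2 E *; congr (existT _ _ _).
have [z1 _] := (mem_solutions _ _ ur hs').1 h1.
have [z2 _] := (mem_solutions _ _ ur hs').1 h2.
apply/ffunP => b; have [->|/negPf ba] := eqVneq b a; first by rewrite z1 ?z2.
by have := congr1 (fun f : {ffun _ -> _} => f b) E; rewrite !ffunE ba.
Qed.

Lemma card_solutions r v : uniq r -> (forall i, sidx i \notin r) ->
    (forall b, b \notin r -> exists i, b = sidx i) ->
  #|` fset_set [set c : {ffun I -> nat} | \sum_a vec a *+ c a = v] |
    = pcount [seq vec a | a <- r] v.
Proof.
move=> ur hs hr; rewrite -size_solutions.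
have -> : [set c : {ffun I -> nat} | \sum_a vec a *+ c a = v] =
          [set` [fset c in solutions r v]%fset].
  apply/seteqP; split=> c /=; rewrite inE /=.
    move=> h; apply/mem_solutions => //; split=> // b br hb.
    by have [i bi] := hr _ br; have := hb i; rewrite bi eqxx.
  by move=> /(mem_solutions _ _ ur hs)[].
by rewrite set_fsetK card_fseq undup_id // uniq_solutions.
Qed.

End Counting.

(** * Functions that are polynomial on residue classes *)

Section QuasiPolynomials.

Variables (R : realType) (n : nat).
Local Notation C := R[i].
Local Notation fn := ('cV[C]_n -> C).
Local Notation coord := (@coordinate R n).
Local Notation basic := (@basic_quasinumber R n).

Section Algebra.

Variable G : set fn.
Local Notation alg := (rat_algebra G).

Lemma alg_ext f g : alg f -> (forall x, f x = g x) -> alg g.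
Proof. by move=> hf /funext <-. Qed.

Lemma alg0 : alg (fun=> 0).
Proof. by apply: alg_ext (RatAlgConst G 0) _ => x; rewrite rmorph0. Qed.

Lemma algN f : alg f -> alg (fun x => - f x).
Proof.
move=> hf; apply: alg_ext (RatAlgMul (RatAlgConst G (-1)) hf) _ => x.
by rewrite rmorphN1 mulN1r.
Qed.

Lemma algB f g : alg f -> alg g -> alg (fun x => f x - g x).
Proof. by move=> hf hg; exact: RatAlgAdd hf (algN hg). Qed.

Lemma alg_sum (I : Type) (r : seq I) (F : I -> fn) :
  (forall i, alg (F i)) -> alg (fun x => \sum_(i <- r) F i x).
Proof.
move=> H; elim: r => [|i r IH].
  by apply: alg_ext alg0 _ => x; rewrite big_nil.
by apply: alg_ext (RatAlgAdd (H i) IH) _ => x; rewrite big_cons.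
Qed.

Lemma alg_sub (G' : set fn) f : G `<=` G' -> alg f -> rat_algebra G' f.
Proof.
move=> sG; elim=> [r|h /sG hg|h1 h2 _ ? _ ?|h1 h2 _ ? _ ?].
- exact: RatAlgConst.
- exact: RatAlgGen.
- exact: RatAlgAdd.
- exact: RatAlgMul.
Qed.

End Algebra.

Definition polyfn : fn -> Prop := rat_algebra (range coord).

Definition lattice_point (z : 'cV[int]_n) : 'cV[C]_n := map_mx intr z.

Lemma lattice_point_inj : injective lattice_point.
Proof.
move=> z z' /colP h; apply/colP => i; have := h i; rewrite !mxE.
by move/eqP; rewrite eqr_int => /eqP.
Qed.

Definition off_lattice (x : 'cV[C]_n) := forall z, x <> lattice_point z.

Definition congruent (N : nat) (z z' : 'cV[int]_n) :=
  forall i, exists k : int, z' i 0 = z i 0 + k * N%:Z.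

Definition same_cell N x y := (off_lattice x /\ off_lattice y) \/
  exists z z', [/\ x = lattice_point z, y = lattice_point z' & congruent N z z'].

(** The cells are the complement of the integral points and the residue classes
    modulo N.  Functions that agree with a polynomial on each cell are exactly
    those with possible common period N, for positive N, and unlike the latter notion this one
    does not mention presentations. *)
Definition cellwise N (q : fn) :=
  forall x, exists2 g, polyfn g & forall y, same_cell N x y -> q y = g y.

Lemma congruent_dvd N N' z z' : (N %| N')%N -> congruent N' z z' -> congruent N z z'.
Proof.
move=> /dvdnP[m ->] h i; have [k ->] := h i.
by exists (k * m); rewrite PoszM mulrA.
Qed.

Lemma same_cell_dvd N N' x y : (N %| N')%N -> same_cell N' x y -> same_cell N x y.
Proof.
move=> d [[h1 h2]|[z [z' [-> -> h]]]]; first by left.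
by right; exists z, z'; split=> //; exact: congruent_dvd h.
Qed.

Lemma cellwise_dvd N N' q : (N %| N')%N -> cellwise N q -> cellwise N' q.
Proof.
move=> d h x; have [g hg e] := h x; exists g => // y hy; apply: e.
exact: same_cell_dvd hy.
Qed.

Lemma off_latticeP x : off_lattice x \/ exists z, x = lattice_point z.
Proof.
have [h|h] := pselect (exists z, x = lattice_point z); first by right.
by left => z e; apply: h; exists z.
Qed.

Lemma cellwise_const N r : cellwise N (fun=> ratr r).
Proof. by move=> x; exists (fun=> ratr r) => //; exact: RatAlgConst. Qed.

Lemma cellwise_add N f g : cellwise N f -> cellwise N g -> cellwise N (fun x => f x + g x).
Proof.
move=> hf hg x; have [f' pf ef] := hf x; have [g' pg eg] := hg x.
by exists (fun x => f' x + g' x); [exact: RatAlgAdd|move=> y hy; rewrite ef ?eg].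
Qed.

Lemma cellwise_mul N f g : cellwise N f -> cellwise N g -> cellwise N (fun x => f x * g x).
Proof.
move=> hf hg x; have [f' pf ef] := hf x; have [g' pg eg] := hg x.
by exists (fun x => f' x * g' x); [exact: RatAlgMul|move=> y hy; rewrite ef ?eg].
Qed.

Lemma cellwise_polyfn N f : polyfn f -> cellwise N f.
Proof. by move=> hf x; exists f. Qed.

Lemma basic_off t x : off_lattice x -> basic t x = 0.
Proof.
by move=> h; rewrite /basic_quasinumber; case: asboolP => // -[z e _]; case: (h z).
Qed.

Lemma basic_on t z : basic t (lattice_point z) =
  (`[< forall i, ((bq_mx t *m z) i ord0 = bq_col t i ord0 %[mod bq_mod t])%Z >])%:R.
Proof.
rewrite /basic_quasinumber; congr ((nat_of_bool _)%:R); apply/asboolP/asboolP.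
  by move=> [z' e h]; rewrite (lattice_point_inj e).
by move=> h; exists z.
Qed.

Lemma cellwise_basic t : cellwise (bq_mod t) (basic t).
Proof.
move=> x; have [hx|[z ->]] := off_latticeP x.
  exists (fun=> 0); first exact: alg0.
  move=> y [[_ hy]|[z [z' [e _ _]]]]; first exact: basic_off.
  by case: (hx z).
pose b := `[< forall i, ((bq_mx t *m z) i ord0 = bq_col t i ord0 %[mod bq_mod t])%Z >].
exists (fun=> ratr b%:R); first exact: RatAlgConst.
move=> y [[h _]|[z1 [z' [e -> h]]]]; first by case: (h z).
rewrite basic_on ratr_nat; congr ((nat_of_bool _)%:R).
rewrite -(lattice_point_inj e) in h.
have E i : ((bq_mx t *m z') i ord0 = (bq_mx t *m z) i ord0 %[mod bq_mod t])%Z.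
  rewrite !mxE; elim/big_ind2: _ => // [a1 a2 b1 b2 h1 h2|j _].
    by rewrite -modzDm h1 h2 modzDm.
  have [k ->] := h j; by rewrite mulrDr mulrA addrC modzMDl.
by apply/asboolP/asboolP => h' i; rewrite ?E -?h' // -E.
Qed.

Lemma cellwise_quasipolynomial q : quasipolynomial q ->
  exists2 N, (0 < N)%N & cellwise N q.
Proof.
elim=> [r|f []|f g _ [N N0 hN] _ [M M0 hM]|f g _ [N N0 hN] _ [M M0 hM]].
- by exists 1%N => //; exact: cellwise_const.
- by exists 1%N => //; apply: cellwise_polyfn; exact: RatAlgGen.
- by move=> [t _ <-]; exists (bq_mod t); [exact: bq_mod_gt0|exact: cellwise_basic].
- exists (N * M)%N; rewrite ?muln_gt0 ?N0 //; apply: cellwise_add.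
  + by apply: cellwise_dvd hN; exact: dvdn_mulr.
  + by apply: cellwise_dvd hM; exact: dvdn_mull.
- exists (N * M)%N; rewrite ?muln_gt0 ?N0 //; apply: cellwise_mul.
  + by apply: cellwise_dvd hN; exact: dvdn_mulr.
  + by apply: cellwise_dvd hM; exact: dvdn_mull.
Qed.

Lemma possible_common_period_cellwise q D : possible_common_period q D ->
  (0 < D)%N /\ cellwise D q.
Proof.
move=> [k [t [hq ->]]]; split.
  by elim/big_ind: _ => // [a b a0 b0|i _]; rewrite ?lcmn_gt0 ?a0 // bq_mod_gt0.
set E := (\big[_/_]_(_ < _) _)%N.
have dE i : (bq_mod (t i) %| E)%N by rewrite /E (bigD1 i) //= dvdn_lcml.
elim: hq => [r|f []|f g _ hf _ hg|f g _ hf _ hg].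
- exact: cellwise_const.
- by move=> h; apply: cellwise_polyfn; exact: RatAlgGen.
- by move=> [i _ <-]; apply: cellwise_dvd (dE i) _; exact: cellwise_basic.
- exact: cellwise_add.
- exact: cellwise_mul.
Qed.

Section Residues.

Variables (N : nat) (N_gt0 : (0 < N)%N).
Local Notation I := {ffun 'I_n -> 'I_N}.

(** The quasinumber that detects the residue class c modulo N.  Its matrix is the
    identity with a zero row added, since the number of rows must be positive
    even for n = 0. *)
Definition residue_data (c : I) : basic_data n :=
  @BasicData n n (\matrix_(i < n.+1, j < n) (i == j :> nat)%:Z)
    (\col_(i < n.+1) oapp (fun j : 'I_n => (c j : nat)%:Z) 0 (insub (i : nat))) N N_gt0.

Lemma basic_residue (c : I) z :
  basic (residue_data c) (lattice_point z)
    = [forall i, (z i ord0 %% N%:Z)%Z == c i]%:R.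
Proof.
rewrite basic_on; congr ((nat_of_bool _)%:R).
have small (i : 'I_n) : ((c i : nat)%:Z %% N%:Z)%Z = c i.
  by rewrite modz_small // ltz_nat ltn_ord.
have row (i : 'I_n) : (bq_mx (residue_data c) *m z) (widen_ord (leqnSn n) i) ord0 = z i 0.
  rewrite mxE (bigD1 i) //= mxE eqxx mul1r big1 ?addr0 // => j ji.
  by rewrite mxE /= eq_sym (_ : (j == i :> nat) = false) ?mul0r //; exact: negbTE.
apply/asboolP/forallP => h i.
  by have := h (widen_ord (leqnSn n) i); rewrite row mxE /= (valK i) /= small => ->.
have [lt|ge] := ltnP i n; last first.
  rewrite /= [in RHS]mxE insubF /= ?mxE; last by rewrite ltnNge ge.
  rewrite big1 // => j _; rewrite mxE (_ : (i == j :> nat) = false) ?mul0r //.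
  by apply/negbTE; rewrite neq_ltn (leq_trans (ltn_ord j) ge) orbT.
have -> : i = widen_ord (leqnSn n) (Ordinal lt) by exact: val_inj.
rewrite row mxE /= (valK (Ordinal lt)) /= small.
by have /eqP := h (Ordinal lt).
Qed.

Lemma residue_lt (z : 'cV[int]_n) i : (absz (z i ord0 %% N%:Z)%Z < N)%N.
Proof.
have N0 : N%:Z != 0 by lia.
by have := modz_ge0 (z i 0) N0; have := ltz_pmod (z i 0) (d := N) N_gt0; lia.
Qed.

Definition residue (z : 'cV[int]_n) : I := [ffun i => Ordinal (residue_lt z i)].
Definition residue_point (c : I) : 'cV[int]_n := \col_i (c i : nat)%:Z.

Lemma residueE (c : I) (z : 'cV[int]_n) : [forall i, (z i ord0 %% N%:Z)%Z == c i] = (c == residue z).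
Proof.
have N0 : N%:Z != 0 by lia.
apply/forallP/eqP => [h|-> i].
  by apply/ffunP => i; apply: val_inj; rewrite ffunE /= (eqP (h i)).
by rewrite ffunE /=; have := modz_ge0 (z i 0) N0; lia.
Qed.

Lemma residue_congruent z : congruent N (residue_point (residue z)) z.
Proof.
have N0 : N%:Z != 0 by lia.
move=> i; exists (z i ord0 %/ N%:Z)%Z; rewrite mxE ffunE /=.
by have := divz_eq (z i 0) N; have := modz_ge0 (z i 0) N0; lia.
Qed.

(** The function is g0 + sum_c tau_c (g_c - g0), where g0 is its polynomial off
    the integral points, tau_c detects the residue class c and g_c is the
    polynomial on that class. *)
Lemma cellwise_possible_common_period q :
  cellwise N q -> possible_common_period q N.
Proof.
move=> hq; exists #|{: I}|, (fun i : 'I_#|{: I}| => residue_data (enum_val i)); split; last first.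
  have lcmE k : (0 < k)%N -> N = (\big[lcmn/1]_(i < k) N)%N.
    case: k => // k _; elim: k => [|k IH]; first by rewrite big_ord1.
    by rewrite big_ord_recl -IH; apply/esym/lcmn_idPl.
  by apply: lcmE; apply/card_gt0P; exists (residue 0).
set G := _ `|` _.
have [g0 [pg0 eg0]] : exists g0, polyfn g0 /\ forall y, off_lattice y -> q y = g0 y.
  have [[x hx]|h] := pselect (exists x, off_lattice x).
    by have [g pg eg] := hq x; exists g; split=> // y hy; apply: eg; left.
  exists (fun=> 0); split; first exact: alg0.
  by move=> y hy; case: h; exists y.
have /choice[g hg] : forall c : I, exists g, polyfn g /\
    forall z, residue z = c -> q (lattice_point z) = g (lattice_point z).
  move=> c; have [g pg eg] := hq (lattice_point (residue_point c)).
  exists g; split=> // z zc; apply: eg; right.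
  by exists (residue_point c), z; split=> //; rewrite -zc; exact: residue_congruent.
have sub f : polyfn f -> rat_algebra G f by apply: alg_sub => h; left.
pose tau (i : 'I_#|{: I}|) := basic (residue_data (enum_val i)).
have algt i : rat_algebra G (tau i) by apply: RatAlgGen; right; exists i.
pose h := fun x => g0 x + \sum_i tau i x * (g (enum_val i) x - g0 x).
apply: (@alg_ext _ h).
  apply: RatAlgAdd; first exact: sub.
  apply: alg_sum => i; apply: RatAlgMul; first exact: algt.
  by apply: algB; apply: sub => //; have [] := hg (enum_val i).
move=> x; rewrite /h; have [hx|[z ->]] := off_latticeP x.
  by rewrite eg0 // big1 ?addr0 // => i _; rewrite /tau basic_off ?mul0r.
rewrite (bigD1 (enum_rank (residue z))) //= /tau basic_residue residueE enum_rankK eqxx mul1r.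
rewrite -(hg (residue z)).2 // big1 ?addr0 ?subrKC // => i ir; rewrite basic_residue residueE.
rewrite (_ : enum_val i == residue z = false) ?mul0r //.
by apply/eqP => e; rewrite -e enum_valK eqxx in ir.
Qed.

End Residues.

End QuasiPolynomials.

(** * Uniqueness and minimal periods of quasipolynomials *)

Section Periods.

Variables (R : realType) (n : nat).
Local Notation C := R[i].
Local Notation fn := ('cV[C]_n -> C).
Local Notation coord := (@coordinate R n).
Local Notation polyfn := (@polyfn R n).
Local Notation lattice_point := (@lattice_point R n).

(** The degree in each variable separately is bounded on sums and products, and
    is all that interpolation on grids needs. *)
Definition coordinate_degree M (g : fn) := forall x i, exists p : {poly C},
  (size p <= M)%N /\ forall t, g (x + t *: delta_mx i 0) = p.[t].

Lemma polyfn_degree g : polyfn g -> exists M, coordinate_degree M g.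
Proof.
elim=> [r|f [j _ <-]|f h _ [M hf] _ [M' hh]|f h _ [M hf] _ [M' hh]].
- by exists 1%N => x i; exists (ratr r)%:P; split=> [|t]; rewrite ?size_polyC_leq1 ?hornerC.
- exists 2%N => x i; exists ((i == j)%:R *: 'X + (x j 0)%:P); split=> [|t].
    rewrite (leq_trans (size_polyD _ _)) // geq_max (leq_trans (size_scale_leq _ _)) ?size_polyX //.
    by rewrite (leq_trans (size_polyC_leq1 _)).
  rewrite /coordinate !mxE eqxx andbT !hornerE eq_sym addrC; congr (_ + _).
  exact: mulrC.
- exists (maxn M M') => x i; have [p [sp ep]] := hf x i; have [q [sq eq]] := hh x i.
  exists (p + q); split=> [|t]; last by rewrite ep eq hornerD.
  rewrite (leq_trans (size_polyD _ _)) // geq_max (leq_trans sp) ?leq_maxl //.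
  by rewrite (leq_trans sq) ?leq_maxr.
- exists (M + M')%N => x i; have [p [sp ep]] := hf x i; have [q [sq eq]] := hh x i.
  exists (p * q); split=> [|t]; last by rewrite ep eq hornerM.
  rewrite (leq_trans (size_polyMleq _ _)) // (leq_trans (leq_pred _)) //.
  exact: leq_add.
Qed.

Definition on_grid (x0 : 'cV[C]_n) (L : C) M (x : 'cV[C]_n) :=
  forall i, exists2 k, (k < M)%N & x i 0 = x0 i 0 + L * k%:R.

(** Induction on the number of coordinates that are not yet confined to the grid:
    each freed coordinate is a variable of a polynomial with more roots than its
    degree allows. *)
Lemma vanish_on_grid M g x0 L : L != 0 -> coordinate_degree M g ->
  (forall x, on_grid x0 L M x -> g x = 0) -> forall x, g x = 0.
Proof.
move=> L0 hM h0.
suff main j : forall x : 'cV[C]_n, (forall i : 'I_n, (j <= i)%N -> exists2 k, (k < M)%N & x i 0 = x0 i 0 + L * k%:R) -> g x = 0.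
  by move=> x; apply: (main n) => i; rewrite leqNgt ltn_ord.
elim: j => [|j IH] x hx; first by apply: h0 => i; exact: hx.
have [lt|ge] := ltnP j n; last first.
  by apply: IH => i hi; have := leq_trans ge hi; rewrite leqNgt ltn_ord.
pose jo := Ordinal lt; have [p [sp ep]] := hM x jo.
pose ts := [seq x0 jo 0 + L * k%:R - x jo 0 | k <- iota 0 M].
have p0 : p = 0.
  apply: (@roots_geq_poly_eq0 _ _ ts).
  - apply/allP => t /mapP[k]; rewrite mem_iota add0n => /andP[_ hk] ->.
    rewrite /root -ep IH // => i; rewrite leq_eqVlt => /orP[/eqP ji|ji].
      have -> : i = jo by exact/val_inj/esym.
      by exists k => //; rewrite !mxE !eqxx mulr1 addrC subrK.
    have [k' hk' e] := hx i ji; exists k' => //.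
    rewrite -e !mxE (_ : i == jo = false) ?mulr0 ?addr0 //.
    by apply/negbTE; apply: contraTneq ji => ->; rewrite ltnn.
  - rewrite map_inj_uniq ?iota_uniq // => k k' /addIr /addrI /(mulfI L0) /eqP.
    by rewrite eqr_nat => /eqP.
  - by rewrite size_map size_iota.
by have := ep 0; rewrite scale0r addr0 p0 horner0.
Qed.

Lemma polyfn_eq f g : polyfn f -> polyfn g -> exists M, forall x0 L, L != 0 ->
  (forall x, on_grid x0 L M x -> f x = g x) -> forall x, f x = g x.
Proof.
move=> pf pg; have [M hM] := polyfn_degree (algB pf pg); exists M => x0 L L0 h x.
apply/eqP; rewrite -subr_eq0; apply/eqP.
by apply: (vanish_on_grid L0 hM) => y /h ->; rewrite subrr.
Qed.

Lemma grid_lattice (w : 'cV[int]_n) (L M : nat) x :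
  on_grid (lattice_point w) L%:R M x ->
  exists2 k : 'I_n -> nat, forall i, (k i < M)%N &
    x = lattice_point (\col_i (w i 0 + L%:Z * (k i)%:Z)).
Proof.
move=> hx; have /fin_all_exists2[k hk e] i : exists2 k, (k < M)%N & x i 0 = (lattice_point w) i 0 + L%:R * k%:R.
  exact: hx.
by exists k => //; apply/colP => i; rewrite e !mxE intrD intrM -!pmulrn.
Qed.

(** Take integral z and z' congruent modulo gcd(d, D).  By the Bezout identity
    some w is congruent to z modulo d and to z' modulo D, and so are all points
    of the grid w + d D k.  There the polynomial of z modulo d and that of z'
    modulo D agree with the function, hence they are equal. *)
Lemma cellwise_gcd (d D : nat) (q : fn) : (0 < d)%N -> (0 < D)%N ->
  cellwise d q -> cellwise D q -> cellwise (gcdn d D) q.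
Proof.
move=> d0 D0 hd hD x; have [g1 p1 e1] := hd x; exists g1 => // y.
case=> [[hx hy]|[z [z' [ex ey hz]]]]; first by apply: e1; left.
have [g2 p2 e2] := hD y; rewrite e2; last first.
  by right; exists z', z'; split=> // i; exists 0; rewrite mul0r addr0.
have [u [v uv]] := Bezoutz d D.
have /fin_all_exists[k hk] := hz.
pose w : 'cV[int]_n := \col_i (z i 0 + k i * u * d%:Z).
have [M hM] := polyfn_eq p1 p2.
apply/esym/(hM (lattice_point w) (d * D)%N%:R).
  by rewrite pnatr_eq0 muln_eq0 negb_or -!lt0n d0.
move=> _ /grid_lattice[l _ ->]; set w' := \col_i _.
rewrite -e1 -?e2 //; right.
- exists z', w'; split=> // i; exists (- k i * v + d%:Z * (l i)%:Z).
  by rewrite !mxE hk PoszM -[Posz (gcdn _ _)]/(gcdz d D) -uv; ring.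
- exists z, w'; split=> // i; exists (k i * u + D%:Z * (l i)%:Z).
  by rewrite !mxE PoszM; ring.
Qed.

Lemma period_divides (q : fn) D : (0 < D)%N -> cellwise D q ->
  exists2 d, is_period q d & (d %| D)%N.
Proof.
move=> D0 hD.
have ex : exists d, `[< possible_common_period q d >].
  by exists D; apply/asboolP; exact: cellwise_possible_common_period.
case: (ex_minnP ex) => d /asboolP hd dmin; exists d.
  by split=> // d' hd'; apply: dmin; apply/asboolP.
have [d0 cd] := possible_common_period_cellwise hd.
have g0 : (0 < gcdn d D)%N by rewrite gcdn_gt0 d0.
have /asboolP/dmin : possible_common_period q (gcdn d D).
  by apply: cellwise_possible_common_period => //; exact: cellwise_gcd.
move=> le; have := dvdn_gcdr d D; rewrite (_ : gcdn d D = d) //.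
by apply/eqP; rewrite eqn_leq le dvdn_leq // dvdn_gcdl.
Qed.

(** Such a set contains arbitrarily large grids in each residue class, so a
    quasipolynomial is determined by its values on it. *)
Definition thick (K : set 'cV[rat]_n) := forall rho : nat, exists c : 'cV[int]_n,
  forall y : 'cV[rat]_n, (forall i, `|y i 0 - (c i 0)%:~R| <= rho%:R) -> K y.

Lemma map_ratr_int (z : 'cV[int]_n) : map_mx ratr (map_mx intr z : 'cV[rat]_n) = lattice_point z.
Proof. by apply/colP => i; rewrite !mxE ratr_int. Qed.

Lemma quasipolynomial_eq K (f g : fn) : thick K -> quasipolynomial f -> quasipolynomial g ->
  (forall v, K v -> f (map_mx ratr v) = g (map_mx ratr v)) -> f = g.
Proof.
move=> tK /cellwise_quasipolynomial[N1 N10 h1] /cellwise_quasipolynomial[N2 N20 h2] hK.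
have [N defN] : {N | N = (N1 * N2)%N} by exists (N1 * N2)%N.
have N0 : (0 < N)%N by rewrite defN muln_gt0 N10.
have hf : cellwise N f by apply: cellwise_dvd h1; rewrite defN dvdn_mulr.
have hg : cellwise N g by apply: cellwise_dvd h2; rewrite defN dvdn_mull.
apply/funext => x; have [f' pf ef] := hf x; have [g' pg eg] := hg x.
have [M hM] := polyfn_eq pf pg.
have self : same_cell N x x.
  have [hx|[z ex]] := off_latticeP x; [by left|right].
  by exists z, z; split=> // i; exists 0; rewrite mul0r addr0.
rewrite ef // eg //.
(* Off the integral points, the grid with half-integral coordinates is used. *)
have [hx|[z ex]] := off_latticeP x.
  have [c hc] := tK M.+1.
  apply: (hM (map_mx ratr (\col_i ((c i 0)%:~R + 2^-1))) 1); first exact: oner_neq0.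
  move=> y hy; have /fin_all_exists2[k hk e] := hy.
  pose v : 'cV[rat]_n := \col_i ((c i 0)%:~R + 2^-1 + (k i)%:R).
  have ev : y = map_mx ratr v.
    by apply/colP => i; rewrite e !mxE mul1r [in RHS]rmorphD rmorph_nat.
  have oy : off_lattice y.
    have [i _|h] := pickP (fun _ : 'I_n => true); last first.
      by case: (hx 0); apply/colP => i; have := h i.
    move=> z /colP/(_ i); rewrite ev -map_ratr_int 3!mxE => /fmorph_inj.
    rewrite !mxE => E.
    have : (2 * (z i 0 - c i 0 - (k i)%:Z) - 1)%:~R = 0 :> rat.
      by rewrite !(intrD, intrM, intrN) -!pmulrn; lra.
    by move/eqP; rewrite intr_eq0; lia.
  have sy : same_cell N x y by left.
  rewrite -ef // -eg // ev; apply: hK.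
  apply: hc => i; rewrite mxE (_ : _ - _ = 2^-1 + (k i)%:R); last by ring.
  have h1' : (k i)%:R + 1 <= M.+1%:R :> rat by rewrite natr1 ler_nat ltnS ltnW.
  by have h2' := ler0n rat (k i); rewrite ger0_norm; lra.
have [c hc] := tK (N * M.+1)%N.
pose w : 'cV[int]_n := \col_i (c i 0 + ((z i ord0 - c i ord0) %% N%:Z)%Z).
have N0' : N%:Z != 0 by lia.
have zw i : z i 0 = w i 0 + ((z i ord0 - c i ord0) %/ N%:Z)%Z * N%:Z.
  by rewrite mxE; have := divz_eq (z i 0 - c i 0) N%:Z; lia.
apply: (hM (lattice_point w) N%:R); first by rewrite pnatr_eq0 -lt0n.
move=> _ /grid_lattice[k hk ->]; set w' := \col_i _.
have sw : same_cell N x (lattice_point w').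
  right; exists z, w'; split=> // i.
  exists (- ((z i ord0 - c i ord0) %/ N%:Z)%Z + (k i)%:Z).
  by rewrite [LHS]mxE; have := zw i; move: (divz _ _) => X ->; ring.
rewrite -ef // -eg // -map_ratr_int; apply: hK; apply: hc => i.
rewrite !mxE -intrN -intrD -intr_norm pmulrn ler_int.
have := modz_ge0 (z i ord0 - c i ord0) N0'; have := ltz_pmod (z i ord0 - c i ord0) (d := N) N0.
move: (modz _ _) => r; have := hk i => hki r1 r0.
have : (N * (k i).+1 <= N * M)%N by rewrite leq_mul2l hki orbT.
have : 0 <= N%:Z * (k i)%:Z by [].
rewrite mulnS mulnS -lez_nat !PoszD !PoszM.
by move: (N%:Z * (k i)%:Z) (N%:Z * M%:Z) => a b; lia.
Qed.

End Periods.

(** * Newton interpolation *)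

Section Extension.

Variables (R : realType) (n : nat).
Local Notation C := R[i].
Local Notation V := 'cV[rat]_n.
Local Notation fn := ('cV[C]_n -> C).
Local Notation polyfn := (@polyfn R n).
Local Notation lattice_point := (@lattice_point R n).
Implicit Types (f : V -> rat).

(** The binomial coefficient of k + l - 1 over l, i.e. the rising factorial
    divided by l!: the Newton basis for backward differences. *)
Fixpoint rising (F : fieldType) (l : nat) (k : F) : F :=
  if l is l'.+1 then rising l' k * (k + l'%:R) / l'.+1%:R else 1.

Lemma risingS (F : fieldType) l (k : F) :
  rising l.+1 k = rising l k * (k + l%:R) / l.+1%:R.
Proof. by []. Qed.

Lemma rising_step l (k : rat) : rising l.+1 k - rising l.+1 (k - 1) = rising l k.
Proof.
have E j : rising j.+1 (k - 1) = rising j k * (k - 1) / j.+1%:R.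
  elim: j => [|j IH]; first by rewrite /= addr0.
  rewrite [LHS]risingS IH [in RHS]risingS.
  have : (j.+2%:R : rat) != 0 by rewrite pnatr_eq0.
  have : (j.+1%:R : rat) != 0 by rewrite pnatr_eq0.
  by rewrite -!natr1 => h1 h2; field; rewrite h1 h2.
rewrite E risingS; have : (l.+1%:R : rat) != 0 by rewrite pnatr_eq0.
by rewrite -natr1 => h; field.
Qed.

Lemma rising0 l : rising l.+1 (0 : rat) = 0.
Proof.
by elim: l => [|l IH]; rewrite risingS; [rewrite addr0 mulr0 mul0r|rewrite IH !mul0r].
Qed.

(** Both sides agree at k = 0, and their differences in k agree by induction on
    m; integral k is reached from 0 in both directions. *)
Lemma newton m b f (x : V) (k : int) : killed m b f ->
  f (x + b *~ k) = \sum_(l < m) rising l (k%:~R : rat) * iter l (dif b) f x.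
Proof.
elim: m f k => [|m IH] f k hf.
  by rewrite big_ord0; move: hf; rewrite /killed /= => ->.
have hf' : killed m b (dif b f) by move: hf; rewrite /killed iterSr.
pose E (j : int) := f (x + b *~ j) - \sum_(l < m.+1) rising l (j%:~R : rat) * iter l (dif b) f x.
have E0 : E 0 = 0.
  rewrite /E mulr0z addr0 big_ord_recl big1 ?addr0 /= ?mul1r ?subrr // => l _.
  by rewrite -risingS rising0 mul0r.
have ES j : E j = E (j - 1).
  rewrite /E; set s1 := \sum_(_ < _) _; set s2 := \sum_(_ < _) _.
  have fb : f (x + b *~ (j - 1)) = f (x + b *~ j) - dif b f (x + b *~ j).
    by rewrite /dif /shift fctE opprB subrKC -addrA mulrzDr mulrNz mulr1z.
  have -> : s1 = s2 + dif b f (x + b *~ j).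
    apply/eqP; rewrite addrC -subr_eq (IH _ _ hf') /s1 /s2 !big_ord_recl /= opprD addrACA subrr add0r -sumrB.
    apply/eqP/eq_bigr => l _; rewrite -mulrBl; congr (_ * _); last by rewrite -iterSr.
    by rewrite -!risingS intrD intrN; exact: rising_step.
  by rewrite fb; ring.
have Ej (j : nat) : E j = 0.
  by elim: j => [|j IHj] //; rewrite ES -IHj; congr E; lia.
have EN (j : nat) : E (- j%:Z) = 0.
  by elim: j => [|j IHj] //; rewrite -IHj [RHS]ES; congr E; lia.
have : E k = 0 by case: k => j; [exact: Ej|rewrite NegzE EN].
by rewrite /E => /eqP; rewrite subr_eq0 => /eqP.
Qed.

Lemma polyfn_rising l i : polyfn (fun x => rising l (x i 0)).
Proof.
elim: l => [|l IH] /=; first by apply: alg_ext (RatAlgConst _ 1) _ => x; rewrite rmorph1.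
have pc : polyfn (fun x => x i 0) by apply: RatAlgGen; exists i.
apply: alg_ext (RatAlgMul (RatAlgMul IH (RatAlgAdd pc (RatAlgConst _ l%:R))) (RatAlgConst _ (l.+1%:R)^-1)) _ => x.
by rewrite fmorphV /= !ratr_nat.
Qed.

Lemma ratr_rising l (k : int) : ratr (rising l (k%:~R : rat)) = rising l (k%:~R : C).
Proof.
elim: l => [|l IH] /=; first by rewrite rmorph1.
by rewrite 2!rmorphM /= IH rmorphD /= ratr_int fmorphV /= !ratr_nat.
Qed.

(** Newton interpolation in one coordinate direction after the other; j counts
    the directions that have been treated. *)
Lemma polynomial_on_coset (D : nat) j f (y : V) :
    (forall i, unip (delta_mx i 0 *+ D) f) ->
  exists2 g, polyfn g & forall k : 'cV[int]_n,
    ratr (f (y + \sum_(i < n | (i < j)%N) (delta_mx i 0 *+ D) *~ k i 0)) = g (lattice_point k).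
Proof.
elim: j f => [|j IH] f hf.
  exists (fun=> ratr (f y)); first exact: RatAlgConst.
  by move=> k; rewrite big_pred0 ?addr0 // => i.
have [lt|ge] := ltnP j n; last first.
  have [g pg eg] := IH f hf; exists g => // k; rewrite -eg; congr (ratr (f (_ + _))).
  by apply: eq_bigl => i; rewrite !(leq_trans (ltn_ord i)) // ltnW.
pose jo := Ordinal lt; have [m hm] := hf jo.
have /choice[g hg] (l : nat) : exists g, polyfn g /\ forall k : 'cV[int]_n,
    ratr (iter l (dif (delta_mx jo 0 *+ D)) f (y + \sum_(i < n | (i < j)%N) (delta_mx i 0 *+ D) *~ k i 0)) = g (lattice_point k).
  have [|g pg eg] := IH (iter l (dif (delta_mx jo 0 *+ D)) f); last by exists g.
  by elim: l => // l IHl i; apply: unip_dif; exact: IHl.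
exists (fun x : 'cV[C]_n => \sum_(l < m) rising l (x jo 0) * g l x).
  by apply: alg_sum => l; apply: RatAlgMul; [exact: polyfn_rising|have [] := hg l].
move=> k; rewrite (bigD1 jo) //= [X in y + X]addrC addrA (newton _ _ hm) rmorph_sum /=.
apply: eq_bigr => l _; rewrite rmorphM /= ratr_rising; congr (rising _ _ * _); first by rewrite mxE.
rewrite -(hg l).2; congr (ratr (iter _ _ _ (_ + _))); apply: eq_bigl => i.
by rewrite ltnS leq_eqVlt -(inj_eq val_inj) /=; case: eqP => [->|]; rewrite ?ltnn ?andbT.
Qed.

Lemma polyfn_affine g (c : rat) (z : 'cV[int]_n) : polyfn g ->
  polyfn (fun x => g (ratr c *: (x - lattice_point z))).
Proof.
elim=> [r|h [i _ <-]|f h _ hf _ hh|f h _ hf _ hh].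
- exact: RatAlgConst.
- have pc : polyfn (fun x => x i 0) by apply: RatAlgGen; exists i.
  apply: alg_ext (RatAlgMul (RatAlgConst _ c) (RatAlgAdd pc (RatAlgConst _ (- (z i 0)%:~R)))) _ => x.
  by rewrite /coordinate !mxE rmorphN /= ratr_int.
- exact: RatAlgAdd.
- exact: RatAlgMul.
Qed.

(** Quasipolynomials are functions on complex vectors, while the difference
    calculus lives on rational ones; off the integral points the value is zero,
    like that of the partition function. *)
Definition extend f : fn := fun x =>
  match pselect (exists z, x = lattice_point z) with
  | left h => ratr (f (map_mx intr (projT1 (cid h))))
  | right _ => 0
  end.

Lemma extend_on f z : extend f (lattice_point z) = ratr (f (map_mx intr z)).
Proof.
rewrite /extend; case: pselect => [h|h]; last by case: h; exists z.
by case: cid => z' /= /lattice_point_inj <-.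
Qed.

Lemma extend_off f x : off_lattice x -> extend f x = 0.
Proof. by move=> h; rewrite /extend; case: pselect => // -[z e]; case: (h z). Qed.

Lemma cellwise_extend (D : nat) f : (0 < D)%N ->
  (forall i, unip (delta_mx i 0 *+ D) f) -> cellwise D (extend f).
Proof.
move=> D0 hf x; have [hx|[z ->]] := off_latticeP x.
  exists (fun=> 0); first exact: alg0.
  move=> y [[_ hy]|[z [z' [e _ _]]]]; first exact: extend_off.
  by case: (hx z).
have [g pg eg] := polynomial_on_coset n (map_mx intr z) hf.
exists (fun x => g (ratr D%:R^-1 *: (x - lattice_point z))); first exact: polyfn_affine.
move=> y [[h _]|[z1 [z' [e -> h]]]]; first by case: (h z).
rewrite -(lattice_point_inj e) in h; have /fin_all_exists[k hk] := h.
have D1 : (D%:R : C) != 0 by rewrite pnatr_eq0 -lt0n.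
rewrite extend_on (_ : ratr _ *: _ = lattice_point (\col_i k i)); last first.
  apply/colP => i; rewrite !mxE hk intrD intrM [X in X - _]addrC addrK fmorphV /= ratr_nat -pmulrn.
  by field.
rewrite -eg; congr (ratr (f _)); apply/colP => i; rewrite !mxE summxE hk.
under eq_bigr => j _ do rewrite -scaler_int -scaler_nat !mxE eqxx andbT.
rewrite (bigD1 i) //= eqxx big1 ?addr0 => [|j /andP[_ ji]].
  by rewrite intrD intrM -pmulrn mulr1.
by rewrite eq_sym (negPf ji) !mulr0.
Qed.

Lemma cellwise_quasi (N : nat) (q : fn) : (0 < N)%N -> cellwise N q -> quasipolynomial q.
Proof.
move=> N0 /(cellwise_possible_common_period N0)[k [t [hq _]]].
by apply: alg_sub hq => f [|[i _ <-]]; [left|right; exists (t i)].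
Qed.

Lemma extend_eq (D : nat) f f' (K : set V) : (0 < D)%N -> thick K ->
    (forall i, unip (delta_mx i 0 *+ D) f) -> (forall i, unip (delta_mx i 0 *+ D) f') ->
  (forall v, integral v -> K v -> f v = f' v) -> forall v, integral v -> f v = f' v.
Proof.
move=> D0 tK uf uf' h v iv.
have E : extend f = extend f'.
  apply: (quasipolynomial_eq tK); try by apply: (cellwise_quasi D0); exact: cellwise_extend.
  move=> w Kw; have [hw|[z ez]] := off_latticeP (map_mx ratr w : 'cV[C]_n); first by rewrite !extend_off.
  have ew : w = map_mx intr z.
    apply/colP => i; have /colP/(_ i) := ez; rewrite !mxE -(ratr_int _ (z i 0)).
    exact: fmorph_inj.
  rewrite ez !extend_on h // -ew // => i; rewrite ew mxE; exact: intr_int.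
have [k ev] := integral_int iv.
have := congr1 (fun q => q (lattice_point k)) E.
by rewrite /= !extend_on -ev; exact: fmorph_inj.
Qed.

End Extension.

(** * Generic shifts *)

Section Eventually.

(** For all small enough positive r; a filter that supports simultaneous choices
    of perturbation parameters without explicit bounds. *)
Definition small (P : rat -> Prop) :=
  exists2 r0 : rat, 0 < r0 & forall r, 0 < r -> r <= r0 -> P r.

Lemma small_and P Q : small P -> small Q -> small (fun r => P r /\ Q r).
Proof.
move=> [r1 h1 k1] [r2 h2 k2]; exists (Num.min r1 r2); first by rewrite lt_min h1.
by move=> r r0; rewrite le_min => /andP[l1 l2]; split; [exact: k1|exact: k2].
Qed.

Lemma small_all (T : eqType) (s : seq T) (P : T -> rat -> Prop) :
  (forall x, x \in s -> small (P x)) -> small (fun r => forall x, x \in s -> P x r).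
Proof.
elim: s => [|x s IH] h; first by exists 1.
have h1 := h x (mem_head _ _).
have [|r0 r00 h2] := small_and h1 (IH _); first by move=> y ys; apply: h; rewrite inE ys orbT.
exists r0 => // r rp rl y; have [hx hs] := h2 r rp rl.
by rewrite inE => /orP[/eqP ->|] //; exact: hs.
Qed.

Lemma small_fin (T : finType) (P : T -> rat -> Prop) :
  (forall x, small (P x)) -> small (fun r => forall x, P x r).
Proof.
move=> h; have [|r0 r00 h0] := @small_all T (enum T) P; first by move=> x _.
by exists r0 => // r rp rl x; apply: h0 => //; rewrite mem_enum.
Qed.

Lemma small_ex P : small P -> exists2 r, 0 < r & P r.
Proof. by move=> [r0 h k]; exists r0 => //; exact: k. Qed.

Lemma small_gt0 (x y : rat) : 0 < x -> small (fun r => 0 < x + r * y).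
Proof.
move=> x0; have y1 : 0 < `|y| + 1 by rewrite ltr_wpDl.
exists (x / (`|y| + 1)); first by rewrite divr_gt0.
move=> r rp; rewrite ler_pdivlMr // => h.
have : - (r * y) <= r * `|y| by rewrite -mulrN ler_pM2l // -normrN ler_norm.
by lra.
Qed.

Lemma small_lt0 (x y : rat) : x < 0 -> small (fun r => x + r * y < 0).
Proof.
move=> x0; have [|r0 rp h] := @small_gt0 (- x) (- y); first by rewrite oppr_gt0.
by exists r0 => // r r1 r2; have := h r r1 r2; rewrite mulrN -opprD oppr_gt0.
Qed.

Lemma small_neq0 (x y : rat) : x != 0 \/ y != 0 -> small (fun r => x + r * y != 0).
Proof.
have [->|xn] := eqVneq x 0.
  by case=> // yn; exists 1 => // r rp _; rewrite add0r mulf_neq0 // lt0r_neq0.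
move=> _; have [x0|x0|x0] := ltgtP x 0; last by rewrite x0 eqxx in xn.
- by have [r0 rp h] := small_lt0 y x0; exists r0 => // r r1 r2; rewrite ltr0_neq0 // h.
- by have [r0 rp h] := small_gt0 y x0; exists r0 => // r r1 r2; rewrite lt0r_neq0 // h.
Qed.

Lemma small_lt (x y : rat) : 0 < x -> small (fun r => r * y < x).
Proof.
move=> x0; have [r0 rp h] := small_gt0 (- y) x0.
by exists r0 => // r r1 r2; have := h r r1 r2; rewrite mulrN subr_gt0.
Qed.

End Eventually.

Section CrdBounds.

Variable n : nat.
Local Notation V := 'cV[rat]_n.

Definition crd_norm (M : 'M[rat]_n) i : rat := \sum_k `|invmx M i k|.

Lemma crd_le_norm M (x : V) i (e : rat) : (forall k, `|x k 0| <= e) ->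
  `|crd M x i| <= crd_norm M i * e.
Proof.
move=> h; rewrite /crd mxE mulr_suml (le_trans (ler_norm_sum _ _ _)) // ler_sum // => k _.
by rewrite normrM; apply: ler_wpM2l; [exact: normr_ge0|exact: h].
Qed.

Lemma crd1 (x : V) i : crd 1%:M x i = x i 0.
Proof. by rewrite /crd invmx1 mul1mx. Qed.

Lemma crd_denominator (M : 'M[rat]_n) i : exists2 m : nat, (0 < m)%N &
  forall x : V, integral x -> crd M x i *+ m \is a Num.int.
Proof.
have [m m0 hm] := common_denominator (fun k => invmx M i k).
exists m => // x ix; rewrite /crd mxE -sumrMnl; apply: rpred_sum => k _.
by rewrite -mulrnAl rpredM.
Qed.

End CrdBounds.

Section Perturbation.

Variables (n : nat) (A : seq 'cV[rat]_n).
Local Notation V := 'cV[rat]_n.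
Hypothesis A_int : forall a, a \in A -> integral a.
Hypothesis A_ge0 : forall a, a \in A -> forall i, 0 <= a i 0.
Hypothesis A_neq0 : forall a, a \in A -> a != 0.
Hypothesis A_simple : forall i, delta_mx i 0 \in A.

(** Each condition excludes a hyperplane; they are met one after the other by
    small perturbations along a column dual to the new condition. *)
Lemma generic_direction : exists d : V, forall M, M \in bases A -> forall i, crd M d i != 0.
Proof.
suff H (s : seq ('M[rat]_n * 'I_n)) : {subset s <= [pred p | p.1 \in unitmx]} ->
    exists d : V, forall p, p \in s -> crd p.1 d p.2 != 0.
  have [|d hd] := H [seq (M, i) | M <- bases A, i <- enum 'I_n].
    by move=> p /allpairsP[[M i] [/basesP[uM _] _ ->]].
  by exists d => M hM i; apply: (hd (M, i)); apply/allpairsP; exists (M, i); rewrite hM mem_enum.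
elim: s => [|[M i] s IH] sub; first by exists 0.
have [|d hd] := IH; first by move=> p ps; apply: sub; rewrite inE ps orbT.
have uM : M \in unitmx by apply: (sub (M, i)); rewrite mem_head.
have [|r _ [h1 h2]] := @small_ex (fun r => crd M d i + r * 1 != 0 /\
    forall p, p \in s -> crd p.1 d p.2 + r * crd p.1 (col i M) p.2 != 0).
  apply: small_and; first by apply: small_neq0; right; exact: oner_neq0.
  by apply: small_all => p ps; apply: small_neq0; left; exact: hd.
exists (d + r *: col i M) => p; rewrite inE => /orP[/eqP ->|ps].
  by rewrite /= crdD crdZ crd_col // eqxx.
by rewrite crdD crdZ h2.
Qed.

(** The coordinates of integral vectors have bounded denominators, so they cannot
    cancel a small nonzero perturbation. *)
Lemma generic_of_small (s : V) : (forall M, M \in bases A -> forall i, crd M s i != 0) ->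
  small (fun r => generic A (r *: s)).
Proof.
move=> hs; suff : small (fun r => forall M, M \in bases A -> forall i,
    forall x, integral x -> crd M (x + r *: s) i != 0) by [].
apply: small_all => M hM; apply: small_fin => i.
have [m m0 hm] := crd_denominator M i.
have [r0 rp h] := @small_lt 1 (`|crd M s i| *+ m) ltr01.
exists r0 => // r r1 r2 x ix; rewrite crdD crdZ; apply/eqP => /eqP; rewrite addr_eq0 => /eqP E.
have /intrP[z Ez] := hm x ix.
have small1 : `|z%:~R| < 1 :> rat.
  by rewrite -Ez E mulNrn normrN normrMn normrM (gtr0_norm r1) -mulrnAr h.
have z0 : z = 0 by move: small1; rewrite -intr_norm -[1]/(1%:~R) ltr_int; lia.
move: Ez; rewrite z0 => /eqP; rewrite mulrn_eq0 -leqn0 leqNgt m0 /= E oppr_eq0 mulf_eq0.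
by rewrite (negPf (hs M hM i)) orbF gt_eqF.
Qed.

(** Each summation along a ray adds a multiple of the root to the shift. *)
Fixpoint shift_of (e : rat) (s0 : V) (l : seq V) : V :=
  if l is a :: l' then shift_of e s0 l' + e *: a else s0.

(** At the start, s0 has coordinates strictly between 0 and 1, so x + s0 lies in
    the open cone of the simple roots exactly for natural x. *)
Lemma decomposed_pcount e (s0 : V) (l : seq V) : {subset l <= A} -> 0 < e < 1 ->
    (forall i, 0 < s0 i 0 < 1) ->
    (forall k, generic A (shift_of e s0 (drop k l))) ->
  decomposed A (shift_of e s0 l) (fun x => (pcount l x)%:R).
Proof.
move=> sub he h0; elim: l sub => [|a l IH] sub hg /=.
  have M1 : 1%:M \in bases A.
    apply/basesP; split=> [|j]; first exact: unitmx1.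
    rewrite (_ : col j _ = delta_mx j 0) //.
    by apply/colP => i; rewrite !mxE eqxx andbT.
  exists (fun M => if M == 1%:M then (fun=> 1) else 0) => [M _|x ix].
    case: eqP => _ j; last exact: unip0.
    by exists 1%N; apply/funext => y; rewrite /= /dif /shift fctE subrr.
  rewrite (bigD1_seq 1%:M) ?undup_uniq //= eqxx big1 ?addr0 => [|M /negPf ->]; last by rewrite mulr0.
  rewrite mulr1; congr ((nat_of_bool _)%:R); apply/forallP/forallP => h j.
    rewrite crd1 mxE; have /natrP[k ->] := h j; have /andP[s1 _] := h0 j.
    by rewrite ltr_wpDl ?ler0n.
  have := h j; rewrite crd1 mxE => hj; have /andP[_ s1] := h0 j.
  rewrite natrEint ix /=; have /intrP[z ez] := ix j; rewrite ez in hj *.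
  have : (-1)%:~R < z%:~R :> rat by rewrite intrN; lra.
  by rewrite ltr_int ler0z; lia.
have al : a \in A by apply: sub; rewrite mem_head.
have subl : {subset l <= A} by move=> b bl; apply: sub; rewrite inE bl orbT.
have gl k : generic A (shift_of e s0 (drop k l)) by exact: (hg k.+1).
have [|F' [q uq hq] hF'] := ray_sum A_int A_ge0 A_neq0 (IH subl gl) al he _ (hg 0).
  by have := gl 0; rewrite drop0.
exists q => // x ix; rewrite -hq //; have [K0 hK] := hF' x ix.
rewrite -(hK _ (leq_maxl K0 (height_bound x))) -natr_sum; congr (_%:R).
have height1 b : b \in A -> 1 <= height b.
  move=> bA; have [i bi] : exists i, b i 0 != 0.
    have := A_neq0 bA; apply: contraPP => h; apply/negP; rewrite negbK; apply/eqP/colP => i.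
    by rewrite mxE; apply/eqP; apply: contra_notT h => ?; exists i.
  rewrite /height (bigD1 i) //= -[X in X <= _]addr0 lerD ?sumr_ge0 // => [|j _]; last exact: A_ge0.
  have b0 := A_ge0 bA i; have /intrP[z ez] := A_int bA i; rewrite ez in bi b0 *.
  by move: bi b0; rewrite intr_eq0 ler0z ler1z; lia.
apply/esym/(@pcount_cons _ a l x); last exact: leq_maxr.
by move=> b; rewrite inE => /orP[/eqP ->|/subl]; exact: height1.
Qed.

(** The final shift is forced to be s0 + e (sum of l), so s0 is chosen such that
    this is a small positive multiple of a point near v.  Then s has the same
    signs as v with respect to all bases, where those of v are not zero, and a
    small multiple of a generic direction makes all intermediate shifts generic. *)
Lemma decomposed_near (v : V) (l : seq V) : {subset l <= A} -> (forall i, 0 < v i 0) ->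
  exists s, [/\ decomposed A s (fun x => (pcount l x)%:R),
    forall M, M \in bases A -> forall i, 0 < crd M v i -> 0 < crd M s i &
    forall M, M \in bases A -> forall i, crd M v i < 0 -> crd M s i < 0].
Proof.
move=> sub v0; have [d hd] := generic_direction.
pose sigma (l' : seq V) := \sum_(a <- l') a.
have [eta eta0 heta] : exists2 eta : rat, 0 < eta & forall i, 0 < v i 0 - eta * sigma l i 0.
  have [|eta eta0 h] := @small_ex (fun r => forall i, 0 < v i 0 + r * - sigma l i 0).
    by apply: small_fin => i; exact: small_gt0.
  by exists eta => // i; have := h i; rewrite mulrN.
pose w l' := v - eta *: sigma l + eta *: sigma l'.
have [|tau tau0 [ht1 [ht2 [ht3 ht4]]]] := @small_ex (fun r =>
   (forall k, k \in iota 0 (size l).+1 -> forall M, M \in bases A -> forall i,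
      crd M (w (drop k l)) i + r * crd M d i != 0) /\
   ((forall i, 0 < (v i 0 - eta * sigma l i 0) + r * d i 0) /\
   ((forall M, M \in bases A -> forall i, 0 < crd M v i -> 0 < crd M v i + r * crd M d i) /\
   (forall M, M \in bases A -> forall i, crd M v i < 0 -> crd M v i + r * crd M d i < 0)))).
  apply: small_and.
    apply: small_all => k _; apply: small_all => M hM; apply: small_fin => i.
    by apply: small_neq0; right; exact: hd.
  apply: small_and; first by apply: small_fin => i; exact: small_gt0.
  apply: small_and; apply: small_all => M hM; apply: small_fin => i.
    have [h|h] := ltP 0 (crd M v i); last by exists 1 => // r _ _; rewrite ltNge h.
    by have [r0 rp hr] := small_gt0 (crd M d i) h; exists r0 => // r r1 r2 _; exact: hr.
  have [h|h] := ltP (crd M v i) 0; last by exists 1 => // r _ _; rewrite ltNge h.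
  by have [r0 rp hr] := small_lt0 (crd M d i) h; exists r0 => // r r1 r2 _; exact: hr.
have [|delta delta0 [hd1 [hd2 hd3]]] := @small_ex (fun r => r * eta < 1 /\
   ((forall i, r * (v i 0 - eta * sigma l i 0 + tau * d i 0) < 1) /\
    forall k, k \in iota 0 (size l).+1 -> generic A (r *: (w (drop k l) + tau *: d)))).
  apply: small_and; first exact: small_lt.
  apply: small_and; first by apply: small_fin => i; exact: small_lt.
  apply: small_all => k hk; apply: generic_of_small => M hM i.
  by rewrite crdD crdZ; exact: ht1.
(* eta keeps s0 positive, tau moves the intermediate shifts off the coordinate
   hyperplanes, and delta makes them small. *)
pose s0 := delta *: (v - eta *: sigma l + tau *: d).
have sE l' : shift_of (delta * eta) s0 l' = delta *: (w l' + tau *: d).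
  elim: l' => [|a l' IH] /=; first by rewrite /w /sigma big_nil scaler0 addr0.
  rewrite IH /w /sigma big_cons -scalerA -scalerDr; congr (_ *: _).
  by rewrite [eta *: (a + _)]scalerDr addrAC [eta *: a + _]addrC !addrA.
exists (shift_of (delta * eta) s0 l); split.
- apply: decomposed_pcount => //.
  + by rewrite mulr_gt0.
  + by move=> i; rewrite !mxE mulr_gt0 //=.
  + move=> k; rewrite sE; have [hk|hk] := leqP k (size l).
      by apply: hd3; rewrite mem_iota.
    have := hd3 (size l); rewrite mem_iota drop_size (drop_oversize (ltnW hk)).
    by apply; rewrite add0n leqnn.
- move=> M hM i vi; rewrite sE crdZ pmulr_rgt0 // /w subrK crdD crdZ; exact: ht3.
- move=> M hM i vi; rewrite sE crdZ pmulr_rlt0 // /w subrK crdD crdZ; exact: ht4.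
Qed.

End Perturbation.

(** * Chambers and the period of the Kostant partition function *)

Section Chambers.

Variables (n : nat) (Phi : root_system n).
Hypothesis base : standard_base Phi.
Local Notation V := 'cV[rat]_n.
Local Notation A := (enum_fset (positive_roots Phi)).

Lemma positive_rootE a : (a \in positive_roots Phi) =
  (a \in roots Phi) && [forall i, 0 <= a i 0].
Proof. by rewrite !inE. Qed.

Lemma positive_root_nat a i : a \in A -> a i 0 \is a Num.nat.
Proof.
rewrite positive_rootE => /andP[ra /forallP a0].
have [->//|h] := base.2 _ ra; have := a0 i; have /natrP[k e] := h i.
rewrite -[a i 0]opprK e oppr_ge0 => k0.
have -> : k%:R = 0 :> rat by apply/eqP; rewrite eq_le k0 ler0n.
by rewrite oppr0.
Qed.

Lemma positive_root_int a : a \in A -> integral a.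
Proof. by move=> aA i; rewrite intrEge0 ?positive_root_nat // natr_ge0 ?positive_root_nat. Qed.

Lemma positive_root_ge0 a : a \in A -> forall i, 0 <= a i 0.
Proof. by rewrite positive_rootE => /andP[_ /forallP]. Qed.

Lemma root_neq0 a : a \in roots Phi -> a != 0.
Proof. by apply: contraTneq => ->; exact: roots_neq0. Qed.

Lemma positive_root_neq0 a : a \in A -> a != 0.
Proof. by rewrite positive_rootE => /andP[/root_neq0]. Qed.

Lemma simple_positive i : simple_root i \in A.
Proof.
rewrite positive_rootE base.1 /=; apply/forallP => j; rewrite mxE.
by case: (_ && _).
Qed.

Lemma cone_of_crd (S : {fset V}) M (y : V) : M \in unitmx ->
  (forall j, 0 <= crd M y j) -> (forall j, col j M \in S \/ crd M y j = 0) -> cone S y.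
Proof.
move=> uM h0 hS; exists (fun a => \sum_(j | col j M == a) crd M y j).
split=> [a|]; first exact: sumr_ge0.
rewrite [LHS](crd_sum uM).
transitivity (\sum_(a <- S) \sum_j if col j M == a then crd M y j *: col j M else 0).
  rewrite exchange_big /=; apply: eq_bigr => j _.
  have [jS|->] := hS j; last by rewrite scale0r big1 // => a _; case: eqP.
  rewrite (bigD1_seq (col j M)) ?fset_uniq //= eqxx big1 ?addr0 // => a.
  by rewrite eq_sym => /negPf ->.
apply: eq_bigr => a _; rewrite scaler_suml [RHS]big_mkcond /=.
by apply: eq_bigr => j _; case: eqP => [->|].
Qed.

Lemma free_cols (M : 'M[rat]_n) : M \in unitmx -> free [seq col j M | j <- enum 'I_n].
Proof.
move=> uM; have sz : size [seq col j M | j <- enum 'I_n] == n by rewrite size_map size_enum_ord.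
apply/(freeP (X := Tuple sz)) => k hk i.
have : M *m (\col_j k j) = 0.
  rewrite -hk; apply/colP => r; rewrite mxE summxE; apply: eq_bigr => j _.
  by rewrite !mxE (nth_map i) ?size_enum_ord // nth_ord_enum !mxE mulrC.
by move=> /(canRL (mulKmx uM)); rewrite mulmx0 => /colP/(_ i); rewrite !mxE.
Qed.

Lemma col_inj (M : 'M[rat]_n) : M \in unitmx -> injective (fun j => col j M).
Proof.
move=> uM i j e; have := crd_col uM i j; rewrite -e crd_col // eqxx.
by case: eqP => // _ /eqP; rewrite oner_eq0.
Qed.

(** A facet of the cone of a basis is the cone of a wall. *)
Lemma wall_of_basis M j0 : M \in bases A -> exists2 S, wall Phi S &
  forall y, (forall j, 0 <= crd M y j) -> crd M y j0 = 0 -> cone S y.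
Proof.
move=> /basesP[uM cM].
pose X := [seq col j M | j <- enum 'I_n].
have uX : uniq X by rewrite map_inj_uniq ?enum_uniq //; exact: col_inj.
pose Y := [seq a <- X | predC1 (col j0 M) a].
pose S : {fset V} := [fset a in Y]%fset.
have SY : perm_eq S Y by apply: uniq_perm; rewrite ?fset_uniq ?filter_uniq // => a; rewrite inE.
have memY j : j != j0 -> col j M \in Y.
  move=> jj; rewrite mem_filter /= (inj_eq (col_inj uM)) jj /=.
  by apply/mapP; exists j; rewrite ?mem_enum.
exists S; last first.
  move=> y y0 yj; apply: (cone_of_crd uM) => // j.
  by have [->|jj] := eqVneq j j0; [right|left; rewrite inE /= memY].
split.
- apply/fsubsetP => a; rewrite inE /= mem_filter => /andP[_ /mapP[j _ ->]]; exact: cM.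
- have mX : col j0 M \in X by apply/mapP; exists j0; rewrite ?mem_enum.
  have := count_predC (pred1 (col j0 M)) X.
  rewrite (count_uniq_mem _ uX) mX size_map size_enum_ord => cn.
  by rewrite (perm_size SY) size_filter -[RHS](congr1 predn cn).
- by rewrite (perm_free SY) filter_free // free_cols.
Qed.

(** A wall is completed to a basis by a simple root outside its span, so its cone
    is a facet of the cone of that basis. *)
Lemma basis_of_wall S : (0 < n)%N -> wall Phi S -> exists M j0,
  [/\ M \in bases A, forall j, j != j0 -> col j M \in S &
     forall y, cone S y -> (forall j, 0 <= crd M y j) /\ crd M y j0 = 0].
Proof.
move=> n0 [sS cS fS].
have [k ek] : exists k, simple_root k \notin <<S>>%VS.
  apply/existsP; rewrite -[X in is_true X]negbK negb_exists; apply/forallP => h.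
  have : (fullv <= <<S>>)%VS.
    apply/subvP => v _; rewrite (col_sum v).
    by apply: memv_suml => i _; apply: memvZ; have := h i; rewrite negbK.
  move/dimvS; rewrite dimvf /dim /= muln1 => le.
  have := leq_trans le (dim_span S); rewrite cS.
  by rewrite leqNgt prednK // leqnn.
pose X := simple_root k :: S.
have sX : size X = n by rewrite /= cS prednK.
have fX : free X by rewrite free_cons ek.
pose M : 'M[rat]_n := \matrix_(i, j) (X`_j) i 0.
have colM j : col j M = X`_j by apply/colP => i; rewrite !mxE.
have uM : M \in unitmx.
  rewrite -unitmx_tr -row_free_unit -kermx_eq0; apply/rowV0P => w /sub_kermxP hw.
  have sz : size X == n by rewrite sX.
  have h := freeP (X := Tuple sz) fX (w 0).
  apply/rowP => i; rewrite mxE; apply: h.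
  apply/colP => r; have h2 : (w *m M^T) 0 r = 0 by rewrite hw mxE.
  rewrite [RHS]mxE -h2 [RHS]mxE summxE.
  by apply: eq_bigr => j _; rewrite !mxE.
pose j0 : 'I_n := Ordinal n0.
have Sj j : j != j0 -> col j M \in S.
  rewrite colM; case: j => -[|j] lt //= _; apply: mem_nth.
  by rewrite cS; lia.
have MB : M \in bases A.
  apply/basesP; split=> // j; have [->|/Sj] := eqVneq j j0.
    by rewrite colM /= simple_positive.
  by move/fsubsetP: sS => /[apply].
exists M, j0; split=> // y [c [c0 ->]].
have cr a : a \in S -> exists2 j, j != j0 & a = col j M.
  move=> aS; have lt : ((index a S).+1 < n)%N.
    by move: aS; rewrite -index_mem; move: sX => /=; lia.
  by exists (Ordinal lt) => //; rewrite colM /= nth_index.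
have E i : crd M (\sum_(a <- S) c a *: a) i = \sum_(a <- S) c a * crd M a i.
  rewrite /crd mulmx_sumr summxE; apply: eq_bigr => a _.
  by rewrite -scalemxAr mxE.
split=> [i|]; rewrite E.
  rewrite big_seq sumr_ge0 // => a /cr[j _ ->]; by rewrite mulr_ge0 // crd_col // ler0n.
rewrite big_seq big1 // => a /cr[j jj ->].
by rewrite crd_col // eq_sym (negPf jj) mulr0.
Qed.

Lemma regular_crd u M : regular Phi u -> M \in bases A ->
  (exists i, crd M u i < 0) \/ in_cone M u.
Proof.
move=> [_ hu] hM; have [/existsP[i hi]|h] := boolP [exists i, crd M u i < 0]; first by left; exists i.
right; apply/forallP => j.
have u0 i : 0 <= crd M u i.
  by rewrite leNgt; apply: contraNN h => hi; apply/existsP; exists i.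
rewrite lt_neqAle u0 andbT; apply/eqP => e0.
have [S wS hS] := wall_of_basis j hM.
by apply: (hu S wS); apply: hS.
Qed.

Lemma regular_ge0 u : regular Phi u -> forall i, 0 <= u i 0.
Proof.
move=> [[c [c0 ->]] _] i; rewrite summxE big_seq sumr_ge0 // => a aA.
by rewrite mxE mulr_ge0 // positive_root_ge0.
Qed.

Lemma one_basis : 1%:M \in bases A.
Proof.
apply/basesP; split=> [|j]; first exact: unitmx1.
rewrite (_ : col j _ = simple_root j) ?simple_positive //.
by apply/colP => i; rewrite !mxE eqxx andbT.
Qed.

Lemma regular_gt0 u : regular Phi u -> forall i, 0 < u i 0.
Proof.
move=> hu i; have [[j]|/forallP/(_ i)] := regular_crd hu one_basis; rewrite crd1 //.
by rewrite ltNge regular_ge0.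
Qed.

(** Otherwise, at the first time that the segment leaves the open cone of M, it
    meets a facet, which is a wall. *)
Lemma segment_in_cone M x y : M \in bases A -> segment x y `<=` regular Phi ->
  in_cone M x -> in_cone M y.
Proof.
move=> hM hs /forallP x0; have [[i0 yi0]|//] : (exists i, crd M y i < 0) \/ in_cone M y.
  apply: regular_crd => //; apply: hs; exists 1; first by rewrite /= ?ler01 ?lexx.
  by rewrite subrr scale0r add0r scale1r.
pose t i := crd M x i / (crd M x i - crd M y i).
have dpos i : crd M y i < 0 -> 0 < crd M x i - crd M y i by have := x0 i; lra.
case: (arg_minP (P := fun i => crd M y i < 0) t yi0) => i yi imin.
have t0 : 0 < t i by rewrite divr_gt0 // dpos.
have t1 : t i <= 1 by rewrite ler_pdivrMr ?dpos // mul1r; lra.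
have crz j : crd M ((1 - t i) *: x + t i *: y) j = crd M x j - t i * (crd M x j - crd M y j).
  by rewrite crdD !crdZ; ring.
have rz : regular Phi ((1 - t i) *: x + t i *: y).
  by apply: hs; exists (t i) => //=; rewrite t1 ltW.
have [[j]|/forallP/(_ i)] := regular_crd rz hM; rewrite crz; last first.
  by rewrite /t divfK ?subrr ?ltxx // lt0r_neq0 // dpos.
rewrite ltNge => /negP[]; rewrite subr_ge0.
have [yj|yj] := ltP (crd M y j) 0; first by rewrite -ler_pdivlMr ?dpos //; exact: imin.
have [d0|d0] := leP (crd M x j - crd M y j) 0.
  by rewrite (le_trans (mulr_ge0_le0 (ltW t0) d0)) // ltW.
rewrite (le_trans (ler_piMl (ltW d0) t1)) //; lra.
Qed.

Lemma segment_sym (x y : V) : segment x y = segment y x.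
Proof.
have H (x' y' : V) : segment x' y' `<=` segment y' x'.
  move=> _ [t /= /andP[t0 t1] <-]; exists (1 - t); first by rewrite /= subr_ge0 t1 gerBl.
  by rewrite opprB subrKC addrC.
by apply/seteqP; split; exact: H.
Qed.

Lemma regular_componentP u v : regular Phi u -> regular_component Phi u v ->
  regular Phi v /\ forall M, M \in bases A -> in_cone M v = in_cone M u.
Proof.
move=> + h; elim: h => {u v} [x y hs|x|x y z _ IH1 _ IH2] rx; last first.
- have [ry hy] := IH1 rx; have [rz hz] := IH2 ry; split=> // M hM.
  by rewrite hz // hy.
- by split.
have ry : regular Phi y.
  apply: hs; exists 1; first by rewrite /= ?ler01 ?lexx.
  by rewrite subrr scale0r add0r scale1r.
split=> // M hM; apply/idP/idP; last exact: segment_in_cone.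
by apply: segment_in_cone => //; rewrite segment_sym.
Qed.

(** The points that lie strictly on the same side as u of the coordinate
    hyperplanes of all bases, except for those that contain u.  Regularity
    allows u to lie on such hyperplanes, provided that it is outside the facets,
    so this set may be smaller than the chamber; but it is a convex cone around
    u, which suffices for uniqueness. *)
Definition same_signs (u y : V) := forall M, M \in bases A -> forall i,
  (0 < crd M u i -> 0 < crd M y i) /\ (crd M u i < 0 -> crd M y i < 0).

Lemma same_signs_cone u y M : regular Phi u -> same_signs u y -> M \in bases A ->
  in_cone M y = in_cone M u.
Proof.
move=> ru hy hM; have [[i ui]|uc] := regular_crd ru hM.
  have yi := (hy M hM i).2 ui.
  by apply/idP/idP => /forallP/(_ i); rewrite ltNge ltW.
rewrite uc; apply/forallP => i; move/forallP: uc => /(_ i); exact: (hy M hM i).1.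
Qed.

Lemma same_signs_regular u y : (0 < n)%N -> regular Phi u -> same_signs u y ->
  regular Phi y.
Proof.
move=> n0 ru hy; split.
  apply: (@cone_of_crd _ 1%:M) => [|j|j]; first exact: unitmx1.
    by rewrite ltW // (hy _ one_basis j).1 // crd1 regular_gt0.
  by left; rewrite (_ : col j _ = simple_root j) ?simple_positive //;
    apply/colP => i; rewrite !mxE eqxx andbT.
move=> S wS cy; have [M [j0 [hM hS hc]]] := basis_of_wall n0 wS.
have [y0 yj] := hc y cy; have [[i ui]|uc] := regular_crd ru hM.
  by have := (hy M hM i).2 ui; rewrite ltNge y0.
by move/forallP: uc => /(_ j0) /((hy M hM j0).1); rewrite yj ltxx.
Qed.

Lemma same_signs_component u y : (0 < n)%N -> regular Phi u -> same_signs u y ->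
  regular_component Phi u y.
Proof.
move=> n0 ru hy; apply: rt_step => _ [t /= /andP[t0 t1] <-].
apply: (same_signs_regular n0 ru) => M hM i; rewrite crdD !crdZ.
have [h1 h2] := hy M hM i.
have [t0'|t0'] := eqVneq t 0; first by rewrite t0' subr0 mul1r mul0r addr0.
have tp : 0 < t by rewrite lt_neqAle eq_sym t0'.
split=> h.
- apply: ltr_wpDl; last by rewrite mulr_gt0 // h1.
  by apply: mulr_ge0; rewrite ?subr_ge0 // ltW.
- rewrite -oppr_gt0 opprD; apply: ltr_wpDl; last by rewrite -mulrN mulr_gt0 // oppr_gt0 h2.
  by rewrite -mulrN; apply: mulr_ge0; rewrite ?subr_ge0 ?oppr_ge0 // ltW.
Qed.

(** The set is invariant under positive scalars and contains a neighbourhood of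
    u, so a large integral multiple of u is the centre of a large ball in it. *)
Lemma thick_same_signs u : thick (same_signs u).
Proof.
move=> rho; have [m m0 hm] := common_denominator (fun i => u i 0).
have [|r0 r00 hr] := @small_all _ (bases A) (fun M r => forall i,
    crd M u i != 0 -> r * (crd_norm M i * rho%:R) < `|crd M u i|).
  move=> M hM; apply: small_fin => i; have [->|un] := eqVneq (crd M u i) 0.
    by exists 1 => // r _ _; rewrite eqxx.
  have [|r1 r10 h] := @small_lt `|crd M u i| (crd_norm M i * rho%:R); first by rewrite normr_gt0.
  by exists r1 => // r ra rb _; exact: h.
pose t := (absz (Num.floor (r0^-1))).+1.
have tp : (0 : rat) < (t * m)%N%:R by rewrite ltr0n muln_gt0 m0.
have tr : ((t * m)%N%:R)^-1 <= r0.
  rewrite -[X in _ <= X]invrK lef_pV2 ?posrE ?invr_gt0 //.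
  apply: le_trans (_ : t%:R <= _); last by rewrite ler_nat leq_pmulr.
  apply: ltW; apply: lt_le_trans (floorD1_gt _) _.
  by rewrite /t pmulrn ler_int; move: (Num.floor _) => f; lia.
have /fin_all_exists[c hc] : forall i, exists z : int, (t * m)%N%:R * u i 0 = z%:~R.
  move=> i; apply/intrP; rewrite mulnC natrM mulrAC rpredM ?natr_int //.
  by rewrite mulr_natl.
exists (\col_i c i) => y hy M hM i.
pose e := y - (t * m)%N%:R *: u.
have he k : `|e k 0| <= rho%:R by have := hy k; rewrite !mxE hc.
have ey : crd M y i = (t * m)%N%:R * (crd M u i + ((t * m)%N%:R)^-1 * crd M e i).
  rewrite mulrDr mulrA divff ?lt0r_neq0 // mul1r /e crdD crdN crdZ; ring.
rewrite ey pmulr_rgt0 // pmulr_rlt0 //.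
have key : crd M u i != 0 -> `|((t * m)%N%:R)^-1 * crd M e i| < `|crd M u i|.
  move=> un; apply: le_lt_trans (hr _ _ tr M hM i un); last by rewrite invr_gt0.
  rewrite normrM gtr0_norm ?invr_gt0 // ler_pM2l ?invr_gt0 //.
  exact: crd_le_norm.
split=> h.
- have := key (lt0r_neq0 h); rewrite (gtr0_norm h) ltr_norml => /andP[]; lra.
- have := key (ltr0_neq0 h); rewrite (ltr0_norm h) ltr_norml => /andP[]; lra.
Qed.

Lemma thick_shift K (s s' : V) : thick K -> thick [set x | K (x + s) /\ K (x + s')].
Proof.
move=> tK rho.
have [N hN] : exists N : nat, forall i, `|s i 0| <= N%:R /\ `|s' i 0| <= N%:R.
  pose g i := (absz (Num.floor (`|s i 0| + `|s' i 0|))).+1.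
  exists (\sum_i g i)%N => i.
  have : `|s i 0| + `|s' i 0| <= (\sum_i g i)%N%:R.
    apply: ltW; apply: lt_le_trans (floorD1_gt _) _.
    by rewrite pmulrn ler_int (bigD1 i) //= /g; move: (Num.floor _) (bigop _ _ _) => f h; lia.
  have := normr_ge0 (s i 0); have := normr_ge0 (s' i 0); lra.
have [c hc] := tK (rho + N)%N; exists c => y hy.
by split; apply: hc => i; rewrite mxE natrD addrAC (le_trans (ler_normD _ _)) // lerD //;
  have [] := hN i.
Qed.

(** A point of the open set close to x has the same nonzero signs as x. *)
Lemma closed_hull_signs (U : set V) (x : V) : closed_hull U x -> exists2 v, U v &
  forall M, M \in bases A -> forall i,
    (0 < crd M x i -> 0 < crd M v i) /\ (crd M x i < 0 -> crd M v i < 0).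
Proof.
move=> hx.
have [|r rp hr] := @small_ex (fun r => forall M, M \in bases A -> forall i,
    crd M x i != 0 -> r * crd_norm M i < `|crd M x i|).
  apply: small_all => M hM; apply: small_fin => i; have [->|un] := eqVneq (crd M x i) 0.
    by exists 1 => // r _ _; rewrite eqxx.
  have [|r1 r10 h] := @small_lt `|crd M x i| (crd_norm M i); first by rewrite normr_gt0.
  by exists r1 => // r ra rb _; exact: h.
have [v Uv hv] := hx r rp; exists v => // M hM i.
have key : crd M x i != 0 -> `|crd M v i - crd M x i| < `|crd M x i|.
  move=> un; apply: le_lt_trans (hr M hM i un); rewrite mulrC -crdN -crdD.
  by apply: crd_le_norm => k; rewrite !mxE distrC ltW // hv.
split=> h.
- have := key (lt0r_neq0 h); rewrite (gtr0_norm h) ltr_norml => /andP[]; lra.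
- have := key (ltr0_neq0 h); rewrite (ltr0_norm h) ltr_norml => /andP[]; lra.
Qed.

Definition compound_roots : seq (positive_roots Phi) :=
  [seq a <- enum {: positive_roots Phi} | [forall i, val a != simple_root i]].

Definition compounds : seq V := [seq val a | a <- compound_roots].

Lemma kostant_pcount v : kostant Phi v = pcount compounds v.
Proof.
pose sidx i : positive_roots Phi := [` simple_positive i]%fset.
apply: (@card_solutions n _ (fun a : positive_roots Phi => val a) sidx).
- by move=> a i; apply: positive_root_nat; exact: valP.
- move=> a; have aA : val a \in A := valP a.
  have [i ai] : exists i, val a i 0 != 0.
    have := positive_root_neq0 aA; apply: contraPP => h; apply/negP; rewrite negbK; apply/eqP/colP => i.
    by rewrite mxE; apply/eqP; apply: contra_notT h => ?; exists i.
  rewrite /height (bigD1 i) //= -[X in X <= _]addr0 lerD ?sumr_ge0 // => [|j _].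
    by have /natrP[[|k] e] := positive_root_nat i aA; rewrite e ?eqxx // ler1n in ai *.
  exact: positive_root_ge0.
- by move=> i.
- by rewrite filter_uniq // enum_uniq.
- by move=> i; rewrite mem_filter negb_and; apply/orP; left; rewrite negb_forall; apply/existsP; exists i; rewrite negbK.
- move=> b; rewrite mem_filter mem_enum andbT negb_forall.
  by case/existsP => i; rewrite negbK => /eqP e; exists i; apply: val_inj.
Qed.

Lemma compounds_positive : {subset compounds <= A}.
Proof. by move=> _ /mapP[a _ ->]; exact: valP. Qed.

Lemma kostant_nonintegral v : ~ integral v -> kostant Phi v = 0%N.
Proof.
move=> hv; rewrite kostant_pcount; elim: compounds compounds_positive v hv => [|a l IH] sub v hv /=.
  case: (boolP (natural v)) => // /forallP h; case: hv => i.
  by rewrite intrEge0 ?natr_ge0 // h.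
have la : {subset l <= A} by move=> b bl; apply: sub; rewrite inE bl orbT.
apply: big1 => k _; apply: IH => // h; apply: hv.
rewrite -(subrK (a *+ k) v); apply: integralD => //.
by rewrite pmulrn; apply/integralMz/positive_root_int/sub; rewrite mem_head.
Qed.

Section ChamberPeriod.

Variables (R : realType) (D : nat).
Hypothesis n_gt0 : (0 < n)%N.
Hypothesis D_gt0 : (0 < D)%N.
Hypothesis D_lattice : forall M, M \in bases A -> forall i,
  exists w : 'I_n -> int, simple_root i *+ D = \sum_j col j M *~ w j.

Lemma sum_at (T : Type) (r : seq T) (F : T -> V -> rat) x :
  (\sum_(t <- r) F t) x = \sum_(t <- r) F t x.
Proof. by elim: r => [|t r IH]; rewrite ?big_nil // !big_cons -IH. Qed.

Lemma unip_basis M q i : M \in bases A -> unips M q -> unip (simple_root i *+ D) q.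
Proof.
by move=> hM uq; have [w ->] := D_lattice hM i; apply: unip_bsum => j; exact: unip_mulrz.
Qed.

(** If x + s lies in the same open cones as u, the cut-offs at x are those of u,
    so the sum of the functions q_M over the cones that contain u gives the
    count. *)
Lemma kostant_near (u v : V) : regular Phi u -> regular_component Phi u v ->
  exists s f, [/\ forall i, unip (simple_root i *+ D) f,
    forall x, integral x -> (forall M, M \in bases A -> in_cone M (x + s) = in_cone M u) ->
      (kostant Phi x)%:R = f x,
    forall M, M \in bases A -> forall i, 0 < crd M v i -> 0 < crd M s i &
    forall M, M \in bases A -> forall i, crd M v i < 0 -> crd M s i < 0].
Proof.
move=> ru cv; have [rv _] := regular_componentP ru cv.
have [s [[q uq hq] s1 s2]] := decomposed_near positive_root_int positive_root_ge0
  positive_root_neq0 simple_positive compounds_positive (regular_gt0 rv).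
exists s, (\sum_(M <- bases A) if (M \in bases A) && in_cone M u then q M else 0); split=> //.
  move=> i; apply: unip_sum => M; case: (boolP (M \in bases A)) => [hM|_]; last exact: unip0.
  by case: ifP => _; [apply: unip_basis hM (uq _ hM)|exact: unip0].
move=> x ix hx; rewrite kostant_pcount hq //.
rewrite sum_at; apply: eq_big_seq => M hM; rewrite hx // hM.
by case: (in_cone M u); rewrite /= ?mul1r ?mul0r.
Qed.

(** For a point x of the closed chamber, let v be a point of the open chamber near
    x, and let s be a shift in the direction of v: x + s lies in the same
    open cones as v, even if x lies on their boundaries, so the cut-offs at x
    are those of the chamber.  The function
    f obtained from s may depend on x, but any two such functions agree on a
    thick set and hence everywhere. *)
Lemma kostant_chamber u : regular Phi u -> exists2 f,
  forall i, unip (simple_root i *+ D) f &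
  forall x, integral x -> closed_hull (regular_component Phi u) x ->
    (kostant Phi x)%:R = f x.
Proof.
move=> ru; have [s [f [uf hf _ _]]] := kostant_near ru (rt_refl _ _ u).
exists f => // x ix hx; have [v cv xv] := closed_hull_signs hx.
have [rv vu] := regular_componentP ru cv.
have [s' [f' [uf' hf' s1 s2]]] := kostant_near ru cv.
(* Both functions count the partitions of y when y + s and y + s' have the
   signs of u. *)
have eq_f : forall y, integral y -> f' y = f y.
  apply: (extend_eq R D_gt0 (thick_shift s s' (@thick_same_signs u))) => // y iy [h h'].
  by rewrite -hf' // ?hf // => M hM; exact: same_signs_cone.
rewrite -eq_f // -hf' // => M hM; rewrite -vu //.
apply/idP/idP => [|/forallP vM]; last first.
  apply/forallP => i; rewrite crdD ltr_wpDl ?s1 // leNgt; apply/negP => /((xv M hM i).2).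
  by rewrite ltNge ltW.
have [[i vi]|//] := regular_crd rv hM.
move/forallP => /(_ i); rewrite crdD ltNge ler_wnDl ?(ltW (s2 _ _ _ _)) //.
by rewrite leNgt; apply/negP => /((xv M hM i).1); rewrite ltNge ltW.
Qed.

Theorem kostant_period : kostant_period_divides R Phi D.
Proof.
move=> K [u ru ->]; have [f uf hf] := kostant_chamber ru.
have cD : cellwise D (@extend R n f) by exact: cellwise_extend.
have tK : thick (closed_hull (regular_component Phi u)).
  move=> rho; have [c hc] := @thick_same_signs u rho; exists c => y hy e e0.
  exists y; last by move=> i; rewrite subrr normr0.
  by apply: same_signs_component => //; exact: hc.
have agr : kostant_agrees Phi (closed_hull (regular_component Phi u)) (@extend R n f).
  move=> v hv; have [iv|niv] := pselect (integral v).
    have [k ev] := integral_int iv.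
    by rewrite {2}ev map_ratr_int extend_on -ev -hf // ratr_nat.
  rewrite kostant_nonintegral // extend_off // => z ez; apply: niv => i.
  have /colP/(_ i) := ez; rewrite !mxE -(ratr_int _ (z i 0)) => /fmorph_inj ->.
  exact: intr_int.
exists (@extend R n f); split; last exact: period_divides.
split; first by split=> //; exact: (cellwise_quasi D_gt0 cD).
move=> g [qg ag]; apply: (quasipolynomial_eq tK) => //; first exact: (cellwise_quasi D_gt0 cD).
by move=> v Kv; rewrite -agr // -ag.
Qed.

End ChamberPeriod.

End Chambers.

(** * Exponents of lattice quotients *)

Section Lattices.

Variable n : nat.
Local Notation V := 'cV[rat]_n.
Implicit Types (S : {fset V}) (u v a : V).

Lemma lattice0 S : lattice S 0.
Proof. by exists (fun=> 0); rewrite big1. Qed.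

Lemma latticeB S u v : lattice S u -> lattice S v -> lattice S (u - v).
Proof.
move=> [c ->] [c' ->]; exists (fun a => c a - c' a); rewrite -sumrB.
by apply: eq_bigr => a _; rewrite mulrzBr.
Qed.

Lemma latticeN S v : lattice S v -> lattice S (- v).
Proof. by rewrite -sub0r => h; apply: latticeB => //; exact: lattice0. Qed.

Lemma latticeD S u v : lattice S u -> lattice S v -> lattice S (u + v).
Proof. by move=> hu hv; rewrite -[v]opprK; apply: latticeB => //; exact: latticeN. Qed.

Lemma lattice_sum S (I : Type) (r : seq I) (P : pred I) (F : I -> V) :
  (forall i, P i -> lattice S (F i)) -> lattice S (\sum_(i <- r | P i) F i).
Proof. by move=> H; elim/big_ind: _ => //; [exact: lattice0|exact: latticeD]. Qed.

Lemma latticeMz S v (k : int) : lattice S v -> lattice S (v *~ k).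
Proof. by move=> [c ->]; exists (fun a => c a * k); rewrite mulrz_suml; apply: eq_bigr => a _; rewrite mulrzA. Qed.

Lemma latticeMn S v k : lattice S v -> lattice S (v *+ k).
Proof. by rewrite pmulrn; exact: latticeMz. Qed.

Lemma lattice_mem S a : a \in S -> lattice S a.
Proof.
move=> aS; exists (fun b => (b == a)%:Z); rewrite (bigD1_seq a) ?fset_uniq //= eqxx.
by rewrite big1 ?addr0 // => b /negPf ->.
Qed.

Lemma coset_order_dvd S v k d : coset_order (lattice S) v k -> lattice S (v *+ d) -> (k %| d)%N.
Proof.
move=> [k0 hk mk] hd; rewrite /dvdn; apply: contraPT hd; rewrite -lt0n => r0 hd.
have : lattice S (v *+ (d %% k)).
  have -> : v *+ (d %% k) = v *+ d - v *+ k *+ (d %/ k).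
    by rewrite {2}(divn_eq d k) mulrnDr -mulrnA mulnC addrAC subrr add0r.
  by apply: latticeB => //; exact: latticeMn.
by move/(mk _ r0); rewrite leqNgt ltn_mod k0.
Qed.

Lemma coset_order_exists S v d : (0 < d)%N -> lattice S (v *+ d) ->
  exists k, coset_order (lattice S) v k.
Proof.
move=> d0 hd.
have ex : exists k, (0 < k)%N && `[< lattice S (v *+ k) >].
  by exists d; rewrite d0; apply/asboolP.
case: (ex_minnP ex) => k /andP[k0 /asboolP hk] mk; exists k; split=> // j j0 hj.
by apply: mk; rewrite j0; apply/asboolP.
Qed.

Definition ev (x : 'rV[rat]_n) (a : V) : rat := (x *m a) 0 0.

Lemma evDl x y a : ev (x + y) a = ev x a + ev y a.
Proof. by rewrite /ev mulmxDl mxE. Qed.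
Lemma evNl x a : ev (- x) a = - ev x a.
Proof. by rewrite /ev mulNmx mxE. Qed.
Lemma evZl k x a : ev (k *: x) a = k * ev x a.
Proof. by rewrite /ev -scalemxAl mxE. Qed.
Lemma evDr x a b : ev x (a + b) = ev x a + ev x b.
Proof. by rewrite /ev mulmxDr mxE. Qed.
Lemma evNr x a : ev x (- a) = - ev x a.
Proof. by rewrite /ev mulmxN mxE. Qed.
Lemma evZr k x a : ev x (k *: a) = k * ev x a.
Proof. by rewrite /ev -scalemxAr mxE. Qed.
Lemma evE x a : ev x a = \sum_i x 0 i * a i 0.
Proof. by rewrite /ev mxE. Qed.
Lemma ev_simple x i : ev x (simple_root i) = x 0 i.
Proof.
rewrite evE (bigD1 i) //= mxE !eqxx mulr1 big1 ?addr0 // => j ji.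
by rewrite mxE (negPf ji) mulr0.
Qed.
Lemma ev_delta i a : ev (delta_mx 0 i) a = a i 0.
Proof.
rewrite evE (bigD1 i) //= mxE !eqxx mul1r big1 ?addr0 // => j ji.
by rewrite mxE (negPf ji) mul0r.
Qed.

Lemma span_dual S z : (<<S>> = fullv)%VS -> (forall a, a \in S -> ev z a = 0) -> z = 0.
Proof.
move=> sp hz; apply/rowP => i; rewrite -ev_simple mxE.
have : simple_root i \in <<in_tuple S>>%VS by rewrite sp memvf.
move/coord_span ->; rewrite /ev mulmx_sumr summxE big1 // => j _.
by rewrite -scalemxAr mxE -/(ev z _) hz ?mulr0 // mem_nth.
Qed.

Lemma span_full S : (forall i, simple_root i \in <<S>>%VS) -> (<<S>> = fullv)%VS.
Proof.
move=> h; apply/eqP; rewrite eqEsubv subvf /=; apply/subvP => v _; rewrite (col_sum v).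
by apply: memv_suml => i _; exact/memvZ/h.
Qed.

(** In the Smith normal form of the matrix of S, the last invariant factor dn is
    the exponent of the quotient of the integral vectors by the lattice of S,
    since it is a multiple of all the others.  The functional y is f / dn with f
    the last column of the inverse of R: the products of f with the rows are
    divisible by dn, so y is integral on S, and f belongs to a basis of the
    integral vectors, so dn is the exact denominator of y. *)
Lemma exponent_functional S : (0 < n)%N -> (<<S>> = fullv)%VS ->
    (forall a, a \in S -> integral a) ->
  exists (d : nat) (y : 'rV[rat]_n), [/\ (0 < d)%N,
    forall a, a \in S -> ev y a \is a Num.int,
    forall j : nat, (forall i, y 0 i *+ j \is a Num.int) -> (d %| j)%N,
    forall i, y 0 i *+ d \is a Num.int &
    forall v, integral v -> lattice S (v *+ d)].
Proof.
move=> n0 sp iS.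
pose N := size S.
pose M : 'M[int]_(N, n) := \matrix_(k, i) Num.floor ((nth 0 S k) i 0).
have [L uL [R uR [d sd dM]]] := int_Smith_normal_form M.
pose Dm : 'M[int]_(N, n) := \matrix_(i, j) (d`_i *+ (i == j :> nat)).
have lt : (n.-1 < n)%N by rewrite prednK.
pose jl := Ordinal lt.
pose f : 'cV[int]_n := invmx R *m delta_mx jl 0.
have Rf : R *m f = delta_mx jl 0 by rewrite /f mulKVmx.
have rowM (k : 'I_N) (c : 'cV[int]_n) : ((M *m c) k 0)%:~R = ev (map_mx intr c)^T (nth 0 S k).
  rewrite evE mxE rmorph_sum; apply: eq_bigr => i _; rewrite !mxE rmorphM mulrC; congr (_ * _).
  by rewrite /= floorK // iS // mem_nth.
have MfE : M *m f = L *m (Dm *m delta_mx jl 0) by rewrite dM -!mulmxA Rf.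
have DmE (i : 'I_N) : (Dm *m delta_mx jl (0 : 'I_1)) i 0 = d`_i *+ (i == n.-1 :> nat).
  rewrite mxE (bigD1 jl) //= !mxE !eqxx mulr1 big1 ?addr0 // => j jj.
  by rewrite !mxE (negPf jj) mulr0.
have f_neq0 : f != 0.
  apply/eqP => f0; have := congr1 (fun c : 'cV_n => c jl 0) Rf.
  by rewrite f0 mulmx0 !mxE !eqxx => /eqP; rewrite eq_sym oner_eq0.
have Dneq0 : Dm *m delta_mx jl (0 : 'I_1) != 0.
  apply/eqP => D0; move/eqP: f_neq0; apply; apply/colP => i; rewrite mxE.
  have z0 : (map_mx intr f : 'cV[rat]_n)^T = 0.
    apply: (span_dual sp) => a aS; have la : (index a S < N)%N by rewrite index_mem.
    by have := rowM (Ordinal la) f; rewrite MfE D0 mulmx0 mxE /= nth_index // => <-.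
  by have := congr1 (fun r : 'rV_n => r 0 i) z0; rewrite !mxE => /eqP; rewrite intr_eq0 => /eqP.
(* S spans, so M f cannot vanish, which makes the last invariant factor nonzero. *)
have [ltN dn0] : (n.-1 < N)%N /\ d`_n.-1 != 0.
  move: Dneq0; apply: contraNP => h; apply/eqP/colP => i; rewrite DmE mxE.
  have [E|] := eqVneq (i : nat) n.-1; last by rewrite mulr0n.
  rewrite mulr1n E; apply/eqP; apply: contra_notT h => h; split=> //.
  by rewrite -E ltn_ord.
set dn := d`_n.-1 in dn0.
pose q := absz dn; have q0 : (0 < q)%N by rewrite absz_gt0.
have dq : exists s : int, dn = q%:Z * s /\ q%:Z = dn * s.
  exists (if 0 <= dn then 1 else -1); rewrite /q.
  by case: ifP => h; lia.
have [s [es1 es2]] := dq.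
have dnQ : (dn%:~R : rat) != 0 by rewrite intr_eq0.
exists q, (dn%:~R^-1 *: (map_mx intr f)^T); split=> //.
- move=> a aS; have la : (index a S < N)%N by rewrite index_mem.
  rewrite evZl -(nth_index 0 aS) -(rowM (Ordinal la)) MfE.
  rewrite (_ : Dm *m delta_mx jl (0 : 'I_1) = dn *: \col_i (i == n.-1 :> nat)%:Z); last first.
    apply/colP => i; rewrite DmE !mxE; case: eqP => [->|_]; last by rewrite mulr0.
    by rewrite mulr1n mulr1.
  by rewrite -scalemxAr mxE intrM mulrA mulVf // mul1r intr_int.
- move=> j hj.
  have /fin_all_exists[g hg] : forall i, exists z : int, f i 0 * j%:Z = z * dn.
    move=> i; have /intrP[z hz] := hj i; exists z; apply/eqP; rewrite -(eqr_int rat) !intrM.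
    by rewrite -hz !mxE -mulr_natr; apply/eqP; rewrite -pmulrn; field.
  have : (R *m (f *m (j%:Z)%:M)) jl 0 = ((R *m \col_i g i) jl 0) * dn.
    rewrite mxE [X in X * _]mxE mulr_suml; apply: eq_bigr => i _; rewrite -mulrA; congr (_ * _).
    by rewrite mul_mx_scalar [LHS]mxE [X in _ = X * _]mxE [LHS]mulrC hg.
  rewrite mulmxA Rf mul_mx_scalar !mxE !eqxx mulr1 => jE.
  by have := dvdz_mull (\sum_j0 R jl j0 * (\col_i g i) j0 0) (dvdzz dn); rewrite -jE /dvdz /= /q.
- move=> i; rewrite !mxE -mulr_natr pmulrn es2 intrM.
  by rewrite mulrAC mulKf // rpredM ?intr_int.
move=> v /integral_int[c ->].
have ddvd (i : nat) : (i < n)%N -> exists2 z : int, dn = d`_i * z & d`_i != 0.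
  move=> hi; have hs : (n.-1 < size d)%N.
    by rewrite ltnNge; apply: contraNN dn0 => h; rewrite /dn nth_default.
  have : (d`_i %| dn)%Z.
    have [E|ne] := eqVneq i n.-1; first by rewrite E dvdzz.
    by apply: (sorted_ltn_nth (@dvdz_trans)) => //; rewrite ?inE; lia.
  move/dvdzP => [z ez]; exists z; first by rewrite mulrC.
  by apply: contraNneq dn0 => d0; rewrite ez d0 mulr0.
have nN : (n <= N)%N by rewrite -(prednK n0).
have [t et] : exists t : 'rV[int]_n, t = c^T *m invmx R by exists (c^T *m invmx R).
have /fin_all_exists[z hz] : forall i : 'I_n, exists z : int, dn = d`_i * z.
  by move=> i; have [z e _] := ddvd i (ltn_ord i); exists z.
(* Coefficients of dn v on the rows, obtained factor by factor from dn = d_i z_i. *)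
pose g : 'rV[int]_N := \row_i (if insub (i : nat) is Some j then t 0 j * z j else 0).
have gD : g *m Dm = dn *: t.
  apply/rowP => j; rewrite !mxE (bigD1 (widen_ord nN j)) //= !mxE eqxx mulr1n (valK j).
  rewrite big1 ?addr0 => [|i ij]; first by rewrite (hz j); ring.
  rewrite !mxE (_ : (i == j :> nat) = false) ?mulr0n ?mulr0 //.
  by apply/negbTE; move: ij; rewrite -(inj_eq val_inj).
have uM : (g *m invmx L) *m M = dn *: c^T.
  by rewrite dM mulmxA mulmxA mulmxKV // gD -scalemxAl et mulmxKV.
have Lv : lattice S (map_mx intr c *~ dn).
  pose u := g *m invmx L.
  exists (fun a => if insub (index a S) is Some k then u 0 k else 0).
  rewrite (big_nth 0) big_mkord; apply/colP => i; rewrite summxE.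
  have := congr1 (fun r : 'rV_n => r 0 i) uM; rewrite mxE => uMi.
  rewrite -scaler_int !mxE -intrM.
  have -> : dn * c i 0 = (dn *: c^T) 0 i by rewrite !mxE.
  rewrite -uMi rmorph_sum; apply: eq_bigr => k _.
  rewrite index_uniq ?fset_uniq // (valK k) -scaler_int !mxE rmorphM /=; congr (_ * _).
  by rewrite floorK // iS // mem_nth.
by rewrite pmulrn es2 mulrzA; exact: latticeMz.
Qed.

End Lattices.

(** * The invariant form and the highest root *)

Section RootSystems.

Variables (n : nat) (Phi : root_system n).
Local Notation V := 'cV[rat]_n.
Local Notation Rt := (roots Phi).
Local Notation co := (coroot Phi).
Local Notation "<< v , a >>" := (pairing Phi v a).
Implicit Types (a b v : V) (x y z : 'rV[rat]_n).

Lemma pairingE v a : << v, a >> = ev (co a) v. Proof. by []. Qed.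

Lemma reflection_root a b : a \in Rt -> b \in Rt -> reflection Phi a b \in Rt.
Proof. exact: roots_refl. Qed.

Lemma pairing_self a : a \in Rt -> << a, a >> = 2.
Proof. exact: coroot_self. Qed.

Lemma pairing_int a b : a \in Rt -> b \in Rt -> << b, a >> \is a Num.int.
Proof. exact: coroot_int. Qed.

Lemma reflectionK a v : a \in Rt -> reflection Phi a (reflection Phi a v) = v.
Proof.
move=> ra; have pr : << reflection Phi a v, a >> = - << v, a >>.
  by rewrite /reflection [LHS]pairingE evDr evNr evZr -!pairingE pairing_self //; ring.
by rewrite {1}/reflection pr scaleNr opprK /reflection subrK.
Qed.

Lemma oppr_root a : a \in Rt -> - a \in Rt.
Proof.
move=> ra; have := reflection_root ra ra; rewrite /reflection pairing_self //.
by rewrite scaler_nat mulr2n opprD addrA subrr add0r.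
Qed.

(** The form [sum_a a(x) a(y)] on the dual space is invariant under the Weyl
    group, and it relates the coroots of two roots to their pairing. *)
Definition form x y : rat := \sum_(a <- Rt) ev x a * ev y a.

Lemma form_sym x y : form x y = form y x.
Proof. by apply: eq_bigr => a _; rewrite mulrC. Qed.
Lemma formDl x y z : form (x + y) z = form x z + form y z.
Proof. by rewrite /form -big_split; apply: eq_bigr => a _; rewrite evDl mulrDl. Qed.
Lemma formNl x z : form (- x) z = - form x z.
Proof. by rewrite /form -sumrN; apply: eq_bigr => a _; rewrite evNl mulNr. Qed.
Lemma formZl k x z : form (k *: x) z = k * form x z.
Proof. by rewrite /form mulr_sumr; apply: eq_bigr => a _; rewrite evZl mulrA. Qed.
Lemma formDr x y z : form z (x + y) = form z x + form z y.
Proof. by rewrite !(form_sym z) formDl. Qed.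
Lemma formNr x z : form z (- x) = - form z x.
Proof. by rewrite !(form_sym z) formNl. Qed.
Lemma formZr k x z : form z (k *: x) = k * form z x.
Proof. by rewrite !(form_sym z) formZl. Qed.

Lemma form_ge0 x : 0 <= form x x.
Proof. by apply: sumr_ge0 => a _; rewrite -expr2 sqr_ge0. Qed.

Lemma form_eq0 x : form x x <= 0 -> x = 0.
Proof.
move=> h; have h0 : form x x = 0 by apply/eqP; rewrite eq_le h form_ge0.
apply: (span_dual (roots_span Phi)) => a aR.
move: h0; rewrite /form (bigD1_seq a) ?fset_uniq //= => /eqP.
rewrite paddr_eq0 -?expr2 ?sqr_ge0 //.
  by rewrite sqrf_eq0 => /andP[/eqP].
by apply: sumr_ge0 => b _; rewrite -expr2 sqr_ge0.
Qed.

Definition coreflection b x := x - ev x b *: co b.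

Lemma ev_coreflection b x a : ev (coreflection b x) a = ev x (reflection Phi b a).
Proof. by rewrite /coreflection /reflection evDl evNl evZl evDr evNr evZr -pairingE; ring. Qed.

Lemma coreflectionK b x : b \in Rt -> coreflection b (coreflection b x) = x.
Proof.
by move=> rb; apply/rowP => i; rewrite -!ev_simple !ev_coreflection reflectionK.
Qed.

Lemma sum_reflection b (F : V -> rat) : b \in Rt ->
  \sum_(a <- Rt) F (reflection Phi b a) = \sum_(a <- Rt) F a.
Proof.
move=> rb; rewrite -(big_map (reflection Phi b) xpredT); apply: perm_big.
apply: uniq_perm; rewrite ?fset_uniq //.
  by rewrite map_inj_uniq ?fset_uniq //; exact: can_inj (fun a => reflectionK a rb).
move=> a; apply/mapP/idP => [[c cR ->]|aR]; first exact: reflection_root.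
by exists (reflection Phi b a); rewrite ?reflectionK ?reflection_root.
Qed.

Lemma form_coreflection b x y : b \in Rt ->
  form (coreflection b x) (coreflection b y) = form x y.
Proof.
move=> rb; rewrite /form -[RHS](sum_reflection (fun a => ev x a * ev y a) rb).
by apply: eq_bigr => a _; rewrite !ev_coreflection.
Qed.

Lemma form_coroot b x : b \in Rt -> 2 * form (co b) x = ev x b * form (co b) (co b).
Proof.
move=> rb; have := form_coreflection (co b) x rb.
have -> : coreflection b (co b) = - co b.
  by rewrite /coreflection -pairingE pairing_self // scaler_nat mulr2n opprD addrA subrr add0r.
by rewrite /coreflection formNl formDr formNr formZr; lra.
Qed.

Lemma form_coroot_gt0 b : b \in Rt -> 0 < form (co b) (co b).
Proof.
move=> rb; rewrite lt_neqAle form_ge0 andbT eq_sym; apply/eqP => h.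
have c0 : co b = 0 by apply: form_eq0; rewrite h.
by have := pairing_self rb; rewrite pairingE c0 /ev mul0mx mxE.
Qed.

Lemma pairing_sym a b : a \in Rt -> b \in Rt ->
  << b, a >> * form (co b) (co b) = << a, b >> * form (co a) (co a).
Proof.
move=> ra rb; have := form_coroot (co a) rb; have := form_coroot (co b) ra.
by rewrite form_sym -!pairingE => -> ->.
Qed.

Lemma pairing_gt0 a b : a \in Rt -> b \in Rt -> (0 < << b, a >>) = (0 < << a, b >>).
Proof.
move=> ra rb; have := pairing_sym ra rb.
have := form_coroot_gt0 ra; have := form_coroot_gt0 rb => hb ha e.
by rewrite -(pmulr_lgt0 _ hb) e pmulr_lgt0.
Qed.

Lemma pairing_lt0 a b : a \in Rt -> b \in Rt -> (<< b, a >> < 0) = (<< a, b >> < 0).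
Proof.
move=> ra rb; have := pairing_sym ra rb.
have := form_coroot_gt0 ra; have := form_coroot_gt0 rb => hb ha e.
by rewrite -(pmulr_llt0 _ hb) e pmulr_llt0.
Qed.

Lemma coroot_inj a b : a \in Rt -> b \in Rt -> co a = co b -> a = b.
Proof.
move=> ra rb e; apply/colP => i; rewrite -!ev_delta.
have := form_coroot (delta_mx 0 i) ra; rewrite e form_coroot // => /(mulIf _) -> //.
by rewrite gt_eqF // form_coroot_gt0.
Qed.

(** Two roots at an acute angle differ by a root, since one of the two Cartan
    integers is 1: were both at least 2, the coroots would coincide. *)
Lemma sub_root a b : a \in Rt -> b \in Rt -> a != b -> 0 < << a, b >> -> a - b \in Rt.
Proof.
move=> ra rb ab h; have h' : 0 < << b, a >> by rewrite (pairing_gt0 ra rb).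
have /intrP[p ep] := pairing_int rb ra; have /intrP[q eq] := pairing_int ra rb.
have p0 : 0 < p by rewrite -(ltr_int rat) -ep.
have q0 : 0 < q by rewrite -(ltr_int rat) -eq.
have [p1|p1] := eqVneq p 1.
  by have := reflection_root rb ra; rewrite /reflection ep p1 scale1r.
have [q1|q1] := eqVneq q 1.
  by have := oppr_root (reflection_root ra rb); rewrite /reflection eq q1 scale1r opprB.
have p2 : 2 <= << a, b >> by rewrite ep (ler_int _ 2); lia.
have q2 : 2 <= << b, a >> by rewrite eq (ler_int _ 2); lia.
case/eqP: ab; apply: coroot_inj => //; apply/eqP; rewrite -subr_eq0; apply/eqP/form_eq0.
have e1 := form_coroot (co a) rb; have e2 := form_coroot (co b) ra.
rewrite -!pairingE in e1 e2.
have g1 := form_coroot_gt0 ra; have g2 := form_coroot_gt0 rb.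
rewrite formDl !formDr !formNl !formNr (form_sym (co a) (co b)) in e2 *.
have : 2 * form (co b) (co b) <= << b, a >> * form (co b) (co b) by rewrite ler_pM2r.
have : 2 * form (co a) (co a) <= << a, b >> * form (co a) (co a) by rewrite ler_pM2r.
have := pairing_sym ra rb.
by lra.
Qed.

Hypothesis base : standard_base Phi.
Hypothesis red : reduced Phi.
Local Notation al := (@simple_root n).

Definition positive v := forall i, 0 <= v i 0.

Lemma root_sign a : a \in Rt -> positive a \/ positive (- a).
Proof.
move=> ra; have [h|h] := base.2 _ ra; [left|right] => i; rewrite ?mxE; exact: natr_ge0.
Qed.

Lemma root_int a i : a \in Rt -> a i 0 \is a Num.int.
Proof.
move=> ra; have [h|h] := base.2 _ ra; have := h i => /natrP[k e].
  by rewrite e; exact: natr_int.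
by rewrite -[a i 0]opprK e rpredN natr_int.
Qed.

Lemma root_positive a i : a \in Rt -> 0 < a i 0 -> positive a.
Proof.
move=> ra h; have [//|/(_ i)] := root_sign ra.
by rewrite mxE oppr_ge0 leNgt h.
Qed.

Lemma al_coord i j : al i j 0 = (j == i)%:R.
Proof. by rewrite mxE eqxx andbT. Qed.

Lemma reflection_coord i a j : reflection Phi (al i) a j 0 =
  a j 0 - << a, al i >> * (j == i)%:R.
Proof. by rewrite /reflection !mxE eqxx andbT. Qed.

Lemma pairing_sum v a : << v, a >> = \sum_i v i 0 * << al i, a >>.
Proof.
by rewrite {1}(col_sum v) pairingE /ev mulmx_sumr summxE; apply: eq_bigr => i _;
  rewrite -scalemxAr mxE.
Qed.

Lemma height_reflection i a : height (reflection Phi (al i) a) = height a - << a, al i >>.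
Proof.
rewrite /reflection heightD heightN; congr (_ - _).
rewrite /height (bigD1 i) //= mxE al_coord eqxx mulr1 big1 ?addr0 // => j ji.
by rewrite mxE al_coord (negPf ji) mulr0.
Qed.

Lemma height_ge0 v : positive v -> 0 <= height v.
Proof. by move=> h; apply: sumr_ge0 => i _; exact: h. Qed.

Lemma height_gt0 a : a \in Rt -> positive a -> 0 < height a.
Proof.
move=> ra pa; rewrite lt_neqAle height_ge0 // andbT eq_sym; apply/eqP => h.
have : a == 0.
  apply/eqP/colP => i; rewrite mxE; move/eqP: h; rewrite psumr_eq0; last by move=> j _; exact: pa.
  by move/allP/(_ i (mem_index_enum i))/eqP.
by rewrite (negPf (root_neq0 ra)).
Qed.

Lemma height_natural a : a \in Rt -> positive a -> exists k : nat, height a = k%:R.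
Proof.
move=> ra pa; apply/natrP; rewrite natrEint height_ge0 // andbT.
by apply: rpred_sum => i _; exact: root_int.
Qed.

Lemma exists_descent a : a \in Rt -> positive a -> exists i, 0 < << a, al i >>.
Proof.
move=> ra pa; apply/existsP; rewrite -[X in is_true X]negbK negb_exists; apply/forallP => h.
have := pairing_self ra; rewrite pairing_sum => e.
have : \sum_i a i 0 * << al i, a >> <= 0.
  apply: sumr_le0 => i _; apply: mulr_ge0_le0 => //.
  by rewrite leNgt (pairing_gt0 ra (base.1 i)).
by rewrite e.
Qed.

(** Every positive root is reached from a simple one by simple reflections
    that keep it positive, so a property that is stable under simple
    reflections and holds for the simple roots holds for all positive roots. *)
Lemma root_induction (P : V -> Prop) :
    (forall i, P (al i)) ->
    (forall i a, a \in Rt -> P a -> P (reflection Phi (al i) a)) ->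
  forall a, a \in Rt -> positive a -> P a.
Proof.
move=> P0 PS; suff H (k : nat) a : height a < k%:R -> a \in Rt -> positive a -> P a.
  move=> a ra pa; have [k hk] := height_natural ra pa.
  by apply: (H k.+1) => //; rewrite hk ltr_nat.
elim: k a => [|k IH] a hk ra pa.
  by have := lt_trans (height_gt0 ra pa) hk; rewrite ltxx.
have [i hi] := exists_descent ra pa.
have [/existsP[j /andP[ji aj]]|nj] := boolP [exists j, (j != i) && (0 < a j 0)]; last first.
  have aj j : j != i -> a j 0 = 0.
    move=> ji; apply/eqP; rewrite eq_le pa andbT leNgt; apply: contraNN nj => h.
    by apply/existsP; exists j; rewrite ji.
  have ea : a = a i 0 *: al i.
    apply/colP => j; rewrite mxE al_coord; have [->|ji] := eqVneq j i; first by rewrite mulr1.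
    by rewrite mulr0 aj.
  have a1 : a i 0 = 1.
    have [//|e] := red (base.1 i) (etrans (congr1 (fun v => v \in Rt) (esym ea)) ra).
    by have := pa i; rewrite e.
  by rewrite ea a1 scale1r.
have rb := reflection_root (base.1 i) ra.
rewrite -(reflectionK a (base.1 i)); apply: PS => //; apply: IH => //.
  rewrite height_reflection; apply: le_lt_trans (_ : height a - 1 < _); last first.
    by rewrite ltrBlDr natr1.
  rewrite lerD2l lerN2; have /intrP[z ez] := pairing_int (base.1 i) ra; rewrite ez in hi *.
  by move: hi; rewrite ltr0z ler1z; lia.
apply: (root_positive (i := j)) => //.
by rewrite reflection_coord (negPf ji) mulr0 subr0.
Qed.

Lemma pairing_simple_le0 i j : i != j -> << al i, al j >> <= 0.
Proof.
move=> ij; have rb := reflection_root (base.1 j) (base.1 i).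
have : positive (reflection Phi (al j) (al i)).
  apply: (root_positive (i := i)) => //.
  by rewrite reflection_coord al_coord eqxx (negPf ij) mulr0 subr0.
move/(_ j); rewrite reflection_coord al_coord eqxx eq_sym (negPf ij) mulr1 sub0r.
by rewrite oppr_ge0.
Qed.

(** Connectedness of the Dynkin diagram: only the empty and the full set of nodes
    are closed under adjacency. *)
Definition connected := forall P : pred 'I_n,
  (forall i j, << al i, al j >> != 0 -> P j -> P i) -> forall i j, P j -> P i.

Hypothesis conn : connected.
Hypothesis n_gt0 : (0 < n)%N.

Definition below (a b : V) := forall i, a i 0 <= b i 0.

Lemma max_height (Q : pred V) a0 : a0 \in Rt -> Q a0 ->
  exists a, [/\ a \in Rt, Q a & forall b, b \in Rt -> Q b -> height b <= height a].
Proof.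
move=> ra qa; pose i0 : Rt := [` ra]%fset.
case: (arg_maxP (P := fun c : Rt => Q (val c)) (fun c : Rt => height (val c)) (i0 := i0)) => // c qc hc.
exists (val c); split=> //; first exact: valP.
by move=> b rb qb; exact: (hc [` rb]%fset).
Qed.

(** If a coordinate vanishes at some node, the pairing with that simple root is a
    sum of nonpositive terms, so dominance makes the coordinates at the adjacent
    nodes vanish too. *)
Lemma dominant_support a : a \in Rt -> positive a ->
  (forall j, 0 <= << a, al j >>) -> forall i, 0 < a i 0.
Proof.
move=> ra pa da i; rewrite lt_neqAle pa andbT eq_sym; apply/negP => ai.
have : forall k, a k 0 == 0.
  move=> k; apply: (conn (P := fun k => a k 0 == 0)) ai => {}k j kj /eqP aj.
  have le0 l : a l 0 * << al l, al j >> <= 0.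
    have [->|lj] := eqVneq l j; first by rewrite aj mul0r.
    by rewrite mulr_ge0_le0 // pairing_simple_le0.
  have := da j; rewrite pairing_sum (bigD1 k) //= => h.
  have h2 : \sum_(l | l != k) a l 0 * << al l, al j >> <= 0 by apply: sumr_le0.
  have : a k 0 * << al k, al j >> = 0 by apply/eqP; rewrite eq_le le0 /=; lra.
  by move/eqP; rewrite mulf_eq0 (negPf kj) orbF.
move=> h; have := root_neq0 ra; have -> : a = 0; last by rewrite eqxx.
by apply/colP => k; rewrite mxE; exact/eqP.
Qed.

(** Uniqueness of the highest root: a root of maximal height among those that
    are not below a fixed root of maximal height is dominant with full
    support, hence at an acute angle with it, and their difference is a root. *)
Lemma highest_root : exists2 theta, theta \in Rt & forall a, a \in Rt -> below a theta.
Proof.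
have [theta [rt _ mt]] := max_height (Q := xpredT) (base.1 (Ordinal n_gt0)) isT.
have pt : positive theta.
  have [//|h] := root_sign rt; have := mt _ (base.1 (Ordinal n_gt0)) isT.
  have := height_ge0 h; rewrite heightN oppr_ge0 => h1 h2.
  have := height_gt0 (base.1 (Ordinal n_gt0)) _; rewrite ltNge (le_trans h2 h1) => /(_ _) h3.
  suff : false by []; apply: h3 => i; rewrite al_coord; by case: eqP.
have dt j : 0 <= << theta, al j >>.
  have := mt _ (reflection_root (base.1 j) rt) isT.
  by rewrite height_reflection gerDl oppr_le0.
exists theta => // a ra; apply: contrapT => nb.
pose bad : pred V := fun b => `[< ~ below b theta >].
have [b [rb /asboolP bb mb]] := max_height (Q := bad) ra (introT (asboolP _) nb).
have pb : positive b.
  have [//|h] := root_sign rb; case: bb => i; apply: le_trans (pt i).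
  by have := h i; rewrite mxE oppr_ge0.
have db j : 0 <= << b, al j >>.
  rewrite leNgt; apply/negP => h.
  have : bad (reflection Phi (al j) b).
    apply/asboolP => h'; apply: bb => i; apply: le_trans (h' i).
    rewrite reflection_coord lerDl oppr_ge0 mulr_le0_ge0 ?ler0n //; exact: ltW.
  move/(mb _ (reflection_root (base.1 j) rb)).
  by rewrite height_reflection gerDl oppr_le0 leNgt h.
have sb := dominant_support rb pb db.
have pbt : 0 < << b, theta >>.
  have ge0 i : 0 <= << al i, theta >>.
    by rewrite leNgt (pairing_lt0 rt (base.1 i)) -leNgt.
  rewrite pairing_sum lt_neqAle eq_sym sumr_ge0 ?andbT => [|i _]; last by rewrite mulr_ge0.
  rewrite psumr_eq0; last by move=> i _; rewrite mulr_ge0.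
  apply/negP => /allP h; have := pairing_self rt; rewrite pairing_sum big1 // => i _.
  have := h i (mem_index_enum i); rewrite /= mulf_eq0 gt_eqF //= => /eqP ->.
  by rewrite mulr0.
have bt : b != theta by apply/eqP => e; apply: bb; rewrite e => i.
have rd := sub_root rb rt bt pbt.
have [h|h] := root_sign rd.
  have := height_gt0 rd h; rewrite heightD heightN subr_gt0 ltNge => /negP; apply.
  exact: mt.
by apply: bb => i; have := h i; rewrite !mxE opprB subr_ge0.
Qed.

End RootSystems.

(** * Alcoves and orders in quotients of the root lattice *)

Section Alcove.

Variables (n : nat) (Phi : root_system n).
Local Notation V := 'cV[rat]_n.
Local Notation Rt := (roots Phi).
Local Notation co := (coroot Phi).
Local Notation al := (@simple_root n).
Local Notation "<< v , a >>" := (pairing Phi v a).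
Hypothesis base : standard_base Phi.
Variable theta : V.
Hypothesis theta_root : theta \in Rt.
Hypothesis theta_max : forall b, b \in Rt -> below b theta.
Implicit Types (a b v : V) (y z : 'rV[rat]_n).

Definition integral_on y a := ev y a \is a Num.int.

(** The properties of a functional dual to a subsystem of full rank that survive
    the affine Weyl group: the roots on which it is integral span the space, d
    divides its denominator and N is a multiple of it. *)
Definition full_rank_functional (d N : nat) y := [/\
  forall z, (forall a, a \in Rt -> integral_on y a -> ev z a = 0) -> z = 0,
  forall j : nat, (forall a, a \in Rt -> ev y a *+ j \is a Num.int) -> (d %| j)%N &
  forall a, a \in Rt -> ev y a *+ N \is a Num.int].

Lemma full_rank_coreflection d N b y : b \in Rt ->
  full_rank_functional d N y -> full_rank_functional d N (coreflection Phi b y).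
Proof.
move=> rb [h1 h2 h3]; split.
- move=> z hz; have cz0 : coreflection Phi b z = 0.
    apply: h1 => a ra ya; rewrite ev_coreflection; apply: hz; first exact: reflection_root.
    by rewrite /integral_on ev_coreflection reflectionK.
  by rewrite -(coreflectionK z rb) cz0 /coreflection /ev mul0mx mxE scale0r subr0.
- move=> j hj; apply: h2 => a ra; have := hj _ (reflection_root rb ra).
  by rewrite ev_coreflection reflectionK.
- by move=> a ra; rewrite ev_coreflection; apply/h3/reflection_root.
Qed.

Lemma full_rank_translate d N b (k : int) y : b \in Rt ->
  full_rank_functional d N y -> full_rank_functional d N (y + k%:~R *: co b).
Proof.
move=> rb [h1 h2 h3].
have ki a : a \in Rt -> k%:~R * ev (co b) a \is a Num.int.
  by move=> ra; rewrite rpredM ?intr_int // -pairingE pairing_int.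
have E a : ev (y + k%:~R *: co b) a = ev y a + k%:~R * ev (co b) a by rewrite evDl evZl.
split.
- move=> z hz; apply: h1 => a ra ya; apply: hz => //.
  by rewrite /integral_on E rpredD // ki.
- move=> j hj; apply: h2 => a ra; have := hj a ra; rewrite E mulrnDl.
  by rewrite rpredDr // rpredMn // ki.
- by move=> a ra; rewrite E mulrnDl rpredD // ?h3 // rpredMn // ki.
Qed.

Lemma theta_ge1 i : 1 <= theta i 0.
Proof. by have := theta_max (base.1 i) i; rewrite al_coord eqxx. Qed.

(** In the alcove, 0 <= y(a) <= y(theta) <= 1 for every positive root a. *)
Lemma integral_positive y a : a \in Rt -> integral_on y a -> positive a ->
  (forall i, 0 <= y 0 i) -> ev y theta <= 1 -> ev y a = 0 \/ ev y a = 1 /\ ev y theta = 1.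
Proof.
move=> ra /intrP[k ek] pa y0 yt.
have le : ev y a <= ev y theta.
  by rewrite !evE ler_sum // => i _; rewrite ler_wpM2l // theta_max.
have ge : 0 <= ev y a by rewrite evE sumr_ge0 // => i _; rewrite mulr_ge0.
have : (k == 0) || (k == 1).
  have := le_trans le yt; move: ge; rewrite ek ler0z -[1]/(1%:~R) ler_int; lia.
case/orP => /eqP k1; rewrite ek k1; [by left|right; split=> //].
by apply/eqP; rewrite eq_le yt; move: le; rewrite ek k1.
Qed.

(** A functional of full rank in the fundamental alcove is a vertex of it:
    it vanishes, or it vanishes on all simple roots but one, on which it is
    the inverse of the coefficient of the highest root. *)
Lemma alcove_vertex d N y : full_rank_functional d N y ->
    (forall i, 0 <= y 0 i) -> ev y theta <= 1 ->
  (d = 1%N) \/ exists i (c : nat), theta i 0 = c%:R /\ (d %| c)%N.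
Proof.
move=> [sp od _] y0 yt.
have [/existsP[j yj]|ny] := boolP [exists j, 0 < y 0 j]; last first.
  left; apply/eqP; rewrite -dvdn1; apply: od => a _; rewrite evE big1 // => i _.
  rewrite (_ : y 0 i = 0) ?mul0r //; apply/eqP; rewrite eq_le y0 andbT leNgt.
  by apply: contraNN ny => h; apply/existsP; exists i.
have zero a i : positive a -> ev y a = 0 -> 0 < y 0 i -> a i 0 = 0.
  move=> pa; rewrite evE => /eqP; rewrite psumr_eq0; last by move=> k _; rewrite mulr_ge0.
  move=> /allP/(_ i (mem_index_enum i)) /=; rewrite mulf_eq0 => /orP[/eqP ->|/eqP //].
  by rewrite ltxx.
have signs z : (forall a, a \in Rt -> integral_on y a -> positive a -> ev z a = 0) -> z = 0.
  move=> h; apply: sp => a ra ya; have [pa|na] := root_sign base ra; first exact: h.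
  rewrite -[a]opprK evNr h ?oppr0 ?oppr_root //.
  by rewrite /integral_on evNr rpredN.
(* Otherwise the roots on which y is integral vanish at the node j. *)
have yt1 : ev y theta = 1.
  apply/eqP; apply: contraT => ne.
  have : delta_mx 0 j = 0 :> 'rV[rat]_n.
    apply: signs => a ra ya pa; rewrite ev_delta; apply: (zero _ _ pa _ yj).
    have [//|[_ e]] := integral_positive ra ya pa y0 yt.
    by rewrite e eqxx in ne.
  by move/rowP/(_ j); rewrite !mxE !eqxx => /eqP; rewrite oner_eq0.
(* With a second node i, the functional below vanishes on the roots a with
   y(a) = 0, and on those with y(a) = 1, which agree with theta at i and j. *)
have other i : i != j -> y 0 i = 0.
  move=> ij; apply/eqP; rewrite eq_le y0 andbT leNgt; apply/negP => yi.
  have : theta i 0 *: delta_mx 0 j - theta j 0 *: delta_mx 0 i = 0 :> 'rV[rat]_n.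
    apply: signs => a ra ya pa; rewrite evDl evNl !evZl !ev_delta.
    have [e|[e _]] := integral_positive ra ya pa y0 yt.
      by rewrite (zero a i) // (zero a j) // !mulr0 subrr.
    have pd : positive (theta - a) by move=> k; rewrite !mxE subr_ge0 theta_max.
    have z0 : ev y (theta - a) = 0 by rewrite evDr evNr e yt1 subrr.
    have := zero _ i pd z0 yi; have := zero _ j pd z0 yj; rewrite !mxE.
    by move=> /eqP; rewrite subr_eq0 => /eqP -> /eqP; rewrite subr_eq0 => /eqP ->; ring.
  move/rowP/(_ j); rewrite !mxE !eqxx eq_sym (negPf ij) mulr1 mulr0 subr0 => t0.
  by have := theta_ge1 i; rewrite t0 ler10.
right; exists j; have tj := theta_ge1 j.
have : theta j 0 \is a Num.nat.
  by rewrite natrEint (root_int base j theta_root) (le_trans ler01).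
move=> /natrP[c ec]; exists c; split=> //; apply: od => a ra.
have e1 : y 0 j * theta j 0 = 1.
  rewrite -yt1 evE (bigD1 j) //= big1 ?addr0 // => i ij.
  by rewrite other ?mul0r.
rewrite evE (bigD1 j) //= big1 ?addr0 => [|i ij]; last by rewrite other ?mul0r.
by rewrite -mulr_natr mulrAC -ec e1 mul1r (root_int base j ra).
Qed.

(** Moving y by the affine reflections in the walls of the alcove brings it
    closer to an interior point p of the alcove as long as it lies on the
    other side of some wall; the squared distances to p have a common
    denominator, so this stops. *)
Lemma affine_reflection_closer p y b k : b \in Rt ->
  form Phi (y - (ev y b - k) *: co b - p) (y - (ev y b - k) *: co b - p) =
  form Phi (y - p) (y - p) + form Phi (co b) (co b) * (ev y b - k) * (ev p b - k).
Proof.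
move=> rb; set x := ev y b - k.
have -> : y - x *: co b - p = (y - p) - x *: co b by rewrite addrAC.
have e : 2 * form Phi (co b) (y - p) = (x + k - ev p b) * form Phi (co b) (co b).
  by rewrite form_coroot // evDl evNl /x subrK.
rewrite formDl formNl formZl formDr formNr formZr (form_sym _ (y - p) (co b)).
rewrite [form _ (co b) (_ - _ *: _)]formDr formNr formZr.
by move: e; set f := form _ (co b) (y - p); nra.
Qed.

Lemma reach_alcove d N y : (0 < N)%N -> full_rank_functional d N y ->
  exists y', [/\ full_rank_functional d N y', forall i, 0 <= y' 0 i & ev y' theta <= 1].
Proof.
move=> N0; have pth : positive theta.
  by move=> i; rewrite (le_trans ler01) // theta_ge1.
have [H eH] := height_natural base theta_root pth.
have H1 : (H.+1%:R : rat) != 0 by rewrite pnatr_eq0.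
pose p : 'rV[rat]_n := const_mx (H.+1%:R^-1).
have pE a : ev p a = height a / H.+1%:R.
  by rewrite evE /height mulr_suml; apply: eq_bigr => i _; rewrite mxE mulrC.
pose D : rat := (N * H.+1)%N%:R.
have D0 : 0 < D by rewrite ltr0n muln_gt0 N0.
pose F z := form Phi (z - p) (z - p).
have Fnat z : full_rank_functional d N z -> exists m : nat, F z * D ^+ 2 = m%:R.
  move=> [_ _ h]; apply/natrP; rewrite natrEint mulr_ge0 ?form_ge0 ?sqr_ge0 // andbT.
  rewrite /F /form mulr_suml big_seq; apply: rpred_sum => a ra.
  have : ev (z - p) a * D \is a Num.int.
    rewrite evDl evNl pE mulrBl rpredB //.
      rewrite /D natrM mulrA rpredM ?natr_int // mulr_natr; exact: h.
    rewrite /D mulnC natrM mulrA divfK // rpredM ?natr_int //.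
    by apply: rpred_sum => i _; exact: (root_int base).
  by move=> hi; rewrite (_ : _ * _ * _ = (ev (z - p) a * D) ^+ 2) ?rpredX //; ring.
suff main (m : nat) z : full_rank_functional d N z -> F z * D ^+ 2 < m%:R ->
    exists y', [/\ full_rank_functional d N y', forall i, 0 <= y' 0 i & ev y' theta <= 1].
  move=> hy; have [m em] := Fnat y hy.
  by apply: (main m.+1 y) => //; rewrite em ltr_nat.
elim: m z => [|m IH] z hz hm.
  by move: hm; rewrite ltNge mulr_ge0 ?form_ge0 ?sqr_ge0.
have step z' : full_rank_functional d N z' -> F z' < F z ->
    exists y', [/\ full_rank_functional d N y', forall i, 0 <= y' 0 i & ev y' theta <= 1].
  move=> hz' lt; apply: IH hz' _; have [k ek] := Fnat z hz.
  have : F z' * D ^+ 2 < F z * D ^+ 2 by rewrite ltr_pM2r // exprn_gt0.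
  move: hm; rewrite ek ltr_nat ltnS => le lt'; apply: lt_le_trans lt' _.
  by rewrite ler_nat.
have [/existsP[i zi]|nz] := boolP [exists i, z 0 i < 0].
  apply: (step (coreflection Phi (al i) z)); first exact: full_rank_coreflection (base.1 i) hz.
  rewrite /F /coreflection -[ev z (al i)]subr0 affine_reflection_closer ?base.1 //.
  rewrite !subr0 gtrDl nmulr_rlt0.
    rewrite pE divr_gt0 ?ltr0n //; apply: (height_gt0 (base.1 i)) => j.
    by rewrite al_coord ler0n.
  by rewrite nmulr_llt0 ?ev_simple // form_coroot_gt0 // base.1.
have [zt|zt] := leP (ev z theta) 1.
  exists z; split=> // i; rewrite leNgt; apply: contraNN nz => h.
  by apply/existsP; exists i.
apply: (step (z - (ev z theta - 1) *: co theta)).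
  have -> : z - (ev z theta - 1) *: co theta = coreflection Phi theta z + 1%:~R *: co theta.
    by rewrite /coreflection scalerBl opprB scale1r addrCA addrC.
  by apply: full_rank_translate => //; exact: full_rank_coreflection.
rewrite /F affine_reflection_closer // gtrDl pmulr_rlt0.
  by rewrite pE eH subr_lt0 ltr_pdivrMr ?ltr0n // mul1r ltr_nat.
by rewrite mulr_gt0 ?form_coroot_gt0 // subr_gt0.
Qed.

Hypothesis n_gt0 : (0 < n)%N.

Lemma full_rank_span (S : {fset V}) : full_rank_subsystem Phi S -> (<<S>> = fullv)%VS.
Proof.
move=> [_ d]; apply/eqP; rewrite eqEsubv subvf /=.
by rewrite -dimv_leqif_sup ?subvf // d roots_span.
Qed.

(** The order divides the exponent d of the quotient, and d divides a coefficient
    by the position of the dual functional in the alcove. *)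
Lemma quotient_order_dvd k : quotient_orders Phi k ->
  k = 1%N \/ exists i (c : nat), theta i 0 = c%:R /\ (k %| c)%N.
Proof.
move=> [S [v [hS hv hk]]]; have sp := full_rank_span hS.
have sub a : a \in S -> a \in Rt by case: hS => -[/fsubsetP h _] _; exact: h.
have iR a : a \in Rt -> integral a by move=> ra i; exact: (root_int base).
have [d [y [d0 yS yd yN dv]]] := exponent_functional n_gt0 sp (fun a aS => iR a (sub a aS)).
have iv : integral v.
  move=> i; move: hv => [c ->]; rewrite summxE big_seq; apply: rpred_sum => a ra.
  by rewrite -scaler_int mxE rpredM ?intr_int // (root_int base)//.
have kd : (k %| d)%N by apply: coset_order_dvd hk _; exact: dv.
have frk : full_rank_functional d d y.
  split.
  - by move=> z hz; apply: (span_dual sp) => a aS; apply: hz; [exact: sub|exact: yS].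
  - by move=> j hj; apply: yd => i; rewrite -ev_simple; apply/hj/base.1.
  - move=> a ra; rewrite evE -sumrMnl; apply: rpred_sum => i _.
    by rewrite -mulrnAl rpredM // (root_int base)//.
have [y' [h1 h2 h3]] := reach_alcove d0 frk.
have [d1|[i [c [e dc]]]] := alcove_vertex h1 h2 h3.
  by left; apply/eqP; rewrite -dvdn1 -d1.
by right; exists i, c; split=> //; exact: dvdn_trans dc.
Qed.

End Alcove.

Section Orders.

Variables (n : nat) (Phi : root_system n).
Local Notation V := 'cV[rat]_n.
Local Notation Rt := (roots Phi).
Local Notation al := (@simple_root n).
Hypothesis base : standard_base Phi.
Hypothesis n_gt0 : (0 < n)%N.

(** The subsystem of the roots whose i-th coordinate is divisible by the
    coordinate k of gamma has full rank, and the i-th simple root has order k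
    modulo its lattice. *)
Lemma coefficient_order gamma i k : gamma \in Rt -> gamma i 0 = k%:R -> (0 < k)%N ->
  quotient_orders Phi k.
Proof.
move=> rg gi k0; have kn : (k%:R : rat) != 0 by rewrite pnatr_eq0 -lt0n.
pose S : {fset V} := [fset a in Rt | a i 0 / k%:R \is a Num.int]%fset.
have memS a : (a \in S) = (a \in Rt) && (a i 0 / k%:R \is a Num.int) by rewrite !inE.
have alS j : j != i -> al j \in S.
  by move=> ji; rewrite memS base.1 al_coord eq_sym (negPf ji) mul0r rpred0.
have gS : gamma \in S by rewrite memS rg gi divff // rpred1.
have subS : root_subsystem Phi S.
  split; first by apply/fsubsetP => a; rewrite memS => /andP[].
  move=> a b; rewrite !memS => /andP[ra ia] /andP[rb ib]; rewrite reflection_root //=.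
  rewrite /reflection mxE [X in _ + X]mxE [X in - X]mxE mulrBl rpredB // -mulrA rpredM //.
  exact: pairing_int.
have sp : (<<S>> = fullv)%VS.
  apply: span_full => j; have [->|/alS h] := eqVneq j i; last exact: memv_span.
  have -> : al i = k%:R^-1 *: (gamma - \sum_(l | l != i) gamma l 0 *: al l).
    rewrite {1}(col_sum gamma) (bigD1 i) //= addrK gi scalerA mulVf // scale1r //.
  apply/memvZ/rpredB; first exact: memv_span.
  by apply: memv_suml => l li; apply/memvZ/memv_span/alS.
exists S, (al i); split.
- by split=> //; rewrite sp roots_span.
- exact/lattice_mem/base.1.
split=> //.
  have -> : al i *+ k = gamma - \sum_(l | l != i) gamma l 0 *: al l.
    by rewrite {1}(col_sum gamma) (bigD1 i) //= addrK gi scaler_nat.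
  apply: latticeB; first exact: lattice_mem.
  apply: lattice_sum => l li; have /intrP[z ->] := root_int base l rg.
  by rewrite scaler_int; apply/latticeMz/lattice_mem/alS.
move=> j j0 [c ec].
have : (j%:R : rat) / k%:R \is a Num.int.
  have -> : (j%:R : rat) = (al i *+ j) i 0.
    by rewrite -scaler_nat mxE al_coord eqxx mulr1.
  rewrite ec summxE mulr_suml big_seq; apply: rpred_sum => a; rewrite memS => /andP[_ ia].
  by rewrite -scaler_int mxE -mulrA rpredM ?intr_int.
move=> /intrP[z ez]; have : (j%:R : rat) = z%:~R * k%:R by rewrite -ez divfK.
rewrite !pmulrn -intrM => /eqP; rewrite eqr_int => /eqP jE.
have z0 : 0 < z by nia.
nia.
Qed.

Lemma order_one : quotient_orders Phi 1.
Proof.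
have i : 'I_n := Ordinal n_gt0.
by apply: (@coefficient_order (al i) i) => //; rewrite ?base.1 // al_coord eqxx.
Qed.

(** The roots in the lattice spanned by a basis B of roots form a subsystem of
    full rank with the same lattice, so a common multiple of the orders
    multiplies the root lattice into the lattice of B. *)
Lemma orders_basis_lattice D M : (forall k, quotient_orders Phi k -> (k %| D)%N) ->
  M \in bases (enum_fset (positive_roots Phi)) ->
  forall i, exists w : 'I_n -> int, al i *+ D = \sum_j col j M *~ w j.
Proof.
move=> hD /basesP[uM cM] i.
have cR j : col j M \in Rt by have := cM j; rewrite positive_rootE => /andP[].
pose S : {fset V} := [fset a in Rt | [forall j, crd M a j \is a Num.int]]%fset.
have memS a : (a \in S) = (a \in Rt) && [forall j, crd M a j \is a Num.int] by rewrite !inE.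
have cS j : col j M \in S.
  by rewrite memS cR; apply/forallP => l; rewrite crd_col // natr_int.
have subS : root_subsystem Phi S.
  split; first by apply/fsubsetP => a; rewrite memS => /andP[].
  move=> a b; rewrite !memS => /andP[ra /forallP ia] /andP[rb /forallP ib].
  rewrite reflection_root //=; apply/forallP => j.
  by rewrite /reflection crdD crdN crdZ rpredB // rpredM // pairing_int.
have sp : (<<S>> = fullv)%VS.
  apply: span_full => j; rewrite (crd_sum uM (al j)).
  by apply: memv_suml => l _; apply/memvZ/memv_span.
have iR a : a \in Rt -> integral a by move=> ra l; exact: (root_int base).
have sub a : a \in S -> a \in Rt by rewrite memS => /andP[].
have [d [_ [d0 _ _ _ dv]]] := exponent_functional n_gt0 sp (fun a aS => iR a (sub a aS)).
have [k hk] := coset_order_exists d0 (dv _ (iR _ (base.1 i))).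
have kD : (k %| D)%N.
  apply: hD; exists S, (al i); split=> //; first by split=> //; rewrite sp roots_span.
  exact/lattice_mem/base.1.
have [c ec] : lattice S (al i *+ D).
  have [_ h _] := hk; have /dvdnP[q ->] := kD.
  by rewrite mulnC mulrnA; exact: latticeMn.
have /fin_all_exists[w hw] : forall j, exists z : int, crd M (al i *+ D) j = z%:~R.
  move=> j; apply/intrP; rewrite ec.
  have -> : crd M (\sum_(a <- S) a *~ c a) j = \sum_(a <- S) (c a)%:~R * crd M a j.
    rewrite /crd mulmx_sumr summxE; apply: eq_bigr => a _.
    by rewrite -scaler_int -scalemxAr mxE.
  rewrite big_seq; apply: rpred_sum => a; rewrite memS => /andP[_ /forallP ia].
  by rewrite rpredM ?intr_int.
exists w; rewrite {1}(crd_sum uM (al i *+ D)); apply: eq_bigr => j _.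
by rewrite hw scaler_int.
Qed.

End Orders.

(** * Roots in the numbering of the Dynkin diagram *)

Lemma dynkin_weight_neq0 X i j : (dynkin_weight X i j)%:Z != 0.
Proof. by case: X => //= *; case: ifP. Qed.

Section DiagramCoordinates.

Variables (X : dynkin_type) (Phi : root_system (dynkin_rank X)).
Local Notation N := (dynkin_rank X).
Local Notation V := 'cV[rat]_N.
Local Notation Rt := (roots Phi).
Local Notation al := (@simple_root N).
Hypothesis base : standard_base Phi.
Hypothesis red : reduced Phi.
Variable s : {perm 'I_N}.
Hypothesis hs : forall i j,
  pairing Phi (al (s i)) (al (s j)) = (cartan_entry X i j)%:~R.

(** The coefficients of a vector in the numbering of the Dynkin diagram, as a
    function on all natural numbers, which avoids ordinals in the computations
    with neighbouring nodes. *)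
Definition cf (a : V) : nat -> rat := fun k =>
  oapp (fun i : 'I_N => a (s i) 0) 0 (insub k).

Lemma cf_ord a (i : 'I_N) : cf a i = a (s i) 0.
Proof. by rewrite /cf valK. Qed.

Lemma cf_large a k : (N <= k)%N -> cf a k = 0.
Proof. by move=> h; rewrite /cf insubF // ltnNge h. Qed.

Definition cartan_sum (c : nat -> rat) j : rat :=
  \sum_(l < N) c l * (cartan_entry X l j)%:~R.

Definition reflect (c : nat -> rat) j : nat -> rat := fun k =>
  if k == j then c k - cartan_sum c j else c k.

Lemma cf_simple (j : 'I_N) : cf (al (s j)) = fun k => (k == j :> nat)%:R.
Proof.
apply/funext => k; have [lt|ge] := ltnP k N.
  by rewrite -[k]/(nat_of_ord (Ordinal lt)) cf_ord al_coord (inj_eq perm_inj).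
by rewrite cf_large // (_ : (k == j) = false) //; apply/negbTE; rewrite neq_ltn (leq_trans (ltn_ord j) ge) orbT.
Qed.

Lemma cf_reflection (j : 'I_N) a : cf (reflection Phi (al (s j)) a) = reflect (cf a) j.
Proof.
have E : pairing Phi a (al (s j)) = cartan_sum (cf a) j.
  rewrite pairing_sum (reindex_inj (perm_inj (s := s))); apply: eq_bigr => l _.
  by rewrite hs cf_ord.
apply/funext => k; have [lt|ge] := ltnP k N.
  rewrite -[k]/(nat_of_ord (Ordinal lt)) /reflect !cf_ord reflection_coord E (inj_eq perm_inj).
  by rewrite -val_eqE /=; case: eqP => _; rewrite ?mulr1 ?mulr0 ?subr0.
rewrite /reflect !cf_large // (_ : (k == j) = false) //.
by apply/negbTE; rewrite neq_ltn (leq_trans (ltn_ord j) ge) orbT.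
Qed.

(** Properties of the coefficients of positive roots may be proved on the diagram
    alone, from the simple roots and their reflections. *)
Lemma cf_induction (Q : (nat -> rat) -> Prop) :
    (forall j, (j < N)%N -> Q (fun k => (k == j)%:R)) ->
    (forall j c, (j < N)%N -> (forall k, (N <= k)%N -> c k = 0) -> Q c -> Q (reflect c j)) ->
  forall a, a \in Rt -> positive a -> Q (cf a).
Proof.
move=> Q0 QS; apply: (root_induction base red (P := fun a => Q (cf a))) => [i|i a ra qa].
  by rewrite -(permKV s i) cf_simple; exact/Q0/ltn_ord.
rewrite -(permKV s i) cf_reflection; apply: QS => //; exact: cf_large.
Qed.

Definition diagram_root (c : nat -> rat) := exists2 a, a \in Rt & cf a = c.

Lemma diagram_root_simple j : (j < N)%N -> diagram_root (fun k => (k == j)%:R).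
Proof. by move=> lt; exists (al (s (Ordinal lt))); [exact: base.1|rewrite cf_simple]. Qed.

Lemma diagram_root_reflect c j : (j < N)%N -> diagram_root c -> diagram_root (reflect c j).
Proof.
move=> lt [a ra <-]; exists (reflection Phi (al (s (Ordinal lt))) a).
  by apply: reflection_root => //; exact: base.1.
by rewrite cf_reflection.
Qed.

Lemma diagram_root_order c i k : diagram_root c -> (i < N)%N -> c i = k%:R -> (0 < k)%N ->
  quotient_orders Phi k.
Proof.
move=> [a ra <-] lt e k0; apply: (coefficient_order base (leq_ltn_trans (leq0n i) lt) ra _ k0 (i := s (Ordinal lt))).
by rewrite -cf_ord.
Qed.

Lemma edge_cartan_neq0 (i j : 'I_N) : i != j ->
  dynkin_edge X i j || dynkin_edge X j i -> pairing Phi (al (s i)) (al (s j)) != 0.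
Proof.
move=> ij e; rewrite hs intr_eq0 /cartan_entry (_ : (i == j :> nat) = false) ?e; last exact: negbTE.
by rewrite oppr_eq0; exact: dynkin_weight_neq0.
Qed.

Lemma connected_of_diagram :
  (forall q : nat -> bool,
     (forall k l, (k < N)%N -> (l < N)%N -> k != l -> dynkin_edge X k l -> q k = q l) ->
     forall k, (k < N)%N -> q k = q 0%N) ->
  connected Phi.
Proof.
move=> H P hP.
pose q k := oapp (fun i : 'I_N => P (s i)) false (insub k).
have qE (i : 'I_N) : q i = P (s i) by rewrite /q valK.
have hq k l : (k < N)%N -> (l < N)%N -> k != l -> dynkin_edge X k l -> q k = q l.
  move=> lk ll kl e; rewrite -[k]/(nat_of_ord (Ordinal lk)) -[l]/(nat_of_ord (Ordinal ll)) !qE.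
  have kl' : Ordinal lk != Ordinal ll by [].
  have lk' : Ordinal ll != Ordinal lk by rewrite eq_sym.
  apply/idP/idP; apply: hP; first by apply: edge_cartan_neq0 => //; rewrite e orbT.
  by apply: edge_cartan_neq0 => //; rewrite e.
move=> i j; rewrite -(permKV s i) -(permKV s j) -!qE.
by rewrite (H q hq _ (ltn_ord _)) (H q hq _ (ltn_ord ((s^-1)%g i))).
Qed.

End DiagramCoordinates.

(** * Coefficients of roots: classical types *)

(** Evaluates the tests on node numbers whose outcome follows from the context. *)
Ltac decide_nat := repeat match goal with
  | |- context [ @eq_op _ ?a ?b ] =>
      first [ rewrite (_ : (a == b) = true); last by lia
            | rewrite (_ : (a == b) = false); last by lia ]
  | |- context [ leq ?a ?b ] =>
      first [ rewrite (_ : leq a b = true); last by lia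
            | rewrite (_ : leq a b = false); last by lia ]
  end; rewrite ?andbF.

Section CartanSums.

Implicit Types (c : nat -> rat).

Lemma sum_support (F : nat -> rat) (nb : seq nat) N : uniq nb -> all (gtn N) nb ->
  (forall l, (l < N)%N -> l \notin nb -> F l = 0) -> \sum_(l < N) F l = \sum_(l <- nb) F l.
Proof.
move=> unb lnb h; rewrite -(big_mkord xpredT F) (bigID (mem nb)) /= [X in _ + X]big_nat_cond.
rewrite [X in _ + X]big1 ?addr0 => [|l /andP[/andP[_ hl] hn]]; last exact: h.
rewrite -big_filter; apply: perm_big; apply: uniq_perm; rewrite ?filter_uniq ?iota_uniq // => l.
rewrite mem_filter mem_index_iota /=; case: (boolP (l \in nb)) => //= hl.
exact: (allP lnb).
Qed.

Definition prev c j : rat := if j is j'.+1 then c j' else 0.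

Lemma cartan_entry_diag X j : cartan_entry X j j = 2.
Proof. by rewrite /cartan_entry eqxx. Qed.

Lemma cartan_sum_support X c (nb : seq nat) j :
    uniq nb -> all (gtn (dynkin_rank X).+1) nb -> (forall k, (dynkin_rank X <= k)%N -> c k = 0) ->
    (forall l, (l < dynkin_rank X)%N -> l \notin nb -> cartan_entry X l j = 0) ->
  cartan_sum X c j = \sum_(l <- nb) c l * (cartan_entry X l j)%:~R.
Proof.
move=> unb lnb c0 h; rewrite -(sum_support (N := (dynkin_rank X).+1) unb lnb).
  by rewrite big_ord_recr /= c0 // mul0r addr0.
move=> l; rewrite ltnS leq_eqVlt => /orP[/eqP ->|hl] hn; first by rewrite c0 // mul0r.
by rewrite h // mulr0.
Qed.

Lemma cartan_sum_chain X c j : (j < dynkin_rank X)%N ->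
    (forall k, (dynkin_rank X <= k)%N -> c k = 0) ->
    (forall l, (l < dynkin_rank X)%N -> l != j -> l.+1 != j -> l != j.+1 -> cartan_entry X l j = 0) ->
  cartan_sum X c j = 2 * c j + prev c j * (cartan_entry X j.-1 j)%:~R
     + c j.+1 * (cartan_entry X j.+1 j)%:~R.
Proof.
move=> lj c0 h; case: j lj h => [|j] lj h.
  rewrite (@cartan_sum_support X c [:: 0%N; 1%N] 0%N) //.
  - by rewrite !big_cons big_nil cartan_entry_diag mul0r !addr0 mulrC.
  - by rewrite /= andbT; lia.
  - by move=> l hl; rewrite !inE => hn; apply: h => //; lia.
rewrite (@cartan_sum_support X c [:: j.+1; j; j.+2] j.+1) //.
- by rewrite !big_cons big_nil cartan_entry_diag addr0 mulrC /= addrA.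
- by rewrite /= !inE; lia.
- by rewrite /= andbT; lia.
- by move=> l hl; rewrite !inE => hn; apply: h => //; lia.
Qed.

Definition l1 (m : nat) (x : nat -> rat) : rat := \sum_(k < m) `|x k|.

Lemma l1_split m x j (lj : (j < m)%N) (lj1 : (j.+1 < m)%N) :
  l1 m x = `|x j| + (`|x j.+1| + \sum_(k < m | (k != Ordinal lj) && (k != Ordinal lj1)) `|x k|).
Proof.
have ne : Ordinal lj1 != Ordinal lj by rewrite -val_eqE /=; lia.
by rewrite /l1 (bigD1 (Ordinal lj)) //=; congr (_ + _); rewrite (bigD1 (Ordinal lj1)).
Qed.

Lemma l1_swap m x x' j : (j.+1 < m)%N ->
    (forall k, (k < m)%N -> k != j -> k != j.+1 -> `|x' k| = `|x k|) ->
    `|x' j| = `|x j.+1| -> `|x' j.+1| = `|x j| -> l1 m x' = l1 m x.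
Proof.
move=> lj h h1 h2; have lj' : (j < m)%N by exact: ltnW.
rewrite !(l1_split _ lj' lj) h1 h2 addrCA; congr (_ + (_ + _)).
by apply: eq_bigr => k /andP[k1 k2]; exact: h.
Qed.

Lemma l1_ext m x x' : (forall k, (k < m)%N -> `|x' k| = `|x k|) -> l1 m x' = l1 m x.
Proof. by move=> h; apply: eq_bigr => k _; exact: h. Qed.

Lemma l1_delta m (x : nat -> rat) j : (j < m)%N -> (forall k, (k < m)%N -> k != j -> x k = 0) ->
  l1 m x = `|x j|.
Proof.
move=> lj h; rewrite /l1 (bigD1 (Ordinal lj)) //= big1 ?addr0 // => k kj.
by rewrite h ?normr0.
Qed.

Lemma l1_delta2 m (x : nat -> rat) j : (j.+1 < m)%N ->
  (forall k, (k < m)%N -> k != j -> k != j.+1 -> x k = 0) -> l1 m x = `|x j| + `|x j.+1|.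
Proof.
move=> lj h; have lj' : (j < m)%N by exact: ltnW.
rewrite (l1_split _ lj' lj) big1 ?addr0 // => k /andP[k1 k2].
by rewrite h ?normr0.
Qed.

Lemma l1S m x : l1 m.+1 x = l1 m x + `|x m|.
Proof. exact: big_ord_recr. Qed.

Lemma l1_le m m' x : (m <= m')%N -> l1 m x <= l1 m' x.
Proof.
move=> /subnK <-; elim: (m' - m)%N => [|k IH] //.
by rewrite addSn l1S (le_trans IH) // lerDl.
Qed.

Lemma telescope_le c x K : (forall k, (k <= K)%N -> x k = c k - prev c k) ->
  `|c K| <= l1 K.+1 x.
Proof.
elim: K => [|K IH] h; rewrite l1S; first by rewrite /l1 big_ord0 add0r h // subr0.
have := IH (fun k hk => h k (leq_trans hk (leqnSn K))).
rewrite (h K.+1) //= => hK; apply: le_trans (lerD hK (lexx _)).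
by rewrite -[c K.+1 in X in X <= _](subrKC (c K)) ler_normD.
Qed.

End CartanSums.

Section Families.

Implicit Types (c : nat -> rat).

(** The coordinates in the usual realizations, where the simple roots are
    e_k - e_(k+1), and e_n, 2 e_n or e_(n-1) + e_n at the end for types B, C, D.
    Simple reflections permute these coordinates up to sign. *)
Definition coord_AB c k : rat := c k - prev c k.
Definition coord_C n c k : rat := (if k == n.-1 then 2 else 1) * c k - prev c k.
Definition coord_D n c k : rat :=
  if k == n.-1 then c n.-1 - c n.-2
  else if k == n.-2 then c n.-2 + c n.-1 - prev c n.-2 else c k - prev c k.

Definition family_norm X c : rat :=
  match X with
  | TypeA n => l1 n.+1 (coord_AB c)
  | TypeB n => l1 n (coord_AB c)
  | TypeC n => l1 n (coord_C n c)
  | TypeD n => l1 n (coord_D n c)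
  | _ => 0
  end.

Lemma prev_reflect X c j k : k != j.+1 -> prev (reflect X c j) k = prev c k.
Proof. by case: k => //= k; rewrite eqSS /reflect => /negPf ->. Qed.

Lemma prev_delta j k : prev (fun l => (l == j)%:R) k = (k == j.+1)%:R.
Proof. by case: k => //= k; rewrite eqSS. Qed.

Lemma norm_A n c j : (j < n)%N -> (forall k, (n <= k)%N -> c k = 0) ->
  family_norm (TypeA n) (reflect (TypeA n) c j) = family_norm (TypeA n) c.
Proof.
move=> lj c0; have E : cartan_sum (TypeA n) c j = 2 * c j - prev c j - c j.+1.
  rewrite cartan_sum_chain //; last by move=> l /= *; rewrite /cartan_entry /=; decide_nat.
  case: j lj => [|j] lj; rewrite /cartan_entry /=; decide_nat; rewrite /= ?mul0r; ring.
rewrite /=; apply: (@l1_swap _ _ _ j) => //.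
- move=> k _ k1 k2; rewrite /coord_AB prev_reflect // /reflect (negPf k1) //.
- rewrite /coord_AB prev_reflect /reflect ?eqxx /=; last by lia.
  by rewrite E; congr `|_|; ring.
- rewrite /coord_AB /reflect /=; decide_nat; rewrite E; congr `|_|; ring.
Qed.

Lemma norm_B m c j (n := m.+2) : (j < n)%N -> (forall k, (n <= k)%N -> c k = 0) ->
  family_norm (TypeB n) (reflect (TypeB n) c j) = family_norm (TypeB n) c.
Proof.
rewrite {}/n => lj c0.
have E : cartan_sum (TypeB m.+2) c j =
    2 * c j - (if j == m.+1 then 2 else 1) * prev c j - c j.+1.
  rewrite cartan_sum_chain //; last by move=> l /= *; rewrite /cartan_entry /=; decide_nat.
  case: j lj => [|j] lj; rewrite /cartan_entry /=; first by decide_nat; rewrite /=; ring.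
  by have [->|ne] := eqVneq j m; decide_nat; rewrite /=; ring.
have [jE|jE] := eqVneq j m.+1.
  apply: l1_ext => k kn; rewrite /coord_AB prev_reflect /reflect; last by lia.
  have [->|//] := eqVneq k j; rewrite -normrN E jE eqxx (c0 m.+2) //; congr `|_|; ring.
apply: (@l1_swap _ _ _ j) => //; first by lia.
- by move=> k _ k1 k2; rewrite /coord_AB prev_reflect // /reflect (negPf k1).
- rewrite /coord_AB prev_reflect /reflect ?eqxx /=; last by lia.
  by rewrite E (negPf jE); congr `|_|; ring.
- by rewrite /coord_AB /reflect /=; decide_nat; rewrite E (negPf jE); congr `|_|; ring.
Qed.

Lemma norm_C m c j (n := m.+2) : (j < n)%N -> (forall k, (n <= k)%N -> c k = 0) ->
  family_norm (TypeC n) (reflect (TypeC n) c j) = family_norm (TypeC n) c.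
Proof.
rewrite {}/n => lj c0.
have E : cartan_sum (TypeC m.+2) c j =
    2 * c j - prev c j - (if j == m then 2 else 1) * c j.+1.
  rewrite cartan_sum_chain //; last by move=> l /= *; rewrite /cartan_entry /=; decide_nat.
  rewrite /cartan_entry /=; have [->|ne] := eqVneq j m.
    by case: (m) => [|m'] /=; decide_nat; rewrite /=; ring.
  by case: j lj ne => [|j] lj ne /=; decide_nat; rewrite /=; ring.
have [jE|jE] := eqVneq j m.+1.
  apply: l1_ext => k kn; rewrite /coord_C prev_reflect /reflect; last by lia.
  have [->|//] := eqVneq k j; rewrite -normrN E jE (c0 m.+2) //; decide_nat; congr `|_|; ring.
apply: (@l1_swap _ _ _ j) => //; first by lia.
- by move=> k _ k1 k2; rewrite /coord_C prev_reflect // /reflect (negPf k1).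
- rewrite /coord_C prev_reflect /reflect ?eqxx /=; last by lia.
  by rewrite E; have [jm|jm] := eqVneq j m; decide_nat; congr `|_|; ring.
- rewrite /coord_C /reflect /=; rewrite E.
  by have [jm|jm] := eqVneq j m; decide_nat; congr `|_|; ring.
Qed.

Lemma cartan_sum_D m c j (n := m.+4) : (j < n)%N -> (forall k, (n <= k)%N -> c k = 0) ->
  cartan_sum (TypeD n) c j =
    if j == m.+3 then 2 * c m.+3 - c m.+1
    else if j == m.+2 then 2 * c m.+2 - c m.+1
    else if j == m.+1 then 2 * c m.+1 - c m - c m.+2 - c m.+3
    else 2 * c j - prev c j - c j.+1.
Proof.
rewrite {}/n => lj c0.
have [->|j3] := eqVneq j m.+3.
  rewrite (@cartan_sum_support (TypeD m.+4) c [:: m.+3; m.+1] m.+3) //.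
  - by rewrite !big_cons big_nil cartan_entry_diag /cartan_entry /= ; decide_nat; rewrite /=; ring.
  - by rewrite /= !inE; lia.
  - by rewrite /= andbT; lia.
  - by move=> l /= hl; rewrite !inE => hn; rewrite /cartan_entry /=; decide_nat.
have [->|j2] := eqVneq j m.+2.
  rewrite (@cartan_sum_support (TypeD m.+4) c [:: m.+2; m.+1] m.+2) //.
  - by rewrite !big_cons big_nil cartan_entry_diag /cartan_entry /= ; decide_nat; rewrite /=; ring.
  - by rewrite /= !inE; lia.
  - by rewrite /= andbT; lia.
  - move=> l /= hl; rewrite !inE => hn; have [el|l3] := eqVneq l m.+3; rewrite /cartan_entry /=; by decide_nat.
have [->|j1] := eqVneq j m.+1.
  rewrite (@cartan_sum_support (TypeD m.+4) c [:: m.+1; m; m.+2; m.+3] m.+1) //.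
  - by rewrite !big_cons big_nil cartan_entry_diag /cartan_entry /= ; decide_nat; rewrite /=; ring.
  - by rewrite /= !inE; lia.
  - by rewrite /= andbT; lia.
  - by move=> l /= hl; rewrite !inE => hn; rewrite /cartan_entry /=; decide_nat.
rewrite cartan_sum_chain //; last by move=> l /= *; rewrite /cartan_entry /=; decide_nat.
by case: j lj j1 j2 j3 => [|j] *; rewrite /cartan_entry /=; decide_nat; rewrite /=; ring.
Qed.

Lemma norm_D m c j (n := m.+4) : (j < n)%N -> (forall k, (n <= k)%N -> c k = 0) ->
  family_norm (TypeD n) (reflect (TypeD n) c j) = family_norm (TypeD n) c.
Proof.
rewrite {}/n => lj c0; have E := cartan_sum_D lj c0.
pose j' := if j == m.+3 then m.+2 else j.
apply: (@l1_swap _ _ _ j').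
- by rewrite /j'; case: (eqVneq j m.+3) => /= *; lia.
- move=> k kn; rewrite /j' => k1 k2; rewrite /coord_D /=.
  have [k3|k3] := eqVneq k m.+3.
    have jj : (j < m.+2)%N by move: k1 k2; case: (eqVneq j m.+3) => /= *; lia.
    by rewrite /reflect; decide_nat.
  have [k4|k4] := eqVneq k m.+2.
    have jj : (j < m.+1)%N by move: k1 k2; case: (eqVneq j m.+3) => /= *; lia.
    by rewrite /reflect /=; decide_nat.
  rewrite prev_reflect /reflect; last by move: k1 k2; case: (eqVneq j m.+3) => /= *; lia.
  by rewrite (_ : (k == j) = false) //; move: k1 k2; case: (eqVneq j m.+3) => /= *; lia.
- rewrite /j'; have [j3|j3] := eqVneq j m.+3.
    by rewrite /coord_D /reflect /= E; decide_nat; rewrite -normrN /=; congr `|_|; ring.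
  have [j2|j2] := eqVneq j m.+2.
    by rewrite /coord_D /reflect /= E j2; decide_nat; rewrite /=; congr `|_|; ring.
  have [j1|j1] := eqVneq j m.+1.
    by rewrite /coord_D /reflect /= E j1 /=; decide_nat; rewrite /=; congr `|_|; ring.
  rewrite /coord_D; decide_nat; rewrite prev_reflect; last by lia.
  by rewrite /reflect E; decide_nat; rewrite /=; congr `|_|; ring.
- rewrite /j'; have [j3|j3] := eqVneq j m.+3.
    by rewrite /coord_D /reflect /= E; decide_nat; rewrite -normrN /=; congr `|_|; ring.
  have [j2|j2] := eqVneq j m.+2.
    by rewrite /coord_D /reflect /= E j2; decide_nat; rewrite /=; congr `|_|; ring.
  have [j1|j1] := eqVneq j m.+1.
    by rewrite /coord_D /reflect /= E j1 /=; decide_nat; rewrite /=; congr `|_|; ring.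
  rewrite /coord_D; decide_nat; rewrite [prev _ j.+1]/= /reflect E; decide_nat.
  by rewrite /=; congr `|_|; ring.
Qed.

(** The types that form infinite series. *)
Definition family X :=
  match X with TypeA _ | TypeB _ | TypeC _ | TypeD _ => true | _ => false end.

Lemma family_norm_reflect X c j : family X -> dynkin_valid X -> (j < dynkin_rank X)%N ->
  (forall k, (dynkin_rank X <= k)%N -> c k = 0) ->
  family_norm X (reflect X c j) = family_norm X c.
Proof.
case: X => // n _ /=; first by move=> _; exact: norm_A.
- by case: n => [|[|m]] // _; exact: norm_B.
- by case: n => [|[|m]] // _; exact: norm_C.
- by case: n => [|[|[|[|m]]]] // _; exact: norm_D.
Qed.

Lemma family_norm_simple X j : family X -> dynkin_valid X -> (j < dynkin_rank X)%N ->
  family_norm X (fun k => (k == j)%:R) <= 2.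
Proof.
case: X => // n _ /= hn lj.
- rewrite (l1_delta2 (j := j)) //.
    by rewrite /coord_AB !prev_delta; decide_nat; rewrite /= ?subr0 ?sub0r ?normrN !normr1.
  by move=> k _ *; rewrite /coord_AB prev_delta; decide_nat; rewrite subr0.
- have [jn|jn] := eqVneq j n.-1.
    rewrite (l1_delta (j := j)) //.
      by rewrite /coord_AB prev_delta; decide_nat; rewrite subr0 normr1.
    by move=> k *; rewrite /coord_AB prev_delta; decide_nat; rewrite subr0.
  rewrite (l1_delta2 (j := j)); last 2 first.
  + by lia.
  + by move=> k _ *; rewrite /coord_AB prev_delta; decide_nat; rewrite subr0.
  by rewrite /coord_AB !prev_delta; decide_nat; rewrite /= ?subr0 ?sub0r ?normrN !normr1.
- have [jn|jn] := eqVneq j n.-1.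
    rewrite (l1_delta (j := j)) //.
      by rewrite /coord_C prev_delta; decide_nat; rewrite subr0 mulr1 ger0_norm.
    by move=> k *; rewrite /coord_C prev_delta; decide_nat; rewrite mulr0 subr0.
  rewrite (l1_delta2 (j := j)); last 2 first.
  + by lia.
  + by move=> k _ *; rewrite /coord_C prev_delta; decide_nat; rewrite mulr0 subr0.
  rewrite /coord_C !prev_delta; decide_nat.
  by rewrite /= ?mulr0 ?mul1r ?subr0 ?sub0r ?normrN !normr1.
- case: n hn lj => [|[|[|[|m]]]] // _ lj.
  pose j' := if j == m.+3 then m.+2 else j.
  rewrite (l1_delta2 (j := j')); last 2 first.
  + by rewrite /j'; case: (eqVneq j m.+3) => /= *; lia.
  + move=> k kn; rewrite /j' => k1 k2; rewrite /coord_D !prev_delta /=.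
    have [k3|k3] := eqVneq k m.+3.
      have jj : (j < m.+2)%N by move: k1 k2; case: (eqVneq j m.+3) => /= *; lia.
      by decide_nat; rewrite /= ?mulr0n ?addr0 ?subr0.
    have [k4|k4] := eqVneq k m.+2.
      have jj : (j < m.+1)%N by move: k1 k2; case: (eqVneq j m.+3) => /= *; lia.
      by decide_nat; rewrite /= ?mulr0n ?addr0 ?subr0.
    have [kj kj1] : k != j /\ k != j.+1 by move: k1 k2; case: (eqVneq j m.+3) => /= *; lia.
    by decide_nat; rewrite /= ?mulr0n ?addr0 ?subr0.
  rewrite /j' /coord_D /=; have [j3|j3] := eqVneq j m.+3.
    by decide_nat; rewrite /= !subr0 ?add0r ?addr0 ?sub0r ?normrN !normr1.
  have [j2|j2] := eqVneq j m.+2.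
    by decide_nat; rewrite /= ?subr0 ?add0r ?addr0 ?sub0r ?normrN !normr1.
  have [j1|j1] := eqVneq j m.+1.
    by rewrite !prev_delta; decide_nat; rewrite /= ?subr0 ?add0r ?addr0 ?sub0r ?normrN !normr1.
  by rewrite !prev_delta; decide_nat; rewrite /= ?subr0 ?add0r ?addr0 ?sub0r ?normrN !normr1.
Qed.

(** The largest coefficient of the highest root. *)
Definition max_coefficient X : nat :=
  match X with
  | TypeA _ => 1 | TypeB _ | TypeC _ | TypeD _ => 2
  | TypeE6 => 3 | TypeE7 => 4 | TypeE8 => 6 | TypeF4 => 4 | TypeG2 => 3
  end.

(** Walking from k to the end of the diagram costs at least the coefficient at k
    in l1 norm; in type A the coefficient beyond the end is zero, which halves
    the bound. *)
Lemma tail_le n c k d : (k + d < n.+1)%N ->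
  `|c k| + l1 k.+1 (coord_AB c) <= `|c (k + d)%N| + l1 (k + d).+1 (coord_AB c).
Proof.
elim: d => [|d IH] h; first by rewrite addn0.
apply: le_trans (IH _) _; first by lia.
rewrite addnS (l1S (k + d).+1) [coord_AB c (k + d).+1]/coord_AB /=.
have := ler_normD (c (k + d).+1) (- (c (k + d).+1 - c (k + d)%N)).
by rewrite normrN opprB subrKC; lra.
Qed.

(** The coefficient at k is the sum of the coordinates up to k, hence bounded by
    the l1 norm; type A and the last nodes of types C and D gain a factor 2 from
    the remaining coordinates. *)
Lemma family_bound X c k : family X -> dynkin_valid X -> (k < dynkin_rank X)%N ->
  (forall l, (dynkin_rank X <= l)%N -> c l = 0) ->
  family_norm X c <= 2 -> c k <= (max_coefficient X)%:R.
Proof.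
case: X => // n _ /= hn lk c0 hc.
- have h1 : `|c k| + l1 k.+1 (coord_AB c) <= l1 n.+1 (coord_AB c).
    have := @tail_le n c k (n - k); rewrite subnKC ?(ltnW lk) // (c0 n) // normr0 add0r.
    by apply; exact: ltnSn.
  have h2 := @telescope_le c (coord_AB c) k (fun _ _ => erefl).
  by have := ler_norm (c k); lra.
- apply: le_trans (ler_norm _) _; apply: le_trans (@telescope_le c (coord_AB c) k (fun _ _ => erefl)) _.
  exact: le_trans (l1_le _ lk) hc.
- apply: le_trans (ler_norm _) _; have [kn|kn] := eqVneq k n.-1; last first.
    apply: le_trans (@telescope_le c (coord_C n c) k _) _.
      by move=> l lk'; rewrite /coord_C; decide_nat; rewrite mul1r.
    exact: le_trans (l1_le _ lk) hc.
  case: n hn lk c0 hc kn => [|[|m]] // _ lk c0 hc /= ->.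
  move: hc; rewrite l1S.
  have := @telescope_le c (coord_C m.+2 c) m _.
  move=> /(_ _) h hc; have {}h : `|c m| <= l1 m.+1 (coord_C m.+2 c).
    by apply: h => l lk'; rewrite /coord_C /=; decide_nat; rewrite mul1r.
  move: hc; rewrite /coord_C /= eqxx => hc.
  have := ler_normD (2 * c m.+1 - c m) (c m); rewrite subrK normrM ger0_norm //.
  have := normr_ge0 (c m.+1); lra.
- apply: le_trans (ler_norm _) _; case: n hn lk c0 hc => [|[|[|[|m]]]] // _ lk c0 hc.
  have low l : (l <= m.+1)%N -> `|c l| <= l1 l.+1 (coord_D m.+4 c).
    move=> lm; apply: telescope_le => i il; rewrite /coord_D /=; decide_nat; by [].
  have [km|km] := leqP k m.+1; first by apply: le_trans (low k km) _; apply: le_trans (l1_le _ lk) hc.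
  have e2 : coord_D m.+4 c m.+2 = c m.+2 + c m.+3 - c m.+1 by rewrite /coord_D /=; decide_nat.
  have e3 : coord_D m.+4 c m.+3 = c m.+3 - c m.+2 by rewrite /coord_D /=; decide_nat.
  move: hc; rewrite (l1S m.+3) (l1S m.+2) e2 e3; have := low m.+1 (leqnn _).
  move: (l1 _ _) => L h1 h2.
  have hy := ler_normD (c m.+2 + c m.+3 - c m.+1) (c m.+1); rewrite subrK in hy.
  have hk : k = m.+2 \/ k = m.+3 by lia.
  have hz : `|c m.+2 + c m.+3| + `|c m.+3 - c m.+2| <= 2 by lra.
  case: hk => ->.
    have e : 2 * c m.+2 = (c m.+2 + c m.+3) - (c m.+3 - c m.+2) by ring.
    have : `|2 * c m.+2| <= 2 by rewrite e (le_trans (ler_normB _ _)).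
    by rewrite normrM ger0_norm //; have := normr_ge0 (c m.+2); lra.
  have e : 2 * c m.+3 = (c m.+2 + c m.+3) + (c m.+3 - c m.+2) by ring.
  have : `|2 * c m.+3| <= 2 by rewrite e (le_trans (ler_normD _ _)).
  by rewrite normrM ger0_norm //; have := normr_ge0 (c m.+3); lra.
Qed.

End Families.

(** * Coefficients of roots: exceptional types *)

Section Exceptional.

Variable X : dynkin_type.
Local Notation N := (dynkin_rank X).
Implicit Types (t : seq int) (T F : seq (seq int)).

(** Vectors are lists of integers here, so that the enumeration can be carried
    out by computation. *)
Definition row_reflect t j : seq int :=
  set_nth 0 t j (t`_j - foldr (fun l acc => t`_l * cartan_entry X l j + acc) 0 (iota 0 N)).

Definition simple_row j : seq int := [seq (k == j)%:Z | k <- iota 0 N].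

(** Breadth-first closure under simple reflections: F holds the vectors found in
    the last round. *)
Fixpoint grow fuel T F : seq (seq int) :=
  if fuel is f.+1 then
    let F' := undup [seq t <- [seq row_reflect t j | t <- F, j <- iota 0 N] | t \notin T] in
    grow f (F' ++ T) F'
  else T.

(* The fuel exceeds the number of generations needed for any exceptional type. *)
Definition root_rows : seq (seq int) :=
  let S := [seq simple_row j | j <- iota 0 N] in grow 40 S S.

(** Closure of T under simple reflections is tested on the result, so that the
    bounds hold for all roots whatever the fuel. *)
Definition rows_bounded (T : seq (seq int)) : bool :=
  [&& all (fun j => simple_row j \in T) (iota 0 N),
      all (fun t => all (fun j => row_reflect t j \in T) (iota 0 N)) T,
      all (fun t => all (fun k => t`_k <= (max_coefficient X)%:Z) (iota 0 N)) T &
      all (fun k => (0 < k)%N && has (fun t => has (fun i => t`_i == k%:Z) (iota 0 N)) T)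
        (dynkin_orders X)].

Definition row_fun t : nat -> rat := fun k => if (k < N)%N then (t`_k)%:~R else 0.

Lemma row_fun_simple j : row_fun (simple_row j) = fun k => ((k < N)%N && (k == j))%:R.
Proof.
apply/funext => k; rewrite /row_fun; case: ltnP => // kN.
by rewrite (nth_map 0%N) ?size_iota // nth_iota // add0n -pmulrn.
Qed.

Lemma row_fun_reflect t j : (j < N)%N -> reflect X (row_fun t) j = row_fun (row_reflect t j).
Proof.
move=> lj; apply/funext => k; rewrite /reflect /row_fun nth_set_nth /=.
case: ltnP => kN; last by rewrite (_ : (k == j) = false) //; lia.
case: eqP => [->|//]; rewrite intrB; congr (_ - _).
have foldE (f : nat -> int) r : (foldr (fun l acc => f l + acc) 0 r)%:~R = \sum_(l <- r) (f l)%:~R :> rat.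
  by elim: r => [|l r IH] /=; rewrite ?big_nil // big_cons intrD IH.
rewrite foldE /cartan_sum -(big_mkord xpredT (fun l => row_fun t l * (cartan_entry X l j)%:~R)).
rewrite /index_iota subn0 !big_seq; apply: eq_bigr => l; rewrite mem_iota add0n => /andP[_ lN].
by rewrite /row_fun lN intrM.
Qed.

Variable Phi : root_system N.
Hypothesis base : standard_base Phi.
Hypothesis red : reduced Phi.
Variable s : {perm 'I_N}.
Hypothesis hs : forall i j,
  pairing Phi (simple_root (s i)) (simple_root (s j)) = (cartan_entry X i j)%:~R.

Let isroot t := diagram_root Phi s (row_fun t).

Lemma grow_roots fuel T F : (forall t, t \in T -> isroot t) -> (forall t, t \in F -> isroot t) ->
  forall t, t \in grow fuel T F -> isroot t.
Proof.
elim: fuel T F => [|f IH] T F hT hF //=; set F' := undup _.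
have hF' t : t \in F' -> isroot t.
  rewrite mem_undup mem_filter => /andP[_ /allpairsP[[u j] /= [uF]]].
  rewrite mem_iota add0n => /andP[_ jN] ->.
  by rewrite /isroot -row_fun_reflect //; apply: diagram_root_reflect => //; exact: hF.
apply: IH => // t; rewrite mem_cat => /orP[]; [exact: hF'|exact: hT].
Qed.

Lemma root_rows_roots t : t \in root_rows -> isroot t.
Proof.
have h t' : t' \in [seq simple_row j | j <- iota 0 N] -> isroot t'.
  move=> /mapP[j]; rewrite mem_iota add0n => /andP[_ jN] ->.
  rewrite /isroot row_fun_simple.
  rewrite (_ : (fun k => _) = (fun k => (k == j)%:R)); first exact: diagram_root_simple.
  by apply/funext => k; case: eqP => [->|_]; rewrite ?jN ?andbF.
exact: grow_roots.
Qed.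

(** The positive roots belong to any list that contains the simple roots and is
    closed under simple reflections. *)
Lemma rows_bound a k : rows_bounded root_rows -> a \in roots Phi -> positive a ->
  (k < N)%N -> cf s a k <= (max_coefficient X)%:R.
Proof.
move=> /and4P[/allP h1 /allP h2 /allP h3 _] ra pa kN.
have : exists2 t, t \in root_rows & forall l, (l < N)%N -> cf s a l = row_fun t l.
  apply: (cf_induction base red hs (Q := fun c => exists2 t, t \in root_rows & forall l, (l < N)%N -> c l = row_fun t l)) => //.
    move=> j jN; exists (simple_row j); first by apply: h1; rewrite mem_iota.
    by move=> l lN; rewrite row_fun_simple lN.
  move=> j c jN c0 [t ht ct]; have -> : c = row_fun t.
    apply/funext => l; have [lN|lN] := ltnP l N; first exact: ct.
    by rewrite (c0 l lN) /row_fun (leq_gtF lN).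
  exists (row_reflect t j); last by rewrite row_fun_reflect.
  by have /allP := h2 t ht; apply; rewrite mem_iota.
move=> [t ht hk]; rewrite (hk k kN) /row_fun kN pmulrn ler_int.
by have /allP := h3 t ht; apply; rewrite mem_iota.
Qed.

Lemma rows_orders k : rows_bounded root_rows -> k \in dynkin_orders X ->
  quotient_orders Phi k.
Proof.
move=> /and4P[_ _ _ /allP h4] /h4 /andP[k0 /hasP[t ht /hasP[i iI /eqP e]]].
have iN : (i < N)%N by move: iI; rewrite mem_iota.
apply: (diagram_root_order base (root_rows_roots ht) iN _ k0).
by rewrite /row_fun iN e.
Qed.

End Exceptional.

Lemma exceptional_rows X : ~~ family X -> rows_bounded X (root_rows X).
Proof.
case: X => [n|n|n|n|||||] nf; try (by case/negP: nf); by vm_compute.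
Qed.

(** * The orders for each type *)

Section Assembly.

Variables (X : dynkin_type) (Phi : root_system (dynkin_rank X)).
Local Notation N := (dynkin_rank X).
Hypothesis valid : dynkin_valid X.
Hypothesis base : standard_base Phi.
Hypothesis red : reduced Phi.
Variable s : {perm 'I_N}.
Hypothesis hs : forall i j,
  pairing Phi (simple_root (s i)) (simple_root (s j)) = (cartan_entry X i j)%:~R.

Lemma rank_ge2 : (2 <= N)%N.
Proof. by case: (X) valid => //= n; exact: leq_trans. Qed.

Lemma coefficient_bound a k : a \in roots Phi -> positive a -> (k < N)%N ->
  cf s a k <= (max_coefficient X)%:R.
Proof.
move=> ra pa kN; have [fX|nX] := boolP (family X); last first.
  by apply: (rows_bound base red hs) => //; exact: exceptional_rows.
apply: family_bound => //; first exact: cf_large.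
apply: (cf_induction base red hs (Q := fun c => family_norm X c <= 2)) => //.
  by move=> j jN; exact: family_norm_simple.
by move=> j c jN c0; rewrite family_norm_reflect.
Qed.

Lemma cartan_sum_delta i j : (i < N)%N ->
  cartan_sum X (fun k => (k == i)%:R) j = (cartan_entry X i j)%:~R.
Proof.
move=> iN; rewrite /cartan_sum (bigD1 (Ordinal iN)) //= eqxx mul1r big1 ?addr0 // => l li.
by rewrite (_ : (l == i :> nat) = false) ?mul0r //; exact: negbTE.
Qed.

Lemma diagram_root_large c k : diagram_root Phi s c -> (N <= k)%N -> c k = 0.
Proof. by move=> [a _ <-]; exact: cf_large. Qed.

End Assembly.

Lemma diagram_connected X (Phi : root_system (dynkin_rank X)) (s : {perm 'I_(dynkin_rank X)}) :
  dynkin_valid X ->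
  (forall i j, pairing Phi (simple_root (s i)) (simple_root (s j)) = (cartan_entry X i j)%:~R) ->
  connected Phi.
Proof.
move=> valid hs; apply: (connected_of_diagram hs) => q.
have kS k : k != k.+1 by rewrite neq_ltn ltnSn.
have chain m : (forall k, (k.+1 < m)%N -> q k = q k.+1) -> forall k, (k < m)%N -> q k = q 0%N.
  by move=> h; elim=> [|k IH] // lk; rewrite -h // IH // ltnW.
case: X Phi s valid hs => [n|n|n|n|||||] Phi s valid hs h.
- by apply: (chain n) => k lk; exact: (h k k.+1 (ltnW lk) lk (kS k) (eqxx _)).
- by apply: (chain n) => k lk; exact: (h k k.+1 (ltnW lk) lk (kS k) (eqxx _)).
- by apply: (chain n) => k lk; exact: (h k k.+1 (ltnW lk) lk (kS k) (eqxx _)).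
- have c k : (k < n.-1)%N -> q k = q 0%N.
    apply: chain => {}k lk; have lk' : (k.+1 < n)%N by lia.
    by apply: (h k k.+1 (ltnW lk') lk' (kS k)); rewrite /dynkin_edge eqxx lk.
  have n4 : (4 <= n)%N by [].
  move=> k lk; have [e|ne] := eqVneq k n.-1; last by apply: c; move: lk ne; rewrite /dynkin_rank; lia.
  rewrite -(c (n - 3)%N) ?e; last by lia.
  have l1 : (n - 3 < n)%N by lia.
  have l2 : (n.-1 < n)%N by lia.
  have l3 : (n - 3)%N != n.-1 by lia.
  by rewrite (h _ _ l1 l2 l3) // /dynkin_edge !eqxx orbT.
- have e02 := h 0%N 2%N isT isT isT isT; have e13 := h 1%N 3%N isT isT isT isT.
  have e23 := h 2%N 3%N isT isT isT isT; have e34 := h 3%N 4%N isT isT isT isT.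
  have e45 := h 4%N 5%N isT isT isT isT.
  by move=> [|[|[|[|[|[|k]]]]]] lk; first [congruence | by []].
- have e02 := h 0%N 2%N isT isT isT isT; have e13 := h 1%N 3%N isT isT isT isT.
  have e23 := h 2%N 3%N isT isT isT isT; have e34 := h 3%N 4%N isT isT isT isT.
  have e45 := h 4%N 5%N isT isT isT isT; have e56 := h 5%N 6%N isT isT isT isT.
  by move=> [|[|[|[|[|[|[|k]]]]]]] lk; first [congruence | by []].
- have e02 := h 0%N 2%N isT isT isT isT; have e13 := h 1%N 3%N isT isT isT isT.
  have e23 := h 2%N 3%N isT isT isT isT; have e34 := h 3%N 4%N isT isT isT isT.
  have e45 := h 4%N 5%N isT isT isT isT; have e56 := h 5%N 6%N isT isT isT isT.
  have e67 := h 6%N 7%N isT isT isT isT.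
  by move=> [|[|[|[|[|[|[|[|k]]]]]]]] lk; first [congruence | by []].
- by apply: (chain 4%N) => k lk; exact: (h k k.+1 (ltnW lk) lk (kS k) (eqxx _)).
- by apply: (chain 2%N) => k lk; exact: (h k k.+1 (ltnW lk) lk (kS k) (eqxx _)).
Qed.

(** Explicit roots with a coefficient 2: the reflection of the simple root m in
    the simple root m + 1 for type B, that of m + 1 in m for type C, and for
    type D the highest root of the D4 subdiagram at the branch node m + 1. *)
Lemma order_two X (Phi : root_system (dynkin_rank X)) (s : {perm 'I_(dynkin_rank X)}) :
  dynkin_valid X -> standard_base Phi ->
  (forall i j, pairing Phi (simple_root (s i)) (simple_root (s j)) = (cartan_entry X i j)%:~R) ->
  family X -> (2 <= max_coefficient X)%N -> quotient_orders Phi 2.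
Proof.
case: X Phi s => [n|n|n|n|||||] // Phi s valid base hs _ _.
- case: n Phi s valid base hs => [|[|m]] // Phi s _ base hs.
  have r0 := diagram_root_simple base s (j := m) (leqnSn _).
  have r1 := diagram_root_reflect base hs (j := m.+1) (leqnn _) r0.
  apply: (diagram_root_order base r1 (i := m.+1)) => //.
  rewrite /reflect eqxx (@cartan_sum_delta (TypeB m.+2)) ?leqnSn // /cartan_entry /=.
  by decide_nat; rewrite /= opprK.
- case: n Phi s valid base hs => [|[|m]] // Phi s _ base hs.
  have r0 := diagram_root_simple base s (j := m.+1) (leqnn _).
  have r1 := diagram_root_reflect base hs (j := m) (leqnSn _) r0.
  apply: (diagram_root_order base r1 (i := m)) => //=.
  rewrite /reflect eqxx (@cartan_sum_delta (TypeC m.+2)) // /cartan_entry /=.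
  by decide_nat; rewrite /= opprK.
- case: n Phi s valid base hs => [|[|[|[|m]]]] // Phi s _ base hs.
  have l0 : (m < m.+4)%N by lia.
  have l1 : (m.+1 < m.+4)%N by lia.
  have l2 : (m.+2 < m.+4)%N by lia.
  have l3 : (m.+3 < m.+4)%N by lia.
  have r0 := diagram_root_simple base s (j := m.+1) l1.
  have r1 := diagram_root_reflect base hs (j := m) l0 r0.
  have r2 := diagram_root_reflect base hs (j := m.+2) l2 r1.
  have r3 := diagram_root_reflect base hs (j := m.+3) l3 r2.
  apply: (diagram_root_order base (diagram_root_reflect base hs (j := m.+1) l1 r3) l1) => //.
  have z0 := fun k => diagram_root_large (k := k) r0.
  have z1 := fun k => diagram_root_large (k := k) r1.
  have z2 := fun k => diagram_root_large (k := k) r2.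
  have z3 := fun k => diagram_root_large (k := k) r3.
  rewrite [LHS]/reflect eqxx (cartan_sum_D l1 z3); decide_nat.
  have E1 k : reflect (TypeD m.+4) (fun l => (l == m.+1)%:R) m k = (k == m.+1)%:R + (k == m)%:R.
    rewrite /reflect (cartan_sum_D l0 z0) prev_delta; have [->|km] := eqVneq k m.
      by decide_nat; rewrite /=; ring.
    by rewrite addr0.
  have E2 k : reflect (TypeD m.+4) (reflect (TypeD m.+4) (fun l => (l == m.+1)%:R) m) m.+2 k
      = (k == m.+1)%:R + (k == m)%:R + (k == m.+2)%:R.
    rewrite [LHS]/reflect (cartan_sum_D l2 z1) !E1; have [->|km] := eqVneq k m.+2.
      by decide_nat; rewrite /=; ring.
    by rewrite addr0.
  have E3 k : reflect (TypeD m.+4) (reflect (TypeD m.+4) (reflect (TypeD m.+4)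
      (fun l => (l == m.+1)%:R) m) m.+2) m.+3 k
      = (k == m.+1)%:R + (k == m)%:R + (k == m.+2)%:R + (k == m.+3)%:R.
    rewrite [LHS]/reflect (cartan_sum_D l3 z2) !E2; have [->|km] := eqVneq k m.+3.
      by decide_nat; rewrite /=; ring.
    by rewrite addr0.
  by rewrite !E3; decide_nat; rewrite /=; ring.
Qed.

Lemma period_bound_gt0 X : (0 < dynkin_period_bound X)%N.
Proof. by case: X. Qed.

Lemma lcm_dynkin_orders X :
  (\big[lcmn/1]_(k <- dynkin_orders X) k)%N = dynkin_period_bound X.
Proof. by case: X => *; rewrite !big_cons big_nil. Qed.

Lemma dynkin_orders_dvd X k : k \in dynkin_orders X -> (k %| dynkin_period_bound X)%N.
Proof. by move=> hk; rewrite -lcm_dynkin_orders (big_rem k) //= dvdn_lcml. Qed.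

Lemma dynkin_ordersE X k : (k \in dynkin_orders X) = (0 < k <= max_coefficient X)%N.
Proof.
by case: X => *; rewrite !inE /=; case: k => [|[|[|[|[|[|[|k]]]]]]].
Qed.

(** An order divides a coefficient of the highest root, which is at most
    [max_coefficient]; conversely, the coefficients of roots realize all the
    numbers up to this bound. *)
Lemma quotient_ordersE X (Phi : root_system (dynkin_rank X)) (s : {perm 'I_(dynkin_rank X)}) :
    dynkin_valid X -> standard_base Phi -> reduced Phi ->
    (forall i j, pairing Phi (simple_root (s i)) (simple_root (s j)) = (cartan_entry X i j)%:~R) ->
  quotient_orders Phi = [set` dynkin_orders X].
Proof.
move=> valid base red hs; have n0 : (0 < dynkin_rank X)%N := ltnW (rank_ge2 valid).
apply/seteqP; split=> k /=; last first.
  have [fX|nX] := boolP (family X); last exact: (rows_orders base hs (exceptional_rows nX)).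
  rewrite dynkin_ordersE => /andP[k0 km].
  have k2 : (k <= 2)%N by apply: leq_trans km _; case: (X) fX.
  case: k k0 km k2 => [|[|[|k]]] // _ km _; first exact: order_one.
  exact: (order_two valid base hs).
move=> hk; rewrite dynkin_ordersE.
have k0 : (0 < k)%N by case: hk => S [v [_ _ []]].
have [theta rt mt] := highest_root base (diagram_connected valid hs) n0.
have t1 := theta_ge1 base mt.
rewrite k0 /=; have [->|[i [c [ec kc]]]] := quotient_order_dvd base rt mt n0 hk.
  by case: (X).
have pt : positive theta by move=> j; rewrite (le_trans ler01).
have := coefficient_bound valid base red hs rt pt (ltn_ord ((s^-1)%g i)).
rewrite cf_ord permKV ec ler_nat; apply: leq_trans; apply: dvdn_leq => //.
by have := t1 i; rewrite ec ler1n.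
Qed.

Theorem proposition5p1 (R : realType) (X : dynkin_type)
    (Phi : root_system (dynkin_rank X)) :
  dynkin_valid X -> irreducible Phi -> reduced Phi -> standard_base Phi ->
  has_type Phi ->
  (exists s : seq nat, quotient_orders Phi = [set` s] /\
     kostant_period_divides R Phi (\big[lcmn/1%N]_(k <- s) k)) /\
  (quotient_orders Phi = [set` dynkin_orders X] /\
     kostant_period_divides R Phi (dynkin_period_bound X)).
Proof.
move=> valid _ red base [s hs].
have ordersE := quotient_ordersE valid base red hs.
have period : kostant_period_divides R Phi (dynkin_period_bound X).
  have n0 := ltnW (rank_ge2 valid).
  apply: (kostant_period base) => //; first exact: period_bound_gt0.
  move=> M hM i; apply: (orders_basis_lattice base n0 _ hM) => k.
  by rewrite ordersE => /dynkin_orders_dvd.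
by split=> //; exists (dynkin_orders X); rewrite lcm_dynkin_orders.
Qed.
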